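(* Let $n\in\mathbb{N}$, fix $1<p\le q<\infty$ and $0<\alpha<n$ with $\Theta_{p,q}(\alpha):=\alpha+n\left(\frac1q-\frac1p\right)>0$. Let $E\subset\mathbb{R}^n$ with $0<\operatorname{diam}(E)<\infty$ be a median porous set. Then, for any exponents $\gamma_1,\gamma_2,\delta_1,\delta_2\in\mathbb{R}$ verifying $$-\gamma_j\in I_\infty(E)\quad\text{and}\quad \delta_j\,p'/p\in I_\infty(E)\qquad\text{for } j=1,2,$$ $$\overline{\dim}_M(E)-n<\frac{n}{\Theta_{p,q}(\alpha)}\left(\frac{\gamma_1}{q}-\frac{\delta_1}{p}\right)<0,$$ and $$\frac{\delta_2}{p}-\frac{\gamma_2}{q}=\Theta_{p,q}(\alpha),$$ there exists $C>0$, depending only on $\gamma_1,\gamma_2,\delta_1,\delta_2,p,q,\alpha,n$, and $E$, such that $$\left(\int_{\mathbb{R}^n}|I_\alpha(f)(x)|^q\,u_{\gamma_1,\gamma_2}(x)\,dx\right)^{1/q}\le C\left(\int_{\mathbb{R}^n}|f(x)|^p\,u_{\delta_1,\delta_2}(x)\,dx\right)^{1/p}$$ for every measurable $f$.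
   Context: Here $p'=p/(p-1)$, $d(x,E)=\inf\{|x-y|:y\in E\}$ and $\operatorname{diam}(E)=\sup\{|x-y|:x,y\in E\}$. The fractional integral operator is $I_\alpha(f)(x)=\int_{\mathbb{R}^n}\frac{f(y)}{|x-y|^{n-\alpha}}\,dy$. The class $A_\infty(\mathbb{R}^n)$ consists of the weights $w$ (i.e. $w\in L^1_{\rm loc}(\mathbb{R}^n)$, $w\ge0$ a.e.) with $\sup_Q\left(\frac{1}{|Q|}\int_Q w\right)\exp\left(-\frac{1}{|Q|}\int_Q\ln w\right)<\infty$, the supremum over all cubes $Q\subset\mathbb{R}^n$. For nonempty $E\subset\mathbb{R}^n$ set $I_\infty(E):=\{\beta\in\mathbb{R}: d(\cdot,E)^{-\beta}\in A_\infty(\mathbb{R}^n)\}$; $E$ is called median porous if there exists $\beta>0$ with $d(\cdot,E)^{-\beta}\in A_\infty(\mathbb{R}^n)$. The upper Minkowski dimension of a bounded set $E$ is $\overline{\dim}_M(E)=\limsup_{\delta\to0^+}\frac{\log N(E,\delta)}{\log(1/\delta)}$, where $N(E,\delta)$ is the smallest number of closed balls of radius $\delta$ needed to cover $E$. For $\gamma_1,\gamma_2\in\mathbb{R}$ the weight $u_{\gamma_1,\gamma_2}$ is defined for $x\in\mathbb{R}^n\setminus E$ (it is well defined a.e. when $E$ is median porous, since then $|\overline{E}|=0$) by $u_{\gamma_1,\gamma_2}(x)=\left(\frac{d(x,E)}{\operatorname{diam}(E)}\right)^{\gamma_1}$ if $d(x,E)<\operatorname{diam}(E)$ and $u_{\gamma_1,\gamma_2}(x)=\left(\frac{d(x,E)}{\operatorname{diam}(E)}\right)^{\gamma_2}$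 if $d(x,E)\ge\operatorname{diam}(E)$. *)

(* Defs.v *)
From HB Require Import structures.
From mathcomp Require Import all_boot all_order all_algebra.
From mathcomp Require Import all_classical all_reals all_analysis.

Set Implicit Arguments.
Unset Strict Implicit.
Unset Printing Implicit Defensive.

Import Order.TTheory GRing.Theory Num.Theory.
Import numFieldNormedType.Exports.

Local Open Scope classical_set_scope.
Local Open Scope ring_scope.

(* Lebesgue measure on R^n: the n-fold product of the one-dimensional measure
   on Borel sets, then its Caratheodory completion. *)

Section borel_lebesgue.
Context {R : realType}.
Local Notation RB := (measurableTypeR R).

Definition cons_pair n (z : RB * n.-tuple RB) : n.+1.-tuple RB :=
  [tuple of z.1 :: z.2].

Lemma measurable_cons_pair n :
  measurable_fun [set: RB * n.-tuple RB] (@cons_pair n).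
Proof. exact: measurable_cons measurable_fst measurable_snd. Qed.

Section cons_measure.
Variables (n : nat) (m : {measure set (n.-tuple RB) -> \bar R}).

Definition cons_measure : set (n.+1.-tuple RB) -> \bar R :=
  pushforward (@lebesgue_measure R \x^ m)%E (@cons_pair n).

HB.instance Definition _ := isMeasurableFun.Build _ _ _ _
  (@cons_pair n) (@measurable_cons_pair n).

Let cons_measure0 : cons_measure set0 = 0%E.
Proof. by rewrite /cons_measure/pushforward preimage_set0 measure0. Qed.

Let cons_measure_ge0 A : (0 <= cons_measure A)%E.
Proof. exact: measure_ge0. Qed.

Let cons_measure_sigma_additive : semi_sigma_additive cons_measure.
Proof. exact: (measure_semi_sigma_additive (s := _)). Qed.

HB.instance Definition _ := isMeasure.Build _ _ _ cons_measure
  cons_measure0 cons_measure_ge0 cons_measure_sigma_additive.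

End cons_measure.

Fixpoint borel_lebesgue n : {measure set (n.-tuple RB) -> \bar R} :=
  if n is n'.+1 then cons_measure (borel_lebesgue n') else \d_([tuple]).

Lemma borel_lebesgue_rect n (A : 'I_n -> set RB) :
  (forall i, measurable (A i)) ->
  borel_lebesgue n [set x | forall i, A i (tnth x i)] =
  (\prod_(i < n) lebesgue_measure (A i))%E.
Proof.
elim: n A => [A _|n IH A mA].
  rewrite big_ord0 /= (_ : [set x | _] = setT) ?diracT//.
  by apply/seteqP; split => // x _ [].
have mB : measurable [set x : n.-tuple RB | forall i, A (lift ord0 i) (tnth x i)].
  rewrite (_ : [set x | _] =
      \bigcap_(i in [set: 'I_n]) ((@tnth n RB)^~ i @^-1` A (lift ord0 i))).
    apply: fin_bigcap_measurable => // i _.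
    by rewrite -[X in measurable X]setTI; exact: measurable_tnth.
  by apply/seteqP; split => [x h i _|x h i]; [exact: h|exact: h].
rewrite big_ord_recl -IH; last by move=> i; exact: mA.
rewrite -product_measure2E//= /cons_measure /pushforward.
congr (product_measure2 _ _ _); apply/seteqP; split => -[x t] /=.
  move=> h; split; first by have := h ord0; rewrite tnth0.
  by move=> i; have := h (lift ord0 i); rewrite tnthS.
move=> [h0 h] i; case: (unliftP ord0 i) => [j ->|->].
  by rewrite /cons_pair/= tnthS.
by rewrite tnth0.
Qed.

End borel_lebesgue.

Definition lebesgue_outer (R : realType) (n : nat) :
    {outer_measure set (n.-tuple (measurableTypeR R)) -> \bar R} :=
  ((@borel_lebesgue R n)^*)%mu.

(* R^n with the sigma-algebra of Lebesgue measurable sets; the display is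
   opaque to keep terms small *)
Definition euclid (R : realType) (n : nat) : Type :=
  n.-tuple (measurableTypeR R).

Fact euclid_display (R : realType) (n : nat) : measure_display.
Proof. exact: caratheodory_display (lebesgue_outer R n). Qed.

HB.instance Definition _ R n := Pointed.on (euclid R n).
HB.instance Definition _ R n := @isMeasurable.Build (euclid_display R n)
  (euclid R n) (lebesgue_outer R n).-caratheodory
  (caratheodory_measurable_set0 (lebesgue_outer R n))
  (@caratheodory_measurable_setC _ _ (lebesgue_outer R n))
  (@caratheodory_measurable_bigcup _ _ (lebesgue_outer R n)).

Definition vol {R : realType} {n : nat} : set (euclid R n) -> \bar R :=
  lebesgue_outer R n.
HB.instance Definition _ R n := isMeasure.Build (euclid_display R n)
  (euclid R n) R (@vol R n)
  (@caratheodory_measure0 _ _ (lebesgue_outer R n))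
  (@caratheodory_measure_ge0 _ _ (lebesgue_outer R n))
  (@caratheodory_measure_sigma_additive _ _ (lebesgue_outer R n)).

Lemma vol_box (R : realType) n (a b : 'I_n -> R) :
  (forall i, a i <= b i) ->
  vol [set x : euclid R n | forall i, a i <= tnth x i <= b i] =
  (\prod_(i < n) (b i - a i))%:E.
Proof.
move=> ab; pose A i : set (measurableTypeR R) := `[a i, b i]%classic.
have AE : [set x : euclid R n | forall i, a i <= tnth x i <= b i] =
    [set x | forall i, A i (tnth x i)].
  by apply/seteqP; split => x /= h i; have := h i; rewrite /A/= in_itv.
have mA i : measurable (A i) by exact: measurable_itv.
have mAA : measurable [set x : n.-tuple (measurableTypeR R) | forall i, A i (tnth x i)].
  rewrite (_ : [set x | _] =
      \bigcap_(i in [set: 'I_n]) ((@tnth n (measurableTypeR R))^~ i @^-1` A i)).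
    apply: fin_bigcap_measurable => // i _.
    by rewrite -[X in measurable X]setTI; exact: measurable_tnth.
  by apply/seteqP; split => [x h i _|x h i]; [exact: h|exact: h].
rewrite AE /vol /lebesgue_outer /= measurable_mu_extE//.
rewrite [LHS](borel_lebesgue_rect mA) -prodEFin; apply: eq_bigr => i _.
rewrite lebesgue_measure_itv/= lte_fin; case: ltP => // ba.
by apply/eqP; rewrite eq_sym eqe subr_eq0 eq_le ab ba.
Qed.

Section geometry.
Context {R : realType} {n : nat}.
Implicit Types (x y : euclid R n) (E : set (euclid R n)).

Definition eudist x y : R :=
  Num.sqrt (\sum_(i < n) (tnth x i - tnth y i) ^+ 2).

Definition dist_to E x : R := inf [set eudist x y | y in E].

Definition diam E : \bar R :=
  ereal_sup [set (eudist z.1 z.2)%:E | z in E `*` E].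

Definition cube x (l : R) : set (euclid R n) :=
  [set y | forall i, tnth x i <= tnth y i <= tnth x i + l].

Definition cball x (r : R) : set (euclid R n) := [set y | eudist x y <= r].

(* the infimum of the empty set is +oo: no finite cover *)
Definition covering_number E (delta : R) : \bar R :=
  ereal_inf [set k%:R%:E | k in [set k : nat |
    exists c : 'I_k -> euclid R n, E `<=` \bigcup_i cball (c i) delta]].

Definition upper_minkowski_dim E : \bar R :=
  limf_esup (fun delta : R =>
    (lne (covering_number E delta) * (ln delta^-1)^-1%:E)%E) 0^'+.

End geometry.

(* Unlike in [powR], 0 to a negative power is +oo. *)
Definition powRe {R : realType} (a r : R) : \bar R :=
  if (a == 0) && (r < 0) then +oo%E else (a `^ r)%:E.

Section weights.
Context {R : realType} {n : nat}.
Implicit Types (w : euclid R n -> \bar R) (E : set (euclid R n)).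

Definition avg w (Q : set (euclid R n)) : \bar R :=
  ((vol Q)^-1 * \int[vol]_(x in Q) w x)%E.

(* Integrability on all cubes is local integrability, since every compact set
   is contained in a cube. *)
Definition weight w : Prop :=
  {ae @vol R n, forall x, (0 <= w x)%E} /\
  forall x (l : R), 0 < l -> (@vol R n).-integrable (cube x l) w.

Definition A_infty w : Prop :=
  weight w /\
  (ereal_sup [set (avg w Q * expeR (- avg (fun x => lne (w x)) Q))%E |
     Q in [set Q | exists x (l : R), (0 < l)%R /\ Q = cube x l]] < +oo)%E.

Definition I_infty E : set R :=
  [set beta | A_infty (fun x => powRe (dist_to E x) (- beta))].

Definition median_porous E : Prop :=
  exists beta : R, 0 < beta /\ I_infty E beta.

Definition uweight E (gamma1 gamma2 : R) (x : euclid R n) : \bar R :=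
  let D := fine (diam E) in
  if dist_to E x < D then powRe (dist_to E x / D) gamma1
  else powRe (dist_to E x / D) gamma2.

Definition riesz (alpha : R) (f : euclid R n -> R) (x : euclid R n) : \bar R :=
  (\int[vol]_y (f y / eudist x y `^ (n%:R - alpha))%:E)%E.

End weights.

Definition Theta {R : realType} (n : nat) (p q alpha : R) : R :=
  alpha + n%:R * (q^-1 - p^-1).

Definition conj_exp {R : realType} (p : R) : R := p / (p - 1).

(* Main.v *)
Require Import Defs.
From mathcomp Require Import all_boot all_order all_algebra.
From mathcomp Require Import all_classical all_reals all_analysis.
From mathcomp Require Import measurable_realfun ring lra.
Import Order.TTheory GRing.Theory Num.Theory.
Import numFieldNormedType.Exports.
Local Open Scope classical_set_scope.
Local Open Scope ring_scope.

Set Implicit Arguments.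
Unset Strict Implicit.
Unset Printing Implicit Defensive.

(** The weight [w := uweight E gamma1 gamma2] and the dual weight [sigma],
    which is [uweight E delta1 delta2] to the power [1 - p'], are functions of
    [d := dist_to E].  The inequality is derived from two properties of such
    weights.

    On a cube [Q] of side [l] let [m] be a median of [d].  For a weight of
    A_infty the mass of [Q] is controlled by the mass of any part of [Q] that
    has a fixed proportion of the volume ([A_infty_dense_part]).  Applied to a
    power [d^s] and to the half of [Q] where [d] is at most, or at least, about
    [m], this bounds the mean of [d^s] over [Q] by a multiple of [m^s]
    ([integral_pow_le]).  Median porosity gives such a bound for one negative
    exponent, and then [d] is comparable to [m] on most of [Q]
    ([concentration]).  Hence the mean over [Q], or over half of [Q], of a
    weight that is one power of [d] below [diam E] and another above it is
    comparable to the value of that weight at [d = m] ([integral_two_pow_le],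
    [integral_two_pow_ge]).  This has two consequences.

    First, half of a cube always carries a fixed part of the mass of [w] and of
    [sigma] ([half_part_two_pow]).  Second, the necessary condition
    [l^(alpha - n) * w(Q)^(1/q) * sigma(Q)^(1/p') <= K] on all cubes
    ([cube_Apq]) becomes a condition on [l] and [m] alone.  With
    [kappa := - n / Theta * (gamma1/q - delta1/p)] it reads [l <= C m] when
    [m >= diam E], by the equation between [gamma2] and [delta2], and
    [l^n <= C m^kappa] when [m < diam E].  Both hold because half of [Q] lies
    in the set where [d <= 2m]: this set has volume of order [m^n] in the first
    case, and in the second at most of order [m^n] times the number of balls of
    radius [m] that cover [E], which is less than [m^(kappa - n)] for small [m]
    since the Minkowski dimension is less than [n - kappa]
    ([median_cube_bound]).

    These two properties imply the weighted inequality.  For the operator that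
    adds up multiples of the means of [f] over the dyadic ancestors of a point,
    only the ancestors whose mean is more than twice that of the last selected
    one matter, the others contributing geometric sums ([sum_avg_le]).  At
    least half of a selected cube meets no smaller selected cube
    ([principal_sparse]), so sums of [w]-masses or [sigma]-masses of selected
    cubes are dominated by those of disjoint sets ([principal_carleson]).
    Duality for the exponent [q], the maximal inequality [doob] for [w] and for
    [sigma], and the cube condition on each selected cube then give the
    inequality on a finite tree ([discrete_two_weight]).

    Finally, two points at distance about [l] lie in a common cube of side
    comparable to [l] of one of [2^n] dyadic grids, translates of each other by
    thirds ([third_trick]); so a truncated kernel is dominated by finitely many
    operators of the preceding kind ([truncated_riesz_le]), with a bound
    independent of the truncation.  Fatou's lemma removes the truncation, once
    for the integral defining the operator ([riesz_lt_grids]) and once for the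
    weighted norm ([riesz_two_weight]). *)

(** * Elementary inequalities for real powers *)

Section inequalities.
Context {R : realType}.
Implicit Types a b r eps : R.

(** Whichever of a and eps * b is larger, one of the two terms on the right
    dominates. The parameter eps lets the term in b be absorbed later. *)
Lemma young_eps a b r eps : 0 <= a -> 0 <= b -> 1 < r -> 0 < eps ->
  a * b `^ (r - 1) <= eps * b `^ r + eps `^ (1 - r) * a `^ r.
Proof.
move=> a0 b0 r1 e0.
have [ab|ba] := leP a (eps * b).
  rewrite -[leLHS]addr0; apply: lerD; last by rewrite mulr_ge0 ?powR_ge0.
  rewrite -(@mulr_powRB1 _ b r) ?mulrA//; last by lra.
  by rewrite ler_wpM2r ?powR_ge0.
rewrite -[leLHS]add0r; apply: lerD; first by rewrite mulr_ge0 ?powR_ge0// ltW.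
rewrite -(@mulr_powRB1 _ a r)//; last by lra.
rewrite [leRHS](_ : _ = a * (eps `^ (1 - r) * a `^ (r - 1))); last by ring.
apply: ler_wpM2l => //; rewrite (_ : 1 - r = - (r - 1)); last by ring.
rewrite powRN mulrC ler_pdivlMr ?powR_gt0// mulrC -powRM ?(ltW e0)//.
by rewrite ge0_ler_powR ?nnegrE ?mulr_ge0 ?(ltW e0) ?(ltW ba)//; lra.
Qed.

(** A discrete chain rule: by convexity both sides compare with the
    differential r b^(r-1) db. Summed along the increasing values of a running
    maximum, it yields the maximal inequality. *)
Lemma ler_powRB a b r : 0 <= a -> a <= b -> 1 < r ->
  b `^ r - a `^ r <= r / (r - 1) * b * (b `^ (r - 1) - a `^ (r - 1)).
Proof.
move=> a0 ab r1.
have b0 : 0 <= b by lra.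
have Hr : 0 < r - 1 by lra.
have r0 : r != 0 by apply/eqP; lra.
have r10 : r - 1 != 0 by apply/eqP; lra.
have := @conjugate_powR _ b (a `^ (r - 1)) r (r / (r - 1)) b0 (powR_ge0 _ _).
rewrite -powRrM (_ : (r - 1) * _ = r); last by field.
have rr : r^-1 + (r / (r - 1))^-1 = 1 by field; rewrite r0 r10.
move=> /(_ _ _ rr); rewrite divr_gt0//; last by lra.
move=> /(_ ltac:(lra) isT) H.
have H2 : r / (r - 1) * (b * a `^ (r - 1)) <= (r - 1)^-1 * b `^ r + a `^ r.
  rewrite [leRHS](_ : _ = r / (r - 1) * (b `^ r / r + a `^ r / (r / (r - 1)))).
    by rewrite ler_wpM2l// divr_ge0; lra.
  by field; rewrite r0 r10.
rewrite [leRHS](_ : _ = r / (r - 1) * (b * b `^ (r - 1)) -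
  r / (r - 1) * (b * a `^ (r - 1))); last by ring.
rewrite mulr_powRB1//; last by lra.
have -> : r / (r - 1) * b `^ r = b `^ r + (r - 1)^-1 * b `^ r by field.
lra.
Qed.

(** The power r is above its tangent line at b. Integrated with b the mean of
    a, this is Jensen's inequality. *)
Lemma young_tangent a b r : 0 <= a -> 0 <= b -> 1 < r ->
  r * (a * b `^ (r - 1)) <= a `^ r + (r - 1) * b `^ r.
Proof.
move=> a0 b0 r1.
have Hr : 0 < r - 1 by lra.
have r0 : r != 0 by apply/eqP; lra.
have r10 : r - 1 != 0 by apply/eqP; lra.
have := @conjugate_powR _ a (b `^ (r - 1)) r (r / (r - 1)) a0 (powR_ge0 _ _).
rewrite -powRrM (_ : (r - 1) * _ = r); last by field.
have rr : r^-1 + (r / (r - 1))^-1 = 1 by field; rewrite r0 r10.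
move=> /(_ ltac:(lra)); rewrite divr_gt0//; last by lra.
move=> /(_ isT rr) H.
rewrite [leRHS](_ : _ = r * (a `^ r / r + b `^ r / (r / (r - 1)))).
  by rewrite ler_wpM2l//; lra.
by field; rewrite r0 r10.
Qed.

End inequalities.

Lemma ler_powR_base {R : realType} (r a b : R) : 0 <= r -> 0 <= a -> a <= b ->
  a `^ r <= b `^ r.
Proof.
by move=> r0 a0 ab; rewrite ge0_ler_powR ?nnegrE//; exact: le_trans ab.
Qed.

(** Each term is at most the q-th root of the sum of the q-th powers. *)
Lemma sum_powR_le {R : realType} (I : finType) (a : I -> R) (q : R) :
  (forall i, 0 <= a i) -> 0 < q ->
  (\sum_i a i) `^ q <= (#|I|%:R `^ q) * \sum_i a i `^ q.
Proof.
move=> a0 q0; set S := \sum_i a i `^ q.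
have S0 : 0 <= S by apply: sumr_ge0 => i _; exact: powR_ge0.
have aS i : a i <= S `^ q^-1.
  have -> : a i = (a i `^ q) `^ q^-1 by rewrite -powRrM divff ?gt_eqF// powRr1.
  apply: ler_powR_base; rewrite ?powR_ge0 ?invr_ge0 ?(ltW q0)//.
  by rewrite /S (bigD1 i)//= lerDl sumr_ge0// => j _; exact: powR_ge0.
have -> : S = (S `^ q^-1) `^ q by rewrite -powRrM mulVf ?gt_eqF// powRr1.
rewrite -powRM ?powR_ge0//; apply: ler_powR_base; first exact: ltW.
  exact: sumr_ge0.
apply: (le_trans (ler_sum _ (fun i _ => aS i))).
by rewrite sumr_const mulr_natl.
Qed.

(** * Powers with one exponent near zero and another near infinity *)

Section powers.
Context {R : realType}.
Implicit Types (s t tau K a b : R).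

Lemma powR_le_nneg s t tau K : 0 <= s -> 0 <= t -> 0 <= tau -> 0 <= K ->
  t <= K * tau -> t `^ s <= K `^ `|s| * tau `^ s.
Proof.
move=> s0 t0 tau0 K0 H; rewrite ger0_norm// -powRM//.
by rewrite ge0_ler_powR ?nnegrE// mulr_ge0.
Qed.

Lemma powR_le_npos s t tau K : s <= 0 -> 0 < t -> 0 < tau -> 0 <= K ->
  tau <= K * t -> t `^ s <= K `^ `|s| * tau `^ s.
Proof.
move=> s0 t0 tau0 K0 H; rewrite ler0_norm//.
rewrite -{1 3}[s]opprK !(powRN _ (- s)) ler_pdivlMr ?powR_gt0//.
rewrite ler_pdivrMl ?powR_gt0// mulrC -powRM ?(ltW t0)//.
by rewrite ge0_ler_powR ?nnegrE ?mulr_ge0 ?(ltW t0) ?(ltW tau0)//; lra.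
Qed.

Lemma powR_le_scale s t tau K : 0 < t -> 0 < tau -> 0 <= K ->
  t <= K * tau -> tau <= K * t -> t `^ s <= K `^ `|s| * tau `^ s.
Proof.
move=> t0 tau0 K0 H1 H2; have [s0|/ltW s0] := leP 0 s.
  by apply: powR_le_nneg; rewrite ?(ltW t0) ?(ltW tau0).
exact: powR_le_npos.
Qed.

(** As a function of t = dist_to E x / diam E, this is the profile of the
    weights of the theorem. *)
Definition two_pow a b t := if t < 1 then t `^ a else t `^ b.

Lemma two_pow_ge0 a b t : 0 <= two_pow a b t.
Proof. by rewrite /two_pow; case: ifP => _; exact: powR_ge0. Qed.

Lemma two_pow_gt0 a b t : 0 < t -> 0 < two_pow a b t.
Proof. by move=> t0; rewrite /two_pow; case: ifP => _; exact: powR_gt0. Qed.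

Lemma le_max_two_pow a b t : 0 <= t ->
  two_pow a b t <= t `^ a + t `^ b.
Proof.
by move=> t0; rewrite /two_pow; case: ifP => _; rewrite ?lerDl ?lerDr powR_ge0.
Qed.

(** Powers of t are ordered oppositely on the two sides of 1: for b < a the
    profile is the smaller of its two powers, and for a <= b, in the next
    lemma, the larger one. Upper bounds for means are proved separately in the
    two cases. *)
Lemma two_pow_min a b t : b < a -> 0 < t ->
  two_pow a b t <= t `^ a /\ two_pow a b t <= t `^ b.
Proof.
move=> ba t0; rewrite /two_pow; case: ltP => t1; split => //.
  by rewrite ger_powR ?t0 ?(ltW t1)// ltW.
by rewrite ler_powR// ltW.
Qed.

Lemma two_pow_max a b t : a <= b -> 0 < t ->
  t `^ a <= two_pow a b t /\ t `^ b <= two_pow a b t.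
Proof.
move=> ba t0; rewrite /two_pow; case: ltP => t1; split => //.
  by rewrite ger_powR ?t0 ?(ltW t1).
by rewrite ler_powR.
Qed.

(** The value at 1 of both powers is 1, so a bounded change of t changes the
    profile by a bounded factor even across 1. *)
Lemma two_pow_scale a b t tau K : 0 < t -> 0 < tau -> 1 <= K ->
  t <= K * tau -> tau <= K * t ->
  two_pow a b tau <= K `^ (`|a| + `|b|) * two_pow a b t.
Proof.
move=> t0 tau0 K1 H1 H2; have K0 : 0 <= K by lra.
set M := K `^ _.
have M0 : 0 <= M by exact: powR_ge0.
have Ma : tau `^ a <= M * t `^ a.
  apply: (le_trans (powR_le_scale a tau0 t0 K0 H2 H1)).
  by rewrite ler_wpM2r ?powR_ge0// ler_powR// lerDl.
have Mb : tau `^ b <= M * t `^ b.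
  apply: (le_trans (powR_le_scale b tau0 t0 K0 H2 H1)).
  by rewrite ler_wpM2r ?powR_ge0// ler_powR// lerDr.
have [ab|ba] := leP a b.
  have [H3 H4] := two_pow_max ab t0.
  rewrite {1}/two_pow; case: ifP => _.
    by apply: (le_trans Ma); rewrite ler_wpM2l.
  by apply: (le_trans Mb); rewrite ler_wpM2l.
have [H3 H4] := two_pow_min ba tau0.
rewrite [X in _ <= _ * X]/two_pow; case: ifP => _; first exact: le_trans Ma.
exact: le_trans Mb.
Qed.

End powers.

(** * Conditional means along nested partitions *)

Section martingale.
Context {R : realType} {T : finType} (N : nat) (e : nat -> rel T).
Hypothesis e_refl : forall j, reflexive (e j).
Hypothesis e_sym : forall j, symmetric (e j).
Hypothesis e_trans : forall j, transitive (e j).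
Hypothesis e_nest : forall j x y, e j x y -> e j.+1 x y.

Implicit Types (mu f g h phi : T -> R) (j k : nat) (x y : T).

Lemma e_mono i j x y : (i <= j)%N -> e i x y -> e j x y.
Proof.
elim: j => [|j IH]; first by rewrite leqn0 => /eqP ->.
by rewrite leq_eqVlt => /orP[/eqP -> //|/IH h /h]; exact: e_nest.
Qed.

(** The relation e j x y says that x and y have the same ancestor at level j,
    so this is the mu-mass of the level-j ancestor of x. Levels become coarser
    as j grows. *)
Definition class_sum mu j x := \sum_(y | e j x y) mu y.

(** Conditional expectation of g, for the measure mu, given the partition of
    level j. *)
Definition class_mean mu j g x := class_sum (fun y => mu y * g y) j x / class_sum mu j x.

Definition adapted j phi := forall x y, e j x y -> phi x = phi y.

Lemma class_sum_adapted mu j : adapted j (class_sum mu j).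
Proof.
move=> x y xy; apply: eq_bigl => z; apply/idP/idP.
  by apply: e_trans; rewrite e_sym.
exact: e_trans.
Qed.

Lemma class_mean_adapted mu j g : adapted j (class_mean mu j g).
Proof. by move=> x y xy; rewrite /class_mean !(class_sum_adapted _ xy). Qed.

Lemma adapted_op2 j phi psi (op : R -> R -> R) : adapted j phi -> adapted j psi ->
  adapted j (fun x => op (phi x) (psi x)).
Proof. by move=> a b x y xy; rewrite (a _ _ xy) (b _ _ xy). Qed.

Lemma class_sum_gt0 mu j x : (forall x, 0 < mu x) -> 0 < class_sum mu j x.
Proof.
move=> mu0; rewrite /class_sum (bigD1 x) ?e_refl//=.
by rewrite ltr_pwDl// sumr_ge0// => y _; exact: ltW.
Qed.

Lemma class_mean_ge0 mu j g x : (forall x, 0 < mu x) -> (forall x, 0 <= g x) ->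
  0 <= class_mean mu j g x.
Proof.
move=> mu0 g0; apply: divr_ge0; last by rewrite ltW ?class_sum_gt0.
by apply: sumr_ge0 => y _; rewrite mulr_ge0// ltW.
Qed.

(** Averaging over the classes of a partition is self-adjoint and fixes the
    functions that are constant on the classes. *)
Lemma sum_class_mean mu j g phi : (forall x, 0 < mu x) -> adapted j phi ->
  \sum_x mu x * (phi x * class_mean mu j g x) = \sum_x mu x * (phi x * g x).
Proof.
move=> mu0 aphi.
transitivity (\sum_x \sum_(y | e j x y)
    (mu x * phi x * (mu y * g y) / class_sum mu j x)).
  by apply: eq_bigr => x _; rewrite -mulr_suml -mulr_sumr /class_mean /class_sum; ring.
rewrite (exchange_big_dep xpredT)//=; apply: eq_bigr => y _.
transitivity (\sum_(x | e j y x) mu x * (phi y * g y * mu y / class_sum mu j y)).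
  apply: eq_big => x; first exact: e_sym.
  by move=> xy; rewrite (aphi _ _ xy) (class_sum_adapted _ xy); ring.
rewrite -mulr_suml -/(class_sum mu j y); field.
by rewrite gt_eqF// class_sum_gt0.
Qed.

(** The maximal function of h restricted to the levels from j on; it decreases
    to 0 as j reaches N, which makes telescoping sums over the levels
    complete. *)
Definition running_max mu h j x : R := \big[Num.max/0]_(j <= i < N) class_mean mu i h x.

Lemma running_maxN mu h x : running_max mu h N x = 0.
Proof. by rewrite /running_max big_geq. Qed.

Lemma running_maxS mu h j x : (j < N)%N ->
  running_max mu h j x = Num.max (class_mean mu j h x) (running_max mu h j.+1 x).
Proof. by move=> jN; rewrite /running_max big_ltn. Qed.

Lemma running_max_ge0 mu h j x : 0 <= running_max mu h j x.
Proof.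
rewrite /running_max; elim/big_rec: _ => // i a _ a0.
by rewrite le_max a0 orbT.
Qed.

Lemma le_running_max mu h j x : (j < N)%N -> class_mean mu j h x <= running_max mu h 0 x.
Proof.
move=> jN; rewrite /running_max (bigD1_seq j) ?mem_index_iota ?iota_uniq//=.
by rewrite le_max lexx.
Qed.

Lemma running_max_adapted mu h j : adapted j (running_max mu h j).
Proof.
move=> x y xy; apply: eq_big_nat => i /andP[ji _].
exact: class_mean_adapted (e_mono ji xy).
Qed.

Lemma sum_nat_telescope (F : nat -> R) m :
  \sum_(j < m) (F j - F j.+1) = F 0%N - F m.
Proof.
elim: m => [|m IH]; first by rewrite big_ord0 subrr.
by rewrite big_ord_recr/= IH; ring.
Qed.

(** Doob's maximal inequality, proved along each path: ler_powRB bounds the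
    increment of M^r at level j by the mean of h times the increment of
    M^(r-1). The latter is constant on the classes, so the mean may be
    replaced by h and the sum over the levels telescopes to h M^(r-1);
    young_eps then absorbs M^r. *)
Lemma doob mu h r : (forall x, 0 < mu x) -> (forall x, 0 <= h x) -> 1 < r ->
  \sum_x mu x * running_max mu h 0 x `^ r <=
  2 * (r / (r - 1) * (2 * (r / (r - 1))) `^ (r - 1)) * \sum_x mu x * h x `^ r.
Proof.
move=> mu0 h0 r1.
pose M := running_max mu h; pose c := r / (r - 1).
have r10 : 0 < r - 1 by lra.
have r0 : r != 0 by apply/eqP; lra.
have c0 : 0 < c by rewrite divr_gt0; lra.
have rr : r - 1 != 0 by rewrite gt_eqF.
(* c = r' is the factor of ler_powRB; the telescoping is completed by M N = 0. *)
have step : \sum_x mu x * M 0%N x `^ r <= c * \sum_x mu x * (h x * M 0%N x `^ (r - 1)).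
  rewrite (eq_bigr (fun x => \sum_(j < N) mu x * (M j x `^ r - M j.+1 x `^ r))); last first.
    move=> x _; rewrite -mulr_sumr (sum_nat_telescope (fun j => M j x `^ r)).
    by rewrite [M N x]running_maxN powR0 ?subr0.
  have -> : \sum_x mu x * (h x * M 0%N x `^ (r - 1)) =
      \sum_x \sum_(j < N) mu x * ((M j x `^ (r - 1) - M j.+1 x `^ (r - 1)) * h x).
    apply: eq_bigr => x _.
    rewrite -mulr_sumr -mulr_suml (sum_nat_telescope (fun j => M j x `^ (r - 1))).
    by rewrite [M N x]running_maxN powR0 ?subr0// [h x * _]mulrC.
  rewrite exchange_big [in leRHS]exchange_big mulr_sumr /=.
  apply: ler_sum => j _.
  rewrite -(sum_class_mean (j := j) h) //; last first.
    move=> x y xy; rewrite [M j x](running_max_adapted _ _ xy).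
    by rewrite [M j.+1 x](running_max_adapted _ _ (e_nest xy)).
  rewrite mulr_sumr; apply: ler_sum => x _.
  rewrite [leRHS]mulrCA ler_wpM2l ?(ltW (mu0 _))//.
  rewrite /M running_maxS//; case: (leP (class_mean mu j h x)) => H.
    by rewrite !subrr mul0r mulr0.
  apply: (le_trans (ler_powRB (running_max_ge0 _ _ _ _) (ltW H) r1)).
  by rewrite -/c -mulrA [class_mean _ _ _ _ * _]mulrC.
have Y : c * \sum_x mu x * (h x * M 0%N x `^ (r - 1)) <=
   2^-1 * (\sum_x mu x * M 0%N x `^ r) + c * (2 * c) `^ (r - 1) * \sum_x mu x * h x `^ r.
  rewrite !mulr_sumr -big_split/=; apply: ler_sum => x _.
  rewrite mulrCA [X in _ <= X + _]mulrCA [X in _ <= _ + X]mulrCA -mulrDr.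
  rewrite ler_wpM2l ?(ltW (mu0 _))//.
  have e0 : 0 < (2 * c)^-1 by rewrite invr_gt0; lra.
  have := young_eps (h0 x) (running_max_ge0 mu h 0 x) r1 e0.
  move=> /(ler_wpM2l (ltW c0)) /le_trans; apply.
  rewrite mulrDr le_eqVlt; apply/orP; left; apply/eqP; congr (_ + _).
    rewrite mulrA; congr (_ * _); field; exact: lt0r_neq0.
  rewrite mulrA; congr (_ * _ * _).
  rewrite -powR_inv1; last by lra.
  by rewrite -powRrM; congr (_ `^ _); ring.
move: (le_trans step Y); rewrite -/c.
set A := \sum_x _; set B := \sum_x _; set D := c * _ `^ _ => H.
lra.
Qed.

(** * Principal classes of a stopping construction *)

Local Notation one := (fun=> 1 : R).

(** Reading the means from coarse to fine, keep the last selected value b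
    until a mean a exceeds its double. *)
Definition stop_op (a b : R) := if 2 * b < a then a else b.

(** The value selected last among the levels from j to N - 1. A class of level
    i is principal when the value changes from level i.+1 to level i. *)
Definition principal f j x : R :=
  \big[stop_op/0]_(j <= i < N) class_mean one i f x.

Lemma principalN f j x : (N <= j)%N -> principal f j x = 0.
Proof. by move=> Nj; rewrite /principal big_geq. Qed.

Lemma principalS f j x : (j < N)%N ->
  principal f j x = stop_op (class_mean one j f x) (principal f j.+1 x).
Proof. by move=> jN; rewrite /principal big_ltn. Qed.

Lemma principal_adapted f j : adapted j (principal f j).
Proof.
move=> x y xy; apply: eq_big_nat => i /andP[ji _].
exact: class_mean_adapted (e_mono ji xy).
Qed.

Section stopping.
Variable f : T -> R.
Hypothesis f0 : forall x, 0 <= f x.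
Local Notation A j := (class_mean one j f).
Local Notation P := (principal f).

Lemma avg_ge0 j x : 0 <= A j x.
Proof. exact: class_mean_ge0. Qed.

Lemma principal_ge0 j x : 0 <= P j x.
Proof.
rewrite /principal; elim/big_rec: _ => // i a _ a0.
by rewrite /stop_op; case: ifP => // _; exact: avg_ge0.
Qed.

Lemma principal_leS j x : P j.+1 x <= P j x.
Proof.
have [jN|Nj] := ltnP j N; last by rewrite !principalN// ltnW.
rewrite (@principalS _ j)// /stop_op; case: ifP => // H.
by have := principal_ge0 j.+1 x; lra.
Qed.

Lemma principal_le i j x : (i <= j)%N -> P j x <= P i x.
Proof.
elim: j => [|j IH]; first by rewrite leqn0 => /eqP ->.
rewrite leq_eqVlt => /orP[/eqP -> //|/IH].
exact/le_trans/principal_leS.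
Qed.

Lemma avg_le_principal j x : (j < N)%N -> A j x <= 2 * P j x.
Proof.
move=> jN; rewrite principalS// /stop_op; case: ltP => //.
by have := avg_ge0 j x; lra.
Qed.

Lemma principal_jump j x : P j.+1 x < P j x ->
  [/\ (j < N)%N, P j x = A j x & 2 * P j.+1 x < P j x].
Proof.
have [jN|Nj] := ltnP j N; last by rewrite !principalN ?ltxx// ltnW.
by rewrite (principalS f x jN) /stop_op; case: ifP => //; rewrite ltxx.
Qed.

Lemma class_sum_indic (g : T -> R) j x : \sum_y (e j x y)%:R * g y = class_sum g j x.
Proof.
rewrite /class_sum [RHS]big_mkcond; apply: eq_bigr => y _.
by case: (e j x y); rewrite ?mul1r ?mul0r.
Qed.

(** Let t be the mean of f over a principal class. Every smaller class where
    the value changes for the first time has mean greater than 2 t. These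
    classes are disjoint and the sum of f over them is at most t times the
    size of the class, so they fill at most half of it. *)
Lemma principal_sparse i x : P i.+1 x < P i x ->
  class_sum one i x <= 2 * class_sum (fun y => (P 0 y == P i y)%:R) i x.
Proof.
move=> Hx; have [iN Ai Hd] := principal_jump Hx.
pose t := P i x; have t0 : 0 < t by exact: le_lt_trans (principal_ge0 i.+1 x) Hx.
(* psi j indicates the points of the class whose value has changed between the
   levels i and j, so psi j - psi j.+1 indicates a first change at level j. *)
pose psi (j : nat) (y : T) : R := (e i x y)%:R * (P i y < P j y)%R%:R.
have psi_adapted j k : (k <= i)%N -> (k <= j)%N -> adapted k (psi j).
  move=> ki kj y z yz; rewrite /psi (principal_adapted f (e_mono ki yz)).
  rewrite (principal_adapted f (e_mono kj yz)); congr (_%:R * _).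
  congr nat_of_bool; apply/idP/idP => H; apply: e_trans H _.
    exact: e_mono ki yz.
  by rewrite e_sym; exact: e_mono ki yz.
have key : 2 * t * \sum_y psi 0%N y <= class_sum f i x.
  have psi_i y : psi i y = 0 by rewrite /psi ltxx mulr0.
  rewrite (eq_bigr (fun y => \sum_(j < i) (psi j y - psi j.+1 y))); last first.
    by move=> y _; rewrite (sum_nat_telescope (psi^~ y)) psi_i subr0.
  rewrite exchange_big mulr_sumr /=.
  apply: (@le_trans _ _ (\sum_(j < i) \sum_y 1 * ((psi j y - psi j.+1 y) * A j y))).
    apply: ler_sum => j _; rewrite mulr_sumr; apply: ler_sum => y _.
    rewrite mul1r /psi; case: (boolP (e i x y)) => xy; last first.
      by rewrite !mul0r !subr0 mulr0 mul0r.
    rewrite !mul1r; have := principal_leS j y.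
    rewrite -(principal_adapted f xy) -/t.
    case: (ltP t (P j y)) => H1; case: (ltP t (P j.+1 y)) => H2 H3;
      rewrite ?subrr ?mulr0 ?mul0r ?subr0 ?mulr1 ?mul1r//; last by lra.
    have [_ <- _] : [/\ (j < N)%N, P j y = A j y & 2 * P j.+1 y < P j y].
      by apply: principal_jump; lra.
    have := @principal_le j.+1 i y (ltn_ord j).
    rewrite -(principal_adapted f xy) -/t => H4.
    have H5 : P j.+1 y < P j y by lra.
    have [_ _ H6] := principal_jump H5.
    lra.
  rewrite [leLHS](_ : _ = \sum_(j < i) \sum_y 1 * ((psi j y - psi j.+1 y) * f y)); last first.
    apply: eq_bigr => j _; apply: (@sum_class_mean one) => // y z yz; congr (_ - _).
      by apply: psi_adapted yz => //; exact: ltnW.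
    by apply: psi_adapted yz => //; exact: ltnW.
  rewrite exchange_big /= -class_sum_indic; apply: ler_sum => y _.
  rewrite (eq_bigr (fun j : 'I_i => (psi j y - psi j.+1 y) * f y)); last by move=> j _; rewrite mul1r.
  rewrite -mulr_suml (sum_nat_telescope (psi^~ y)) psi_i subr0 ler_wpM2r//.
  by rewrite /psi; case: (e i x y); case: (_ < _); rewrite ?mulr1 ?mulr0.
have E : class_sum f i x = t * class_sum one i x.
  rewrite /t Ai /class_mean mulfVK; last by rewrite gt_eqF// class_sum_gt0.
  by apply: eq_bigr => y _; rewrite mul1r.
have S : class_sum one i x = \sum_y psi 0%N y + class_sum (fun y => (P 0 y == P i y)%:R) i x.
  rewrite -!class_sum_indic -big_split; apply: eq_bigr => y _ /=.
  rewrite /psi -mulrDr; congr (_ * _).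
  have := @principal_le 0 i y (leq0n i); rewrite le_eqVlt [P 0 y == _]eq_sym.
  by case: (eqVneq (P i y) (P 0 y)) => [->|_ /= ->]; rewrite ?ltxx ?add0r ?addr0.
move: key; rewrite E -mulrA [2 * (t * _)]mulrCA ler_pM2l// S; lra.
Qed.

(** Together with the cube condition, this is what the estimate on a tree uses
    of a weight. *)
Definition half_part_property c w := forall i x (B : pred T), (i < N)%N ->
  class_sum one i x <= 2 * class_sum (fun y => (B y)%:R) i x ->
  class_sum w i x <= c * class_sum (fun y => w y * (B y)%:R) i x.

(** The w-mass of a principal class is at most c times that of its part where
    no further change occurs. For different principal classes these parts are
    disjoint, by sum_last_jump. *)
Lemma principal_carleson c w i phi : (forall x, 0 < w x) ->
  half_part_property c w -> adapted i phi -> (forall x, 0 <= phi x) ->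
  (forall x, phi x != 0 -> P i.+1 x < P i x) ->
  \sum_x w x * phi x <= c * \sum_x w x * (phi x * (P 0 x == P i x)%:R).
Proof.
move=> w0 hw aphi phi0 phiP.
rewrite -(@sum_class_mean w i _ phi) // mulr_sumr; apply: ler_sum => x _.
rewrite mulrCA ler_wpM2l ?(ltW (w0 _))// mulrCA.
have [->|/phiP Hx] := eqVneq (phi x) 0; first by rewrite mul0r.
have [iN _ _] := principal_jump Hx.
rewrite -[leLHS]mulr1 ler_wpM2l// /class_mean mulrA ler_pdivlMr ?class_sum_gt0// mul1r.
apply: hw => //; exact: principal_sparse.
Qed.

(** The indicators of the set where some change occurs below level i increase
    with i, and the summands are their increments; so each point is charged at
    most once. *)
Lemma sum_last_jump x :
  \sum_(i < N) (P i.+1 x < P i x)%R%:R * (P 0 x == P i x)%:R <= 1 :> R.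
Proof.
pose chi i : R := (P i x < P 0 x)%R%:R.
rewrite (eq_bigr (fun i : 'I_N => - (chi i - chi i.+1))); last first.
  move=> i _; rewrite /chi; have := principal_leS i x.
  have := @principal_le 0 i x (leq0n i).
  case: (eqVneq (P 0 x) (P i x)) => [->|ne H1 H2].
    by rewrite ltxx mulr1; case: ltP; rewrite ?subr0 ?sub0r ?opprK ?oppr0.
  have H3 : P i x < P 0 x by rewrite lt_neqAle eq_sym ne.
  by rewrite H3 (le_lt_trans H2 H3) mulr0 subrr oppr0.
rewrite sumrN (sum_nat_telescope chi) opprB /chi ltxx subr0.
by case: (_ < _).
Qed.

(** Summation by parts: the sum over all levels becomes a sum over the levels
    at which the value changes. *)
Lemma sum_principal_jumps (lam : nat -> R) x :
  \sum_(j < N) lam j * P j x =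
  \sum_(j < N) (\sum_(i < j.+1) lam i) * (P j x - P j.+1 x).
Proof.
have H m : \sum_(j < m) lam j * P j x = \sum_(j < m) (\sum_(i < j.+1) lam i) *
    (P j x - P j.+1 x) + (\sum_(i < m) lam i) * P m x.
  elim: m => [|m IH]; first by rewrite !big_ord0 mul0r addr0.
  rewrite big_ord_recr IH/= [in RHS]big_ord_recr/= [\sum_(i < m.+1) lam i]big_ord_recr/=.
  ring.
by rewrite H principalN// mulr0 addr0.
Qed.

End stopping.
End martingale.

(** * The two-weight inequality on a finite tree *)

Lemma absorb {R : realFieldType} (X Y : R) : X <= 2^-1 * X + Y -> X <= 2 * Y.
Proof. lra. Qed.

Section two_weight.
Context {R : realType} {T : finType} (N : nat) (e : nat -> rel T).
Hypothesis e_refl : forall j, reflexive (e j).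
Hypothesis e_sym : forall j, symmetric (e j).
Hypothesis e_trans : forall j, transitive (e j).
Hypothesis e_nest : forall j x y, e j x y -> e j.+1 x y.
Local Notation one := (fun=> 1 : R).
Local Notation class_sum := (class_sum e).
Local Notation class_mean := (class_mean e).
Variables (c p q K L : R) (lam : nat -> R) (w sigma f : T -> R).
Hypothesis p1 : 1 < p.
Hypothesis pq : p <= q.
Hypothesis c0 : 0 < c.
Hypothesis K0 : 0 < K.
Hypothesis L0 : 0 < L.
Hypothesis lam0 : forall j, 0 <= lam j.
Hypothesis w0 : forall x, 0 < w x.
Hypothesis sigma0 : forall x, 0 < sigma x.
Hypothesis f0 : forall x, 0 <= f x.
Hypothesis lamL : forall j, (j < N)%N -> \sum_(i < j.+1) lam i <= L * lam j.
Hypothesis half_w : half_part_property N e c w.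
Hypothesis half_sigma : half_part_property N e c sigma.
Hypothesis Apq : forall j x, (j < N)%N ->
  lam j / class_sum one j x * class_sum w j x `^ q^-1 * class_sum sigma j x `^ (1 - p^-1) <= K.

Local Notation P := (principal N e f).
Local Notation jump i x := ((P i.+1 x < P i x)%R%:R : R).
Local Notation last i x := ((P 0 x == P i x)%:R : R).
Let a i x := lam i * (P i x - P i.+1 x).
Let G x := \sum_(i < N) a i x.

(** The constant in doob as a function of the exponent. *)
Definition doob_const (r : R) : R :=
  2 * (r / (r - 1) * (2 * (r / (r - 1))) `^ (r - 1)).

Lemma doob_const_gt0 r : 1 < r -> 0 < doob_const r.
Proof.
move=> r1; have H : 0 < r / (r - 1) by rewrite divr_gt0; lra.
by apply: mulr_gt0 => //; apply: mulr_gt0 => //; rewrite powR_gt0// mulr_gt0.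
Qed.

Let q1 : 1 < q. Proof. exact: lt_le_trans p1 pq. Qed.

Let p_gt0 : 0 < p. Proof. exact: lt_trans ltr01 p1. Qed.

Let q_gt0 : 0 < q. Proof. exact: lt_trans ltr01 q1. Qed.

Let p_ge0 : 0 <= p. Proof. exact: ltW. Qed.

Let q_ge0 : 0 <= q. Proof. exact: ltW. Qed.

Let qp_gt0 : 0 < q / p. Proof. exact: divr_gt0. Qed.

Let q'_gt1 : 1 < q / (q - 1).
Proof. by rewrite ltr_pdivlMr ?subr_gt0// mul1r ltrBlDr ltrDl. Qed.

Let a_ge0 i x : 0 <= a i x.
Proof. by rewrite mulr_ge0// subr_ge0 principal_leS. Qed.

Let G_ge0 x : 0 <= G x. Proof. exact: sumr_ge0. Qed.

Let a_adapted i : adapted e i (a i).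
Proof.
move=> x y xy; rewrite /a (principal_adapted N e_sym e_trans e_nest f xy).
by rewrite (principal_adapted N e_sym e_trans e_nest f (e_nest xy)).
Qed.

Let a_jump i x : a i x != 0 -> P i.+1 x < P i x.
Proof.
rewrite lt_neqAle (principal_leS N e_refl f0) andbT; apply: contra => /eqP H.
by rewrite /a H subrr mulr0.
Qed.

(** Between two changes the means stay below twice the last selected value,
    and the coefficients lam sum geometrically, so only the changes count. *)
Lemma sum_avg_le x : \sum_(j < N) lam j * class_mean one j f x <= 2 * L * G x.
Proof.
apply: (@le_trans _ _ (2 * \sum_(j < N) lam j * P j x)).
  rewrite mulr_sumr; apply: ler_sum => j _; rewrite [leRHS]mulrCA ler_wpM2l//.
  exact: avg_le_principal.
rewrite sum_principal_jumps// -mulrA ler_wpM2l// /G mulr_sumr.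
apply: ler_sum => j _; rewrite /a mulrA ler_wpM2r ?lamL//.
by rewrite subr_ge0 principal_leS.
Qed.

(** Duality: write G^q as G h with h = G^(q-1). By averaging, h may be
    replaced by its w-means on the principal classes, and principal_carleson
    restricts the sum to disjoint parts, where the maximal function of h
    bounds all these means at once. The maximal inequality bounds its norm by
    that of h, that is by the left-hand side, which is absorbed. *)
Lemma sum_jumps_le :
  \sum_x w x * G x `^ q <=
  2 * c * ((2 * c * doob_const (q / (q - 1)))^-1) `^ (1 - q) *
  \sum_(i < N) \sum_x w x * a i x `^ q.
Proof.
have q10 : 0 < q - 1 by rewrite subr_gt0.
have q10' : q - 1 != 0 by rewrite gt_eqF.
pose q' := q / (q - 1).
have q'1 : 1 < q' by exact: q'_gt1.
pose D := doob_const q'; have D0 : 0 < D := doob_const_gt0 q'1.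
(* With this eps the term in the maximal function is at most half of the
   left-hand side. *)
pose eps := (2 * c * D)^-1.
have eps0 : 0 < eps by rewrite invr_gt0 mulr_gt0// mulr_gt0.
pose h x := G x `^ (q - 1); have h0 x : 0 <= h x := powR_ge0 _ _.
have E0 i x : 0 <= class_mean w i h x by exact: class_mean_ge0.
pose M x := running_max N e w h 0 x.
have S1 : \sum_x w x * G x `^ q =
    \sum_(i < N) \sum_x w x * (a i x * class_mean w i h x).
  rewrite [RHS](eq_bigr (fun i : 'I_N => \sum_x w x * (a i x * h x))); last first.
    by move=> i _; rewrite sum_class_mean.
  rewrite exchange_big; apply: eq_bigr => x _ /=.
  by rewrite -mulr_sumr -mulr_suml -/(G x) /h mulr_powRB1.
have S2 i x : a i x * class_mean w i h x * last i x <=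
    eps * M x `^ q' * (jump i x * last i x) + eps `^ (1 - q) * a i x `^ q.
  have [a0|/a_jump ->] := eqVneq (a i x) 0.
    rewrite a0 powR0; last by rewrite gt_eqF.
    rewrite !mul0r mulr0 addr0 !mulr_ge0// ?powR_ge0// ltW//.
  rewrite mul1r; have [iN|Ni] := ltnP i N; last first.
    have -> : a i x = 0 by rewrite /a !principalN ?subrr ?mulr0 ?leqW.
    by rewrite !mul0r addr_ge0 ?mulr_ge0 ?powR_ge0// ltW.
  have Y := young_eps (a_ge0 i x) (powR_ge0 (class_mean w i h x) (q - 1)^-1) q1 eps0.
  move: Y; rewrite -!powRrM mulVf// powRr1// (_ : (q - 1)^-1 * q = q'); last by rewrite mulrC.
  move=> Y; have M0 : 0 <= M x := running_max_ge0 _ _ _ _ _ _.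
  have H : class_mean w i h x `^ q' <= M x `^ q'.
    rewrite ge0_ler_powR ?nnegrE//; first exact: ltW (lt_trans ltr01 q'1).
    exact: (le_running_max e w h x iN).
  have H2 : eps * class_mean w i h x `^ q' <= eps * M x `^ q' by rewrite ler_wpM2l// ltW.
  case: (_ == _); rewrite ?mulr1 ?mulr0; first by rewrite (le_trans Y)// lerD2r.
  by rewrite add0r mulr_ge0 ?powR_ge0.
have S3 : \sum_x w x * G x `^ q <= c * (eps * (D * \sum_x w x * G x `^ q) +
    eps `^ (1 - q) * \sum_(i < N) \sum_x w x * a i x `^ q).
  rewrite {1}S1.
  apply: (@le_trans _ _ (\sum_(i < N) c * \sum_x w x * (a i x * class_mean w i h x * last i x))).
    apply: ler_sum => i _; apply: (principal_carleson (N := N) e_refl e_sym e_trans e_nest f0 w0 half_w).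
    - by apply: adapted_op2 => //; exact: class_mean_adapted.
    - by move=> x; rewrite mulr_ge0.
    - by move=> x; rewrite mulf_eq0 negb_or => /andP[/a_jump].
  rewrite -mulr_sumr ler_wpM2l// ?(ltW c0)//.
  apply: (@le_trans _ _ (\sum_(i < N) \sum_x (w x * (eps * M x `^ q') * (jump i x * last i x) +
     eps `^ (1 - q) * (w x * a i x `^ q)))).
    apply: ler_sum => i _; apply: ler_sum => x _.
    rewrite [leRHS](_ : _ = w x * (eps * M x `^ q' * (jump i x * last i x) + eps `^ (1 - q) * a i x `^ q)); last by ring.
    by rewrite ler_wpM2l ?(ltW (w0 x)).
  under eq_bigr do rewrite big_split/=.
  rewrite big_split/=; apply: lerD; last first.
    by rewrite mulr_sumr; apply: ler_sum => i _; rewrite mulr_sumr.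
  rewrite exchange_big /=.
  apply: (@le_trans _ _ (eps * \sum_x w x * M x `^ q')).
    rewrite mulr_sumr; apply: ler_sum => x _; rewrite -mulr_sumr.
    rewrite [leRHS](_ : _ = w x * (eps * M x `^ q') * 1); last by ring.
    rewrite ler_wpM2l//; first by rewrite !mulr_ge0 ?powR_ge0// ltW.
    exact: sum_last_jump.
  rewrite ler_wpM2l ?(ltW eps0)//.
  apply: (le_trans (doob (e:=e) N e_refl e_sym e_trans e_nest w0 h0 q'1)).
  rewrite -/(doob_const q') -/D ler_wpM2l ?(ltW D0)//; apply: ler_sum => x _.
  by rewrite /h -powRrM mulrCA divff// mulr1.
move: S3; set X := \sum_x _; set Y := \sum_(i < N) _.
rewrite -/q' -/D -/eps => H.
have : c * (eps * (D * X)) = 2^-1 * X.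
  by rewrite /eps; field; rewrite !gt_eqF.
move: H; rewrite mulrDr => H1 H2; move: H1; rewrite H2.
rewrite -!mulrA; exact: absorb.
Qed.

Let g x := f x / sigma x.
Let B := \sum_x f x `^ p * sigma x `^ (1 - p).

Let g_ge0 x : 0 <= g x. Proof. by rewrite divr_ge0// ltW. Qed.

Let BE : B = \sum_x sigma x * g x `^ p.
Proof.
apply: eq_bigr => x _; rewrite /g powRM// ?invr_ge0 ?(ltW (sigma0 x))//.
rewrite mulrCA; congr (_ * _).
rewrite -powR_inv1 ?ltW// -powRrM mulN1r powRD; last first.
  by rewrite (gt_eqF (sigma0 x)) implybT.
by rewrite powRr1 ?ltW.
Qed.

Let class_mean_g i x : class_sum f i x = class_sum sigma i x * class_mean sigma i g x.
Proof.
rewrite /class_mean mulrC mulfVK; last by rewrite gt_eqF// class_sum_gt0.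
by apply: eq_bigr => y _; rewrite /g mulrC mulfVK// gt_eqF.
Qed.

(** Jensen's inequality for the measure sigma on one class. B is the p-th
    power of the norm of g = f / sigma in L^p(sigma). *)
Lemma class_mean_jensen i x : class_sum sigma i x * class_mean sigma i g x `^ p <= B.
Proof.
pose m := class_mean sigma i g x; have m0 : 0 <= m by exact: class_mean_ge0.
apply: (@le_trans _ _ (class_sum (fun y => sigma y * g y `^ p) i x)); last first.
  rewrite BE /class_sum [leRHS](bigID (e i x))/= lerDl sumr_ge0// => y _.
  by rewrite mulr_ge0 ?powR_ge0// ltW.
have : \sum_(y | e i x y) sigma y * (p * (g y * m `^ (p - 1))) <=
   \sum_(y | e i x y) sigma y * (g y `^ p + (p - 1) * m `^ p).
  by apply: ler_sum => y _; rewrite ler_wpM2l ?(ltW (sigma0 y))// young_tangent.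
rewrite (eq_bigr (fun y => sigma y * g y * (p * m `^ (p - 1)))); last by move=> y _; ring.
rewrite -mulr_suml.
have -> : \sum_(y | e i x y) sigma y * g y = class_sum sigma i x * m.
  by rewrite -class_mean_g; apply: eq_bigr => y _; rewrite /g mulrC mulfVK// gt_eqF.
rewrite [leRHS](_ : _ = class_sum (fun y => sigma y * g y `^ p) i x + class_sum sigma i x * ((p - 1) * m `^ p)); last first.
  rewrite [class_sum sigma i x * _]mulr_suml -big_split/=.
  by apply: eq_bigr => y _; rewrite mulrDr.
rewrite (_ : class_sum sigma i x * m * _ = class_sum sigma i x * (p * (m * m `^ (p - 1)))); last by ring.
rewrite mulr_powRB1//.
rewrite -/m; set X := class_sum sigma i x; set Y := m `^ p.
rewrite (_ : X * (p * Y) = X * Y + X * ((p - 1) * Y)); last by ring.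
by rewrite lerD2r.
Qed.

(** For psi constant on the classes, each class contributes its value of psi
    once, whatever the measure. *)
Lemma sum_rel_weight i (mu nu psi : T -> R) : (forall x, 0 < mu x) ->
  (forall x, 0 < nu x) -> adapted e i psi ->
  \sum_x mu x * (psi x / class_sum mu i x) = \sum_x nu x * (psi x / class_sum nu i x).
Proof.
move=> mu0 nu0 apsi.
have H (ka : T -> R) : (forall x, 0 < ka x) ->
    \sum_x ka x * (psi x / class_sum ka i x) = \sum_x 1 * (psi x / class_sum one i x * 1).
  move=> ka0; have aka : adapted e i (fun x => psi x / class_sum ka i x).
    apply: adapted_op2 => // x y xy.
    by rewrite (class_sum_adapted e_sym e_trans _ xy).
  rewrite (eq_bigr (fun x => 1 * (psi x / class_sum ka i x * ka x))); last first.
    by move=> x _; ring.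
  rewrite -(sum_class_mean (mu := one) e_refl e_sym e_trans ka (fun=> ltr01) aka).
  apply: eq_bigr => x _; rewrite !mul1r mulr1 /class_mean.
  have -> : class_sum (fun y => 1 * ka y) i x = class_sum ka i x.
    by apply: eq_bigr => y _; rewrite mul1r.
  field.
  by rewrite !gt_eqF ?class_sum_gt0.
by rewrite !H.
Qed.

(** The cube condition on a principal class, where the selected value is the
    mean of f, gives a^q w <= K^q b^(q/p) with b = sigma * mean^p. Since b <=
    B and q >= p, one factor b is kept and the others are bounded by B. *)
Lemma jump_pow_le i x : (i < N)%N -> a i x `^ q <=
  K `^ q * B `^ (q / p - 1) *
  (class_sum sigma i x * (class_mean sigma i g x `^ p * jump i x) / class_sum w i x).
Proof.
move=> iN; have W0 : 0 < class_sum w i x by exact: class_sum_gt0.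
have S0 : 0 < class_sum sigma i x by exact: class_sum_gt0.
have O0 : 0 < class_sum one i x by exact: class_sum_gt0.
have g0 : 0 <= class_mean sigma i g x by exact: class_mean_ge0.
have p0 : p != 0 by rewrite gt_eqF.
have [a0|/a_jump H] := eqVneq (a i x) 0.
  rewrite a0 powR0; last by rewrite gt_eqF.
  by rewrite !mulr_ge0 ?powR_ge0 ?invr_ge0 ?(ltW W0) ?(ltW S0).
rewrite H mulr1; have [_ PA _] := principal_jump H.
rewrite mulrA ler_pdivlMr//.
pose b := class_sum sigma i x * class_mean sigma i g x `^ p.
have b0 : 0 <= b by rewrite mulr_ge0 ?powR_ge0// ltW.
have HP : 0 <= P i.+1 x by exact: principal_ge0.
have Ha : a i x * class_sum w i x `^ q^-1 <= K * b `^ p^-1.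
  apply: (@le_trans _ _ (lam i / class_sum one i x * class_sum w i x `^ q^-1 *
    class_sum sigma i x `^ (1 - p^-1) * b `^ p^-1)); last first.
    by rewrite ler_wpM2r ?powR_ge0// Apq.
  rewrite /b powRM ?powR_ge0 ?(ltW S0)// -powRrM divff// powRr1//.
  rewrite [leRHS](_ : _ = lam i / class_sum one i x *
    (class_sum sigma i x `^ (1 - p^-1) * class_sum sigma i x `^ p^-1 * class_mean sigma i g x) *
    class_sum w i x `^ q^-1); last by ring.
  rewrite -powRD; last by rewrite (gt_eqF S0) implybT.
  rewrite subrK powRr1 ?(ltW S0)// -class_mean_g ler_wpM2r ?powR_ge0//.
  rewrite /a -mulrA ler_wpM2l// PA /class_mean.
  rewrite (_ : class_sum (fun y => 1 * f y) i x = class_sum f i x); last first.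
    by apply: eq_bigr => y _; rewrite mul1r.
  by rewrite [leRHS]mulrC lerBlDr lerDl.
have E1 : (a i x * class_sum w i x `^ q^-1) `^ q = a i x `^ q * class_sum w i x.
  rewrite powRM ?powR_ge0 ?a_ge0// -(powRrM _ q^-1 q) mulVf ?powRr1 ?(ltW W0)//.
  by rewrite gt_eqF.
have E2 : (K * b `^ p^-1) `^ q = K `^ q * b `^ (q / p).
  by rewrite powRM ?powR_ge0 ?(ltW K0)// -(powRrM b p^-1 q) [p^-1 * q]mulrC.
have : (a i x * class_sum w i x `^ q^-1) `^ q <= (K * b `^ p^-1) `^ q.
  rewrite ge0_ler_powR ?nnegrE//.
    by apply: mulr_ge0; rewrite ?powR_ge0 ?a_ge0.
  by rewrite mulr_ge0 ?powR_ge0 ?(ltW K0).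
rewrite E1 E2 => /le_trans; apply.
rewrite -mulrA ler_wpM2l ?powR_ge0// -/b.
rewrite -(mulr_powRB1 b0 qp_gt0) mulrC ler_wpM2r//.
rewrite ge0_ler_powR ?nnegrE//.
- by rewrite subr_ge0 ler_pdivlMr ?mul1r.
- exact: le_trans (class_mean_jensen i x).
- exact: class_mean_jensen.
Qed.

(** After jump_pow_le the weight w appears only through the total mass of
    classes and can be exchanged for sigma; the maximal inequality for sigma
    sums the means over the principal classes. *)
Lemma sum_jump_pow_le :
  \sum_(i < N) \sum_x w x * a i x `^ q <=
  K `^ q * (c * doob_const p) * B `^ (q / p).
Proof.
have B0 : 0 <= B by rewrite sumr_ge0// => x _; rewrite mulr_ge0 ?powR_ge0.
have D0 := doob_const_gt0 p1.
pose E i x := class_mean sigma i g x `^ p.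
have E0 i x : 0 <= E i x := powR_ge0 _ _.
have aE i : adapted e i (fun x => E i x * jump i x).
  apply: adapted_op2 => x y xy; first by rewrite /E (class_mean_adapted e_sym e_trans _ _ xy).
  rewrite (principal_adapted N e_sym e_trans e_nest f xy).
  by rewrite (principal_adapted N e_sym e_trans e_nest f (e_nest xy)).
apply: (@le_trans _ _ (K `^ q * B `^ (q / p - 1) * \sum_(i < N) \sum_x sigma x * (E i x * jump i x))).
  rewrite mulr_sumr; apply: ler_sum => i _.
  have -> : \sum_x sigma x * (E i x * jump i x) =
      \sum_x sigma x * (class_sum sigma i x * (E i x * jump i x) / class_sum sigma i x).
    apply: eq_bigr => x _; congr (_ * _); rewrite [RHS]mulrC mulKf//.
    by rewrite gt_eqF// class_sum_gt0.
  rewrite -(@sum_rel_weight i w)//; last first.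
    apply: adapted_op2 => // x y xy; by rewrite (class_sum_adapted e_sym e_trans _ xy).
  rewrite mulr_sumr; apply: ler_sum => x _; rewrite mulrCA ler_wpM2l ?(ltW (w0 x))//.
  exact: jump_pow_le.
rewrite [leRHS](_ : _ = K `^ q * (B `^ (q / p) * (c * doob_const p))); last by ring.
rewrite -mulrA ler_wpM2l ?powR_ge0//.
rewrite -(mulr_powRB1 B0 qp_gt0) [leRHS](_ : _ = B `^ (q / p - 1) * (c * (doob_const p * B))); last by ring.
rewrite ler_wpM2l ?powR_ge0//.
apply: (@le_trans _ _ (\sum_(i < N) c * \sum_x sigma x * (E i x * jump i x * last i x))).
  apply: ler_sum => i _; apply: (principal_carleson (N := N) e_refl e_sym e_trans e_nest f0 sigma0 half_sigma) => //.
  - by move=> x; rewrite mulr_ge0.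
  - by move=> x; case: (P i.+1 x < P i x) => //; rewrite mulr0 eqxx.
rewrite -mulr_sumr ler_wpM2l ?(ltW c0)//.
apply: le_trans (_ : \sum_x sigma x * running_max N e sigma g 0 x `^ p <= _); last first.
  by rewrite BE; exact: doob.
rewrite exchange_big; apply: ler_sum => x _ /=; rewrite -mulr_sumr.
rewrite ler_wpM2l ?(ltW (sigma0 x))//.
rewrite -[leRHS]mulr1.
apply: (le_trans _ (ler_wpM2l (powR_ge0 _ _) (sum_last_jump N e_refl f0 x))).
rewrite mulr_sumr; apply: ler_sum => i _; rewrite -mulrA ler_wpM2r ?mulr_ge0//.
rewrite ge0_ler_powR ?nnegrE ?running_max_ge0//.
  exact: class_mean_ge0.
exact: le_running_max.
Qed.

Definition discrete_const : R :=
  (2 * L) `^ q * (2 * c * ((2 * c * doob_const (q / (q - 1)))^-1) `^ (1 - q) *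
  (K `^ q * (c * doob_const p))).

Lemma discrete_const_gt0 : 0 < discrete_const.
Proof.
have D1 := doob_const_gt0 q'_gt1; have D2 := doob_const_gt0 p1.
apply: mulr_gt0; first by rewrite powR_gt0// mulr_gt0.
apply: mulr_gt0; last by apply: mulr_gt0; [exact: powR_gt0|exact: mulr_gt0].
apply: mulr_gt0; first exact: mulr_gt0.
by rewrite powR_gt0// invr_gt0 mulr_gt0// mulr_gt0.
Qed.

Lemma discrete_two_weight :
  \sum_x w x * (\sum_(j < N) lam j * class_mean one j f x) `^ q <=
  discrete_const * (\sum_x f x `^ p * sigma x `^ (1 - p)) `^ (q / p).
Proof.
apply: (@le_trans _ _ ((2 * L) `^ q * \sum_x w x * G x `^ q)).
  rewrite mulr_sumr; apply: ler_sum => x _; rewrite mulrCA ler_wpM2l ?(ltW (w0 x))//.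
  rewrite -powRM ?mulr_ge0 ?(ltW L0)// ge0_ler_powR ?nnegrE ?mulr_ge0 ?(ltW L0) ?sum_avg_le//.
  by apply: sumr_ge0 => i _; rewrite mulr_ge0// class_mean_ge0.
rewrite /discrete_const -!mulrA ler_wpM2l ?powR_ge0//.
apply: (le_trans sum_jumps_le); rewrite -!mulrA !ler_wpM2l ?powR_ge0 ?(ltW c0)//.
by have := sum_jump_pow_le; rewrite -!mulrA.
Qed.

End two_weight.

(** * Integrals and volumes of boxes *)

(** The integral of a nonnegative function is a supremum over the simple
    functions below it, hence monotone for arbitrary functions. This avoids
    the question whether an integrand that involves the operator is
    measurable. *)
Lemma le_integral_pointwise d (T : measurableType d) (R : realType)
    (mu : {measure set T -> \bar R}) (D : set T) (f g : T -> \bar R) :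
  (forall x, D x -> f x <= g x)%E ->
  (\int[mu]_(x in D) f x <= \int[mu]_(x in D) g x)%E.
Proof.
move=> fg.
have H x : ((f \_ D) x <= (g \_ D) x)%E.
  by rewrite /patch; case: ifPn => // /set_mem/fg.
apply: leeB; apply: le_ereal_sup => _ [h hf <-]; exists h => // x;
  apply: (le_trans (hf x)).
- by rewrite !funeposE ge_max !le_max H lexx orbT.
- by rewrite !funenegE ge_max !le_max leeN2 H lexx orbT.
Qed.

Lemma le_integral_subset d (T : measurableType d) (R : realType)
    (mu : {measure set T -> \bar R}) (A B : set T) (f : T -> \bar R) :
  (forall x, 0 <= f x)%E -> A `<=` B ->
  (\int[mu]_(x in A) f x <= \int[mu]_(x in B) f x)%E.
Proof.
move=> f0 AB; rewrite integral_mkcond [leRHS]integral_mkcond.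
apply: le_integral_pointwise => x _; rewrite !patchE; case: ifPn => [/set_mem/AB xB|_].
  by rewrite mem_set.
by case: ifP.
Qed.

Section boxes.
Context {R : realType} {n : nat}.
Local Notation RB := (measurableTypeR R).

Lemma borel_measurable_euclid (A : set (n.-tuple RB)) : measurable A ->
  measurable (A : set (euclid R n)).
Proof. by move=> mA; apply: sub_caratheodory; exact: sub_sigma_algebra. Qed.

Lemma measurable_coord (i : 'I_n) :
  measurable_fun [set: euclid R n] (fun x : euclid R n => tnth x i : RB).
Proof.
move=> _ Y mY; rewrite setTI; apply: borel_measurable_euclid.
by rewrite -[X in measurable X]setTI; exact: measurable_tnth.
Qed.

Lemma measurable_rect (A : 'I_n -> set RB) : (forall i, measurable (A i)) ->
  measurable [set x : euclid R n | forall i, A i (tnth x i)].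
Proof.
move=> mA; rewrite (_ : [set x | _] =
    \bigcap_(i in [set: 'I_n]) ((fun x : euclid R n => tnth x i : RB) @^-1` A i)).
  apply: fin_bigcap_measurable => // i _.
  by rewrite -[X in measurable X]setTI; exact: measurable_coord.
by apply/seteqP; split => [x h i _|x h i]; [exact: h|exact: h].
Qed.

Lemma vol_rect (A : 'I_n -> set RB) : (forall i, measurable (A i)) ->
  vol [set x : euclid R n | forall i, A i (tnth x i)] =
  (\prod_(i < n) lebesgue_measure (A i))%E.
Proof.
move=> mA; rewrite /vol /lebesgue_outer /= measurable_mu_extE.
  exact: borel_lebesgue_rect.
rewrite (_ : [set x | _] =
    \bigcap_(i in [set: 'I_n]) ((@tnth n (measurableTypeR R))^~ i @^-1` A i)).
  apply: fin_bigcap_measurable => // i _.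
  by rewrite -[X in measurable X]setTI; exact: measurable_tnth.
by apply/seteqP; split => [x h i _|x h i]; [exact: h|exact: h].
Qed.

Lemma measurable_cube (x : euclid R n) l : measurable (cube x l).
Proof.
pose A i : set (measurableTypeR R) := `[tnth x i, tnth x i + l]%classic.
rewrite (_ : cube x l = [set y | forall i, A i (tnth y i)]).
  by apply: measurable_rect => i; exact: measurable_itv.
by apply/seteqP; split => y /= H i; have := H i; rewrite /A/= in_itv.
Qed.

Lemma vol_cube (x : euclid R n) l : 0 <= l -> vol (cube x l) = (l ^+ n)%:E.
Proof.
move=> l0; rewrite (vol_box (a := tnth x) (b := fun i => tnth x i + l)); last first.
  by move=> i; rewrite lerDl.
congr EFin; rewrite -[in RHS](card_ord n) -prodr_const; apply: eq_bigr => i _.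
by rewrite addrAC subrr add0r.
Qed.

End boxes.

(** * The A_infty condition and parts of fixed density *)

Lemma ln_le_affine {R : realType} (lam w : R) : 0 < lam -> 0 < w ->
  ln w <= ln lam - 1 + w / lam.
Proof.
move=> l0 w0.
have := @le_ln1Dx R (w / lam - 1); rewrite [1 + _]addrC subrK ln_div ?posrE//.
have := divr_gt0 w0 l0; move=> ? /(_ ltac:(lra)); lra.
Qed.

Section half.
Context {R : realType} {n : nat}.
Implicit Types (w : euclid R n -> \bar R).
Local Open Scope ereal_scope.

(** The form in which the A_infty condition is used. *)
Definition dense_part_property w := forall theta : R, (0 < theta)%R ->
  exists C : R, (0 < C)%R /\ forall (x : euclid R n) (l : R) A, (0 < l)%R ->
    measurable A -> A `<=` cube x l -> (theta * l ^+ n)%:E <= vol A ->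
    \int[vol]_(y in cube x l) w y <= C%:E * \int[vol]_(y in A) w y.

Lemma lne_le_affine (lam : R) (w : \bar R) : (0 < lam)%R -> 0 <= w ->
  lne w <= (ln lam - 1)%:E + (lam^-1)%:E * w.
Proof.
move=> l0; case: w => [w||//]; last first.
  by move=> _; rewrite gt0_muley ?lte_fin ?invr_gt0//.
rewrite lee_fin => w0 /=; case: ifPn => [_|]; first exact: leNye.
rewrite -ltNge => wp; rewrite -EFinM -EFinD lee_fin mulrC.
exact: ln_le_affine.
Qed.

Lemma integrable_indic_fin d (T : measurableType d)
    (mu : {measure set T -> \bar R}) (D A : set T) : measurable D ->
  measurable A -> mu D < +oo -> mu.-integrable D (fun x => (\1_A x)%:E).
Proof.
move=> mD mA muD; apply/integrableP; split.
  by apply/measurable_EFinP; exact: measurable_indic.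
rewrite (eq_integral (fun x => (\1_A x)%:E)); last first.
  by move=> x _; rewrite gee0_abs// lee_fin.
rewrite integral_indic//; apply: le_lt_trans muD.
by apply: le_measure; rewrite ?inE//; exact: measurableI.
Qed.

Lemma integral_mul_indic d (T : measurableType d)
    (mu : {measure set T -> \bar R}) (D A : set T) (w : T -> \bar R) : A `<=` D ->
  \int[mu]_(x in D) (w x * (\1_A x)%:E) = \int[mu]_(x in A) w x.
Proof.
move=> AD; rewrite -{2}(setIidr AD) integral_mkcondr.
by apply: eq_integral => x _; rewrite epatch_indic.
Qed.

(** Let W be the mean of w over Q and M its mean over A. Bound ln w by its
    tangent at W on all of Q, with the correction ln M - ln W on A, and
    average: up to a constant the mean of ln w is at most ln W - (|A|/|Q|) ln
    (W/M). The A_infty condition bounds ln W minus this mean, hence bounds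
    W/M. *)
Lemma A_infty_dense_part w : (forall x, 0 <= w x) -> A_infty w ->
  dense_part_property w.
Proof.
move=> w0 [[_ iw] supw].
have [B [B1 HB]] : exists B : R, (1 <= B)%R /\ forall x l, (0 < l)%R ->
    avg w (cube x l) * expeR (- avg (fun x => lne (w x)) (cube x l)) <= B%:E.
  move: supw; set s := ereal_sup _ => sy; exists (Num.max 1 (fine s))%R; split.
    by rewrite le_max lexx.
  move=> x l l0; apply: (@le_trans _ _ s).
    by apply: ereal_sup_ubound; exists (cube x l) => //; exists x, l.
  move: sy; case: s => [s _|//|_]; last exact: leNye.
  by rewrite lee_fin le_max lexx orbT.
move=> theta theta0.
(* The term 1 covers the contribution of w over A, whose tangent is taken at a
   point mu slightly above its mean Jr / a. *)
pose k := ((ln B + 1) / theta)%R.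
have lnB0 : (0 <= ln B)%R by rewrite ln_ge0.
have k0 : (0 <= k)%R by rewrite divr_ge0 ?addr_ge0 ?(ltW theta0).
exists (expR k / theta)%R; split; first by rewrite divr_gt0 ?expR_gt0.
move=> x l A l0 mA AQ Ha.
set Q := cube x l; have mQ : measurable Q by exact: measurable_cube.
pose V : R := (l ^+ n)%R; have V0 : (0 < V)%R by rewrite exprn_gt0.
have vQ : vol Q = V%:E by rewrite vol_cube// ltW.
have vQy : vol Q < +oo by rewrite vQ ltry.
have iwQ : vol.-integrable Q w by exact: iw.
have iwA : vol.-integrable A w by exact: integrableS iwQ.
have vAfin : vol A \is a fin_num.
  rewrite ge0_fin_numE//; apply: le_lt_trans vQy.
  by apply: le_measure; rewrite ?inE.
move: (Ha); rewrite -(fineK vAfin) lee_fin; set a := fine _ => Ha'.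
have a0 : (0 < a)%R by apply: lt_le_trans Ha'; rewrite mulr_gt0.
have aV : (a <= V)%R.
  by rewrite -lee_fin fineK// -vQ; apply: le_measure; rewrite ?inE.
have := integrable_fin_num mQ iwQ; have := integrable_fin_num mA iwA.
set I := integral _ Q _; set J := integral _ A _ => Jfin Ifin.
have J0 : 0 <= J by exact: integral_ge0.
have I0 : 0 <= I by exact: integral_ge0.
move: J0 I0; rewrite -(fineK Jfin) -(fineK Ifin) !lee_fin.
move: (fineK Jfin) (fineK Ifin); set Jr := fine J; set Ir := fine I => JE IE J0 I0.
have [Ir0|Ip] := leP Ir 0%R.
  by rewrite (le_trans Ir0)// mulr_ge0// divr_ge0 ?expR_ge0// ltW.
pose W := (Ir / V)%R; have W0 : (0 < W)%R by rewrite divr_gt0.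
have avgw : avg w Q = W%:E.
  by rewrite /avg vQ inver gt_eqF// -/I -IE -EFinM mulrC.
(* The strict inequality keeps ln mu meaningful when the mean over A is zero. *)
have key mu : (Jr / a < mu)%R -> (ln W - ln mu <= k)%R.
  move=> Hmu; have mu0 : (0 < mu)%R by apply: le_lt_trans Hmu; rewrite divr_ge0// ltW.
  pose r y := ((ln W - 1)%:E * (\1_Q y)%:E + (W^-1)%:E * w y) +
     ((ln mu - ln W)%:E * (\1_A y)%:E + (mu^-1)%:E * (w y * (\1_A y)%:E)).
  have lr y : Q y -> lne (w y) <= r y.
    move=> Qy; rewrite /r indicE mem_set//= mule1.
    have [yA|yA] := boolP (y \in A); rewrite indicE.
      rewrite yA/= !mule1.
      have := lne_le_affine mu0 (w0 y).
      have := w0 y; case: (w y) => [u||]; last by [].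
        rewrite lee_fin -!EFinM -!EFinD => u0 /le_trans; apply.
        rewrite lee_fin; have : (0 <= W^-1 * u)%R by rewrite mulr_ge0// invr_ge0 ltW.
        by lra.
      by move=> _ _; rewrite !gt0_muley ?lte_fin ?invr_gt0//= leey.
    rewrite (negbTE yA) /= !mule0 !adde0; exact: lne_le_affine.
  pose S : R := ((ln W - 1) * V + W^-1 * Ir + ((ln mu - ln W) * a + mu^-1 * Jr))%R.
  have iA : vol.-integrable Q (fun y => (\1_A y)%:E) by exact: integrable_indic_fin.
  have iQ : vol.-integrable Q (fun y => (\1_Q y)%:E) by exact: integrable_indic_fin.
  have iwA' : vol.-integrable Q (fun y => w y * (\1_A y)%:E).
    have mwA : measurable_fun Q (fun y => w y * (\1_A y)%:E).
      apply: emeasurable_funM; first by case/integrableP: iwQ.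
      by apply/measurable_EFinP; exact: measurable_indic.
    apply: (le_integrable mQ mwA _ iwQ) => y _.
    rewrite abseM [X in _ * X]gee0_abs ?lee_fin//.
    rewrite -[leRHS]mule1 lee_wpmul2l// lee_fin indicE.
    by case: (_ \in _).
  have ir : \int[vol]_(y in Q) r y = S%:E.
    rewrite integralD//; [|by apply: integrableD => //; exact: integrableZl..].
    rewrite !integralD//; [|exact: integrableZl..].
    rewrite !integralZl// integral_mul_indic// !integral_indic//.
    rewrite setIid (setIidl AQ).
    have -> : (vol : {measure set (euclid R n) -> \bar R}) Q = V%:E := vQ.
    have -> : (vol : {measure set (euclid R n) -> \bar R}) A = a%:E.
      by rewrite /a fineK.
    by rewrite -/I -/J -IE -JE -!EFinM -!EFinD.
  have Ll : avg (fun x => lne (w x)) Q <= (S / V)%:E.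
    rewrite /avg vQ inver gt_eqF// mulrC EFinM lee_wpmul2l//.
      by rewrite lee_fin invr_ge0 ltW.
    by rewrite -ir; exact: le_integral_pointwise.
  have H1 : W%:E * (expR (- (S / V)))%:E <= B%:E.
    apply: le_trans (HB x l l0); rewrite -/Q avgw lee_wpmul2l ?lee_fin ?(ltW W0)//.
    by rewrite -[(expR _)%:E]/(expeR (- (S / V))%:E) lee_expeR EFinN leeN2.
  move: H1; rewrite -EFinM lee_fin => H1.
  have B0 : (0 < B)%R by lra.
  have H2 : (ln W - S / V <= ln B)%R.
    have : (ln (W * expR (- (S / V))) <= ln B)%R.
      by rewrite ler_ln ?posrE// mulr_gt0 ?expR_gt0.
    by rewrite lnM ?posrE ?expR_gt0// expRK.
  have SV : (S / V = ln W + (ln mu - ln W) * (a / V) + mu^-1 * Jr / V)%R.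
    by rewrite /S /W; field; rewrite !gt_eqF.
  have H3 : (mu^-1 * Jr / V <= 1)%R.
    rewrite ler_pdivrMr// mul1r; apply: le_trans aV.
    rewrite mulrC ler_pdivrMr// mulrC -ler_pdivrMr//; exact: ltW.
  have t1 : (theta <= a / V)%R by rewrite ler_pdivlMr.
  have [H4|H4] := leP (ln W - ln mu)%R 0%R; first exact: le_trans H4 k0.
  rewrite /k ler_pdivlMr//; have : ((ln W - ln mu) * theta <= (ln W - ln mu) * (a / V))%R.
    by rewrite ler_wpM2l// ltW.
  by move: H2; rewrite SV; lra.
have WJ : (W <= expR k * (Jr / a))%R.
  apply/ler_addgt0Pr => eps eps0.
  have eps1 : (0 < eps / expR k)%R by rewrite divr_gt0 ?expR_gt0.
  pose mu := (Jr / a + eps / expR k)%R.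
  have H : (ln W - ln mu <= k)%R by apply: key; rewrite ltrDl.
  have mu0 : (0 < mu)%R by apply: lt_le_trans eps1 _; rewrite lerDr divr_ge0// ltW.
  rewrite [leRHS](_ : _ = (expR k * mu)%R); last first.
    by rewrite /mu; field; rewrite !gt_eqF ?expR_gt0.
  rewrite -[leLHS]lnK ?posrE// -[X in (_ <= _ * X)%R]lnK ?posrE// -expRD ler_expR.
  by lra.
move: WJ; rewrite ler_pdivrMr// => /le_trans; apply.
rewrite (_ : (expR k / theta * Jr = expR k * Jr / theta)%R); last by ring.
rewrite (_ : (expR k * (Jr / a) * V = expR k * Jr * (V / a))%R); last by ring.
rewrite ler_wpM2l// ?mulr_ge0 ?expR_ge0// ler_pdivrMr// mulrC ler_pdivlMr//.
by rewrite mulrC.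
Qed.

End half.

(** * Medians of a function on cubes *)

Section distribution.
Context {R : realType} {n : nat}.
Variable d : euclid R n -> R.
Hypothesis d0 : forall x, 0 <= d x.
Hypothesis md : measurable_fun setT d.
Hypothesis dnull : vol [set x | d x = 0] = 0%E.
Local Open Scope ereal_scope.
Implicit Types (x : euclid R n) (l m s : R).

Lemma measurable_dist_ge t : measurable [set y | t <= d y]%R.
Proof.
rewrite [X in measurable X](_ : _ = d @^-1` `[t, +oo[%classic); last first.
  by apply/seteqP; split => y /=; rewrite in_itv/= andbT.
by rewrite -[X in measurable X]setTI; exact: md.
Qed.

Lemma measurable_dist_le t : measurable [set y | d y <= t]%R.
Proof.
rewrite [X in measurable X](_ : _ = d @^-1` `]-oo, t]%classic); last first.
  by apply/seteqP; split => y /=; rewrite in_itv/=.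
by rewrite -[X in measurable X]setTI; exact: md.
Qed.

Lemma measurable_dist_eq0 : measurable [set y | d y = 0]%R.
Proof.
rewrite [X in measurable X](_ : _ = d @^-1` [set 0%R])//.
by rewrite -[X in measurable X]setTI; exact: md.
Qed.

(** A median up to a factor of 2 on both sides, which makes existence
    immediate from a supremum. *)
Definition is_median x l m := [/\ (0 < m)%R,
  (2^-1 * l ^+ n)%:E <= vol (cube x l `&` [set y | m / 2 <= d y]%R) &
  (2^-1 * l ^+ n)%:E <= vol (cube x l `&` [set y | d y <= 2 * m]%R)].

(** Continuity of measure: the sets F k increase to a set of full measure. *)
Lemma vol_exhaust x l (F : nat -> set (euclid R n)) : (0 < l)%R ->
  (forall k, measurable (F k)) -> nondecreasing_seq F ->
  (forall y, d y != 0%R -> exists k, F k y) ->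
  exists k, (2^-1 * l ^+ n)%:E < vol (cube x l `&` F k).
Proof.
move=> l0 mF ndF FT.
have mQ := measurable_cube x l.
have V0 : (0 < l ^+ n)%R by rewrite exprn_gt0.
have mF' k : measurable (cube x l `&` F k) by exact: measurableI.
have mU : measurable (\bigcup_k (cube x l `&` F k)) by exact: bigcupT_measurable.
have ndF' : nondecreasing_seq (fun k => cube x l `&` F k).
  by move=> i j ij; apply/subsetPset; apply: setIS; apply/subsetPset; exact: ndF.
have cv := nondecreasing_cvg_mu (mu := vol) mF' mU ndF'.
have lim : (l ^+ n)%:E <= vol (\bigcup_k (cube x l `&` F k)).
  rewrite -(vol_cube x (ltW l0)) -[leRHS]adde0 -dnull.
  have mN := measurable_dist_eq0.
  apply: (@le_trans _ _ (vol ((\bigcup_k (cube x l `&` F k)) `|` [set x | d x = 0%R]))).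
    apply: le_measure; rewrite ?inE//; first exact: measurableU.
    move=> y Qy; have [dy|/FT[k Fky]] := eqVneq (d y) 0%R; first by right.
    by left; exists k.
  exact: measureU2.
apply: contrapT => /forallNP H.
have : vol (\bigcup_k (cube x l `&` F k)) <= (2^-1 * l ^+ n)%:E.
  apply: (cvge_to_le cv); apply: nearW => k /=.
  by rewrite leNgt; apply/negP; exact: H.
move=> /(le_trans lim); rewrite lee_fin; lra.
Qed.

Let vol_sub_cube x l A : (0 < l)%R -> vol (cube x l `&` A) <= (l ^+ n)%:E ->
  vol (cube x l `&` A) \is a fin_num.
Proof.
by move=> l0 H; rewrite ge0_fin_numE ?measure_ge0// (le_lt_trans H)// ltry.
Qed.

Lemma vol_cubeI_le x l A : (0 < l)%R -> measurable A ->
  vol (cube x l `&` A) <= (l ^+ n)%:E.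
Proof.
move=> l0 mA; rewrite -(vol_cube x (ltW l0)).
have mQ := measurable_cube x l.
by apply: le_measure; rewrite ?inE; [exact: measurableI|exact: mQ|exact: subIsetl].
Qed.

Lemma vol_cubeI_split x l A (theta : R) : (0 < l)%R -> measurable A ->
  ((theta * l ^+ n)%:E <= vol (cube x l `&` A)) \/
  (((1 - theta) * l ^+ n)%:E <= vol (cube x l `&` ~` A)).
Proof.
move=> l0 mA; have mQ := measurable_cube x l.
have [?|H] := leP ((theta * l ^+ n)%:E) (vol (cube x l `&` A)); [by left|right].
have f1 := vol_sub_cube l0 (vol_cubeI_le x l0 mA).
have f2 := vol_sub_cube l0 (vol_cubeI_le x l0 (measurableC mA)).
have : (l ^+ n)%:E = vol (cube x l `&` A) + vol (cube x l `&` ~` A).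
  rewrite -measureU; [|exact: measurableI|by apply: measurableI => //; exact: measurableC|].
    by rewrite -setIUr setUv setIT; rewrite -(vol_cube x (ltW l0)).
  by rewrite setIACA setICr setI0.
move: H; rewrite -(fineK f1) -(fineK f2) -EFinD lte_fin lee_fin => H [].
move: H; move: (l ^+ n)%R (fine _) (fine _) => V a b; lra.
Qed.

(** Take the supremum of the levels t such that d >= t on at least half of the
    cube; it is positive because d vanishes only on a null set. *)
Lemma exists_median x l : (0 < l)%R -> exists m, is_median x l m.
Proof.
move=> l0; have mge := measurable_dist_ge; have mle := measurable_dist_le.
have V0 : (0 < l ^+ n)%R by rewrite exprn_gt0.
pose S := [set t : R | (0 < t)%R /\
  (2^-1 * l ^+ n)%:E <= vol (cube x l `&` [set y | t <= d y]%R)].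
have mono s t : (s <= t)%R -> vol (cube x l `&` [set y | t <= d y]%R) <=
    vol (cube x l `&` [set y | s <= d y]%R).
  move=> st; have mQ := measurable_cube x l.
  apply: le_measure; rewrite ?inE; [exact: measurableI..|].
  by move=> y [Qy /= ty]; split => //=; exact: le_trans ty.
have [k0 Hk0] : exists k, (2^-1 * l ^+ n)%:E <
    vol (cube x l `&` [set y | k.+1%:R^-1 <= d y]%R).
  apply: (@vol_exhaust x l (fun k => [set y | k.+1%:R^-1 <= d y]%R)) => //.
    move=> i j ij; apply/subsetPset => y /=; apply: le_trans.
    by rewrite lef_pV2 ?posrE// ler_nat.
  move=> y dy; exists (Num.truncn ((d y)^-1)) => /=.
  have dp : (0 < d y)%R by rewrite lt_neqAle eq_sym dy d0.
  rewrite -[leRHS]invrK lef_pV2 ?posrE ?invr_gt0//.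
  by rewrite ltW// truncnS_gt.
have [k1 Hk1] : exists k, (2^-1 * l ^+ n)%:E <
    vol (cube x l `&` [set y | d y <= k%:R]%R).
  apply: (@vol_exhaust x l (fun k => [set y | d y <= k%:R]%R)) => //.
    move=> i j ij; apply/subsetPset => y /= H; apply: (le_trans H).
    by rewrite ler_nat.
  move=> y _; exists (Num.truncn (d y)).+1 => /=.
  by rewrite ltW// truncnS_gt.
have Sk0 : S (k0.+1%:R^-1)%R by split; [rewrite invr_gt0|exact: ltW].
have ubS : ubound S (k1%:R)%R.
  move=> t [t0 Ht]; rewrite leNgt; apply/negP => tk.
  have mQ := measurable_cube x l.
  have disj : vol (cube x l `&` [set y | t <= d y]%R) +
     vol (cube x l `&` [set y | d y <= k1%:R]%R) <= (l ^+ n)%:E.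
    rewrite -measureU; [|exact: measurableI..|].
      rewrite -setIUr; apply: vol_cubeI_le => //; exact: measurableU.
    rewrite setIACA [X in _ `&` X](_ : _ = set0) ?setI0//.
    by apply/seteqP; split => // y [/= a b]; have := le_lt_trans b tk; rewrite ltNge a.
  have f1 := vol_sub_cube l0 (vol_cubeI_le x l0 (measurable_dist_ge t)).
  have f2 := vol_sub_cube l0 (vol_cubeI_le x l0 (measurable_dist_le k1%:R)).
  move: disj Ht Hk1; rewrite -(fineK f1) -(fineK f2) -EFinD !lee_fin lte_fin; lra.
have hS : has_sup S by split; [exists (k0.+1%:R^-1)%R | exists k1%:R].
have supS := sup_upper_bound hS.
pose m := sup S.
have m0 : (0 < m)%R.
  by apply: lt_le_trans (supS _ Sk0); rewrite invr_gt0.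
exists m; split => //.
  have m20 : (0 < m / 2)%R by rewrite divr_gt0.
  have [t [t0 St] Ht] := sup_adherent m20 hS.
  apply: (le_trans St); apply: mono; move: Ht; rewrite -/m; lra.
have : ~ S (2 * m)%R.
  by move=> /supS; rewrite -/m; lra.
move=> H; have [H1|] := vol_cubeI_split x (2^-1)%R l0 (measurable_dist_ge (2 * m)%R).
  by exfalso; apply: H; split => //; rewrite mulr_gt0.
have -> : (1 - 2^-1 = 2^-1 :> R)%R by lra.
move=> /le_trans; apply; have mQ := measurable_cube x l.
apply: le_measure; rewrite ?inE; [by apply: measurableI => //; exact: measurableC|exact: measurableI|].
by move=> y [Qy /= /negP]; rewrite -ltNge => /ltW.
Qed.

Lemma measurable_dist_pow s : measurable_fun setT (fun y => (d y `^ s)%:E).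
Proof.
apply/measurable_EFinP; apply: (measurableT_comp (measurable_powR s)).
exact: md.
Qed.

Lemma integral_le_cst (f : euclid R n -> \bar R) A (c V : R) : measurable A ->
  (0 <= c)%R -> (forall y, A y -> f y <= c%:E) -> vol A <= V%:E ->
  \int[vol]_(y in A) f y <= (c * V)%:E.
Proof.
move=> mA c0 fc AV; apply: (le_trans (le_integral_pointwise (g := cst c%:E) vol fc)).
by rewrite integral_cst// EFinM lee_wpmul2l// lee_fin.
Qed.

Lemma integral_ge_cst (f : euclid R n -> \bar R) A (c V : R) : measurable A ->
  (0 <= c)%R -> (forall y, A y -> c%:E <= f y) -> V%:E <= vol A ->
  (c * V)%:E <= \int[vol]_(y in A) f y.
Proof.
move=> mA c0 fc AV; apply: le_trans (le_integral_pointwise (f := cst c%:E) vol fc).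
by rewrite integral_cst// EFinM lee_wpmul2l// lee_fin.
Qed.

(** What is retained of the condition that d^s belongs to A_infty, with finite
    values. *)
Definition admissible s :=
  (forall x l, (0 < l)%R -> vol.-integrable (cube x l) (fun y => (d y `^ s)%:E)) /\
  dense_part_property (fun y => (d y `^ s)%:E).

Let pow_ge0 s (y : euclid R n) : 0 <= (d y `^ s)%:E.
Proof. by rewrite lee_fin powR_ge0. Qed.

(** Compare the integral over Q with the integral over the half where d <= 2 m
    if s >= 0, or d >= m / 2 if s <= 0. On this half d^s is at most a multiple
    of m^s. *)
Lemma integral_pow_le s : admissible s -> exists C : R, (0 < C)%R /\
  forall x l m, (0 < l)%R -> is_median x l m ->
  \int[vol]_(y in cube x l) (d y `^ s)%:E <= (C * (m `^ s * l ^+ n))%:E.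
Proof.
move=> [_ ds].
have h0 : (0 < 2^-1 :> R)%R by rewrite invr_gt0.
have [C [C0 HC]] := ds _ h0.
exists (C * 2 `^ `|s|)%R; split; first by rewrite mulr_gt0// powR_gt0.
move=> x l m l0 [m0 H1 H2].
have mQ := measurable_cube x l.
have [s0|/ltW s0] := leP 0%R s.
  have mA : measurable (cube x l `&` [set y | d y <= 2 * m]%R).
    by apply: measurableI => //; exact: measurable_dist_le.
  apply: (le_trans (HC x l _ l0 mA (@subIsetl _ _ _) H2)).
  rewrite -mulrA EFinM lee_wpmul2l//; first by rewrite lee_fin ltW.
  rewrite mulrA; apply: integral_le_cst => //.
  - by rewrite mulr_ge0// powR_ge0.
  - by move=> y [_ /= dy]; rewrite lee_fin powR_le_nneg// ltW.
  - by apply: vol_cubeI_le => //; exact: measurable_dist_le.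
have mA : measurable (cube x l `&` [set y | m / 2 <= d y]%R).
  by apply: measurableI => //; exact: measurable_dist_ge.
apply: (le_trans (HC x l _ l0 mA (@subIsetl _ _ _) H1)).
rewrite -mulrA EFinM lee_wpmul2l//; first by rewrite lee_fin ltW.
rewrite mulrA; apply: integral_le_cst => //.
- by rewrite mulr_ge0// powR_ge0.
- move=> y [_ /= dy]; rewrite lee_fin powR_le_npos//; last by lra.
  by apply: lt_le_trans dy; rewrite divr_gt0.
- by apply: vol_cubeI_le => //; exact: measurable_dist_ge.
Qed.

(** The null set where d = 0 has to be removed before negative powers are
    compared, because 0 to a negative power is 0 in the convention for real
    powers. *)
Lemma vol_diff_null A : measurable A ->
  vol (A `&` [set y | d y != 0%R]) = vol A.
Proof.
move=> mA; apply/eqP; rewrite eq_le; apply/andP; split.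
  apply: le_measure; rewrite ?inE; [|exact: mA|exact: subIsetl].
  apply: measurableI => //.
  rewrite (_ : [set y | _] = ~` [set y | d y = 0%R]).
    by apply: measurableC; exact: measurable_dist_eq0.
  by apply/seteqP; split => y /= /eqP.
rewrite -[leRHS]adde0 -dnull.
have mN := measurable_dist_eq0.
have mB : measurable (A `&` [set y | d y != 0%R]).
  apply: measurableI => //.
  rewrite (_ : [set y | _] = ~` [set y | d y = 0%R]); first exact: measurableC.
  by apply/seteqP; split => y /= /eqP.
apply: (@le_trans _ _ (vol ((A `&` [set y | d y != 0%R]) `|` [set x | d x = 0%R]))).
  apply: le_measure; rewrite ?inE//; first exact: measurableU.
  by move=> y Ay; have [dy|dy] := eqVneq (d y) 0%R; [right|left].
exact: measureU2.
Qed.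

(** The mean of d^(-beta) over Q is at most a multiple of m^(-beta), so d is
    rarely much smaller than m. Nor is it often much larger: by
    dense_part_property a large part of Q where d^(-beta) is tiny would force
    the integral over Q to be tiny, while d <= 2 m on half of Q. Each
    exceptional part takes at most an eighth of Q. *)
Lemma concentration beta : (0 < beta)%R -> admissible (- beta) ->
  exists K : R, (1 <= K)%R /\
  forall x l m A, (0 < l)%R -> is_median x l m -> measurable A ->
    A `<=` cube x l -> (2^-1 * l ^+ n)%:E <= vol A ->
    (4^-1 * l ^+ n)%:E <=
      vol (A `&` ([set y | m <= K * d y]%R `&` [set y | d y <= K * m]%R)).
Proof.
move=> b0 ab; have [_ db] := ab.
have [C [C0 HC]] := integral_pow_le ab.
have h0 : (0 < 8^-1 :> R)%R by rewrite invr_gt0.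
have [C8 [C80 HC8]] := db _ h0.
(* Where d >= K m the weight is at most m^(-beta) / Y; if this part had
   density 1/8, dense_part_property would force Y <= c2. Where d <= m / K the
   weight is at least Y m^(-beta), so this part has density at most C / Y <=
   1/8. The number Y = K^beta exceeds both bounds. *)
pose c2 : R := (2 * 2 `^ beta * C8)%R.
have c20 : (0 < c2)%R by rewrite !mulr_gt0// powR_gt0.
pose Y : R := (1 + c2 + 8 * C)%R.
have Y1 : (1 <= Y)%R by rewrite /Y; lra.
have Y0 : (0 < Y)%R by lra.
have bn : (- beta != 0)%R by rewrite oppr_eq0 gt_eqF.
pose K := (Y `^ beta^-1)%R.
have K0 : (0 < K)%R by rewrite powR_gt0.
have KY : (K `^ (- beta) = Y^-1)%R.
  by rewrite /K -powRrM mulrN mulVf ?gt_eqF// powR_inv1// ltW.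
have K1 : (1 <= K)%R by rewrite -(powRr0 Y) ler_powR// invr_ge0 ltW.
exists K; split => // x l m A l0 med mA AQ HA.
have [m0 M1 M2] := med.
have mQ := measurable_cube x l.
pose V : R := (l ^+ n)%R; have V0 : (0 < V)%R by rewrite exprn_gt0.
pose mb := (m `^ (- beta))%R; have mb0 : (0 < mb)%R by rewrite powR_gt0.
have IQ := HC x l m l0 med; rewrite -/V -/mb in IQ.
pose N := [set y | d y != 0%R].
have mN : measurable N.
  rewrite (_ : N = ~` [set y | d y = 0%R]).
    by apply: measurableC; exact: measurable_dist_eq0.
  by apply/seteqP; split => y /= /eqP.
have dpos y : N y -> (0 < d y)%R by move=> Ny; rewrite lt_neqAle eq_sym Ny d0.
pose B1 := cube x l `&` ([set y | K * m <= d y]%R `&` N).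
pose B2 := cube x l `&` ([set y | d y <= m / K]%R `&` N).
have mB1 : measurable B1.
  by apply: measurableI => //; apply: measurableI => //; exact: measurable_dist_ge.
have mB2 : measurable B2.
  by apply: measurableI => //; apply: measurableI => //; exact: measurable_dist_le.
have B1V : vol B1 < (8^-1 * V)%:E.
  rewrite ltNge; apply/negP => HB.
  have U := HC8 x l B1 l0 mB1 (@subIsetl _ _ _) HB.
  have U2 : \int[vol]_(y in B1) (d y `^ (- beta))%:E <= (Y^-1 * mb * V)%:E.
    apply: integral_le_cst => //.
    - by rewrite mulr_ge0 ?invr_ge0 ?(ltW Y0) ?(ltW mb0).
    - move=> y [_ [/= Kd _]]; rewrite lee_fin -KY -powRM ?(ltW K0) ?(ltW m0)//.
      have Km : (0 < K * m)%R by rewrite mulr_gt0.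
      have := @powR_le_npos _ (- beta)%R (d y) (K * m)%R 1.
      rewrite powR1 !mul1r; apply => //; first by lra.
      exact: lt_le_trans Kd.
    - apply: vol_cubeI_le => //; apply: measurableI => //; exact: measurable_dist_ge.
  have mD : measurable (cube x l `&` [set y | d y <= 2 * m]%R).
    by apply: measurableI => //; exact: measurable_dist_le.
  have mL : measurable (cube x l `&` [set y | d y <= 2 * m]%R `&` N) by exact: measurableI.
  have L : (2 `^ (- beta) * mb * (2^-1 * V))%:E <= \int[vol]_(y in cube x l) (d y `^ (- beta))%:E.
    apply: (@le_trans _ _ (\int[vol]_(y in cube x l `&` [set y | d y <= 2 * m]%R `&` N) (d y `^ (- beta))%:E)).
      apply: integral_ge_cst => //.
      - by rewrite mulr_ge0 ?powR_ge0.
      - move=> y [[_ /= Kd] Ny]; rewrite lee_fin -powRM ?(ltW m0)//.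
        have Km : (0 < 2 * m)%R by rewrite mulr_gt0.
        have := @powR_le_npos _ (- beta)%R (2 * m)%R (d y) 1.
        by rewrite powR1 !mul1r; apply => //; [lra|exact: dpos].
      - by rewrite vol_diff_null.
    by apply: le_integral_subset => [//|y [[]]].
  have : (2 `^ (- beta) * mb * (2^-1 * V) <= C8 * (Y^-1 * mb * V))%R.
    rewrite -lee_fin; apply: (le_trans L); apply: (le_trans U).
    by rewrite [leRHS]EFinM lee_wpmul2l// lee_fin ltW.
  rewrite powRN => H.
  have P0 : (0 < 2 `^ beta :> R)%R by rewrite powR_gt0.
  have : (Y <= c2)%R.
    rewrite -(ler_pM2l (_ : 0 < mb * V * Y^-1 * (2 * 2 `^ beta)^-1)%R); last first.
      by rewrite !mulr_gt0 ?invr_gt0// mulr_gt0.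
    move: H; rewrite (_ : (_ * _ * (2^-1 * V) = mb * V / Y / (2 * 2 `^ beta) * Y)%R); last first.
      by field; rewrite !gt_eqF.
    rewrite (_ : (C8 * (Y^-1 * mb * V) = mb * V / Y / (2 * 2 `^ beta) * c2)%R)//.
    by rewrite /c2; field; rewrite !gt_eqF.
  by rewrite /Y; lra.
have fB2 : vol B2 \is a fin_num.
  rewrite ge0_fin_numE ?measure_ge0//; apply: (le_lt_trans _ (ltry V)).
  apply: vol_cubeI_le => //; apply: measurableI => //; exact: measurable_dist_le.
have B2V : vol B2 <= (8^-1 * V)%:E.
  have L : (Y * mb * fine (vol B2))%:E <= (C * (mb * V))%:E.
    apply: le_trans IQ.
    apply: (@le_trans _ _ (\int[vol]_(y in B2) (d y `^ (- beta))%:E)).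
      apply: integral_ge_cst => //; last by rewrite fineK.
        by rewrite mulr_ge0 ?(ltW mb0) ?(ltW Y0).
      move=> y [_ [/= dK Ny]]; rewrite lee_fin -[Y]invrK -KY.
      have mK : (0 < m / K)%R by rewrite divr_gt0.
      have := @powR_le_npos _ (- beta)%R (m / K)%R (d y) 1.
      rewrite powR1 !mul1r => /(_ _ mK (dpos _ Ny) ler01 dK) H.
      apply: le_trans (H _); last by lra.
      rewrite powRM ?invr_ge0 ?(ltW m0) ?(ltW K0)// mulrC /mb ler_wpM2l ?powR_ge0//.
      rewrite -(powR_inv1 (ltW K0)) -powRrM mulN1r opprK.
      by rewrite -powRN opprK.
    by apply: le_integral_subset => [//|]; exact: subIsetl.
  rewrite -(fineK fB2) lee_fin; move: L; rewrite lee_fin.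
  rewrite (_ : (C * (mb * V) = mb * (C * V))%R); last by ring.
  rewrite (mulrC Y) -mulrA ler_pM2l// => L.
  have Y8 : (8 * C <= Y)%R by rewrite /Y; lra.
  have : (8 * C * fine (vol B2) <= Y * fine (vol B2))%R.
    by rewrite ler_wpM2r// fine_ge0.
  move=> /le_trans /(_ L); rewrite mulrAC mulrC ler_pM2l//.
  by move: (fine (vol B2)) => b; lra.
set G := _ `&` [set y | d y <= K * m]%R.
have mG : measurable G.
  apply: measurableI; last exact: measurable_dist_le.
  rewrite (_ : [set y | _] = [set y | m / K <= d y]%R); first exact: measurable_dist_ge.
  by apply/seteqP; split => y /=; rewrite ler_pdivrMr// mulrC.
have mAG : measurable (A `&` G) by exact: measurableI.
have sub : A `&` N `<=` (A `&` G) `|` (B1 `|` B2).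
  move=> y [Ay Ny]; have [h1|/ltW h1] := leP m (K * d y)%R; last first.
    by right; right; split; [exact: AQ|split => //=; rewrite ler_pdivlMr// mulrC].
  have [h2|/ltW h2] := leP (d y) (K * m)%R; first by left.
  by right; left; split; [exact: AQ|].
have fAG : vol (A `&` G) \is a fin_num.
  rewrite ge0_fin_numE ?measure_ge0//; apply: (le_lt_trans _ (ltry V)).
  rewrite -(vol_cube x (ltW l0)); apply: le_measure; rewrite ?inE//.
  by move=> y [/AQ].
have fB1 : vol B1 \is a fin_num.
  by rewrite ge0_fin_numE ?measure_ge0//; apply: (lt_trans B1V); exact: ltry.
have mBB : measurable (B1 `|` B2) by exact: measurableU.
have mAN : measurable (A `&` N) by exact: measurableI.
have mU : measurable ((A `&` G) `|` (B1 `|` B2)) by exact: measurableU.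
have big : vol A <= vol (A `&` G) + (vol B1 + vol B2).
  rewrite -(vol_diff_null mA); apply: (@le_trans _ _ (vol ((A `&` G) `|` (B1 `|` B2)))).
    by apply: le_measure; rewrite ?inE.
  apply: (le_trans (measureU2 _ mAG mBB)); apply: leeD => //; exact: measureU2.
move: (le_trans HA big) B1V B2V.
rewrite -(fineK fAG) -(fineK fB1) -(fineK fB2) -!EFinD !lee_fin lte_fin -/V.
by move: (fine (vol (A `&` G))) (fine (vol B1)) (fine (vol B2)) => u v w; lra.
Qed.

Lemma measurable_two_pow a b (D : R) :
  measurable_fun setT (fun y => (two_pow a b (d y / D))%:E).
Proof.
have mdD : measurable_fun setT (fun y => d y / D)%R.
  by apply: measurable_funM => //; exact: measurable_cst.
apply/measurable_EFinP; apply: measurable_fun_ifT.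
- by apply: measurable_fun_ltr => //; exact: measurable_cst.
- exact: measurableT_comp (measurable_powR a) mdD.
- exact: measurableT_comp (measurable_powR b) mdD.
Qed.

Lemma integral_scaled_pow_le s (D : R) : (0 < D)%R -> admissible s ->
  exists C : R, (0 < C)%R /\
  forall x l m, (0 < l)%R -> is_median x l m ->
  \int[vol]_(y in cube x l) ((d y / D) `^ s)%:E <= (C * ((m / D) `^ s * l ^+ n))%:E.
Proof.
move=> D0 ad; have [C [C0 HC]] := integral_pow_le ad.
exists C; split => // x l m l0 med; have [m0 _ _] := med.
have D0' := ltW D0; have mQ := measurable_cube x l.
rewrite (eq_integral (fun y => (D^-1 `^ s)%:E * (d y `^ s)%:E)); last first.
  by move=> y _; rewrite -EFinM powRM ?invr_ge0// mulrC.
rewrite integralZl//; last by case: ad => + _; exact.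
rewrite powRM ?invr_ge0 ?(ltW m0)//.
rewrite (_ : (C * (_ * _ * _))%R = (D^-1 `^ s * (C * (m `^ s * l ^+ n)))%R); last by ring.
rewrite EFinM lee_wpmul2l ?lee_fin ?powR_ge0//; exact: HC.
Qed.

(** If a <= b the profile is at most the sum of its two powers, each of which
    is at most the profile at m. If b < a it is at most either power, and the
    power that equals the profile at m is used. *)
Lemma integral_two_pow_le a b (D : R) : (0 < D)%R -> admissible a -> admissible b ->
  exists C : R, (0 < C)%R /\
  forall x l m, (0 < l)%R -> is_median x l m ->
  \int[vol]_(y in cube x l) (two_pow a b (d y / D))%:E <=
    (C * (two_pow a b (m / D) * l ^+ n))%:E.
Proof.
move=> D0 aa ab.
have [Ca [Ca0 Ha]] := integral_scaled_pow_le D0 aa.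
have [Cb [Cb0 Hb]] := integral_scaled_pow_le D0 ab.
have mT s : measurable_fun setT (fun y => ((d y / D) `^ s)%:E).
  apply/measurable_EFinP; apply: measurableT_comp (measurable_powR s) _.
  by apply: measurable_funM => //; exact: measurable_cst.
exists (Ca + Cb)%R; split; first by rewrite addr_gt0.
move=> x l m l0 med; have [m0 _ _] := med.
have mQ := measurable_cube x l.
have V0 : (0 < l ^+ n)%R by rewrite exprn_gt0.
have t0 : (0 < m / D)%R by rewrite divr_gt0.
have [leab|ltba] := leP a b.
  have [H1 H2] := two_pow_max leab t0.
  apply: (@le_trans _ _ (\int[vol]_(y in cube x l) (((d y / D) `^ a)%:E + ((d y / D) `^ b)%:E))).
    apply: le_integral_pointwise => y _; rewrite -EFinD lee_fin le_max_two_pow//.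
    by rewrite divr_ge0// ltW.
  rewrite ge0_integralD; last 5 first.
  - exact: mQ.
  - by move=> y _; rewrite lee_fin powR_ge0.
  - exact: measurable_funTS.
  - by move=> y _; rewrite lee_fin powR_ge0.
  - exact: measurable_funTS.
  apply: (le_trans (leeD (Ha x l m l0 med) (Hb x l m l0 med))).
  rewrite -EFinD lee_fin mulrDl; apply: lerD; rewrite ler_wpM2l ?(ltW Ca0) ?(ltW Cb0)//;
    by rewrite ler_wpM2r// ltW.
have ae s : (forall t, (0 < t)%R -> (two_pow a b t <= t `^ s)%R) ->
   \int[vol]_(y in cube x l) (two_pow a b (d y / D))%:E <=
   \int[vol]_(y in cube x l) ((d y / D) `^ s)%:E.
  move=> Hs; apply: ae_ge0_le_integral.
  - exact: mQ.
  - by move=> y _; rewrite lee_fin two_pow_ge0.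
  - by apply: measurable_funTS; exact: measurable_two_pow.
  - by move=> y _; rewrite lee_fin powR_ge0.
  - exact: measurable_funTS.
  exists [set y | d y = 0%R]; split => //; first exact: measurable_dist_eq0.
  move=> y /=; apply: contra_notP => /eqP dy _.
  by rewrite lee_fin Hs// divr_gt0// lt_neqAle eq_sym dy d0.
rewrite /two_pow; case: ifP => _.
  apply: (le_trans (ae a _)) => [t tp|]; first by have [] := two_pow_min ltba tp.
  apply: (le_trans (Ha x l m l0 med)); rewrite lee_fin ler_wpM2r ?lerDl ?(ltW Cb0)//.
  by rewrite mulr_ge0 ?powR_ge0// ltW.
apply: (le_trans (ae b _)) => [t tp|]; first by have [] := two_pow_min ltba tp.
apply: (le_trans (Hb x l m l0 med)); rewrite lee_fin ler_wpM2r ?lerDr ?(ltW Ca0)//.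
by rewrite mulr_ge0 ?powR_ge0// ltW.
Qed.

(** On a quarter of Q inside A, d is comparable to m, so the profile is
    comparable to its value at m. *)
Lemma integral_two_pow_ge a b (D beta : R) : (0 < D)%R -> (0 < beta)%R ->
  admissible (- beta) -> exists c : R, (0 < c)%R /\
  forall x l m A, (0 < l)%R -> is_median x l m -> measurable A ->
    A `<=` cube x l -> (2^-1 * l ^+ n)%:E <= vol A ->
  (c * (two_pow a b (m / D) * l ^+ n))%:E <=
  \int[vol]_(y in A) (two_pow a b (d y / D))%:E.
Proof.
move=> D0 b0 adb; have [K [K1 HK]] := concentration b0 adb.
have K0 : (0 < K)%R by lra.
pose M := (K `^ (`|a| + `|b|))%R; have M0 : (0 < M)%R by rewrite powR_gt0.
exists (4^-1 / M)%R; split; first by rewrite divr_gt0.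
move=> x l m A l0 med mA AQ HA; have [m0 _ _] := med.
have t0 : (0 < m / D)%R by rewrite divr_gt0.
have mG : measurable ([set y | m <= K * d y]%R `&` [set y | d y <= K * m]%R).
  apply: measurableI; last exact: measurable_dist_le.
  rewrite (_ : [set y | _] = [set y | m / K <= d y]%R); first exact: measurable_dist_ge.
  by apply/seteqP; split => y /=; rewrite ler_pdivrMr// mulrC.
have := HK x l m A l0 med mA AQ HA.
set G := _ `&` [set y | d y <= K * m]%R => HG.
have mAG : measurable (A `&` G) by exact: measurableI.
apply: (@le_trans _ _ (\int[vol]_(y in A `&` G) (two_pow a b (d y / D))%:E)).
  rewrite [X in X%:E <= _](_ : _ = (M^-1 * two_pow a b (m / D) * (4^-1 * l ^+ n))%R); last by ring.
  apply: integral_ge_cst => //.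
    by rewrite mulr_ge0 ?two_pow_ge0// invr_ge0 ltW.
  move=> y [_ [/= G1 G2]]; rewrite lee_fin ler_pdivrMl//.
  have dy : (0 < d y)%R by rewrite -(pmulr_rgt0 _ K0); exact: lt_le_trans G1.
  apply: two_pow_scale => //; first by rewrite divr_gt0.
    by rewrite mulrA ler_pM2r ?invr_gt0.
  by rewrite mulrA ler_pM2r ?invr_gt0.
apply: le_integral_subset; last exact: subIsetl.
by move=> y; rewrite lee_fin two_pow_ge0.
Qed.

End distribution.

(** * The distance function of a median porous set *)

Section admissible.
Context {R : realType} {n : nat}.
Implicit Types (E : set (euclid R n)).

(** Cubes exhausting the space, to pass from local to global measurability. *)
Definition center_cube k : set (euclid R n) :=
  cube [tuple (- k.+1%:R : R) | i < n] (2 * k.+1%:R).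

Lemma center_cube_cover (y : euclid R n) : exists k, center_cube k y.
Proof.
exists (Num.truncn (\sum_(i < n) `|tnth y i|)) => i.
rewrite tnth_mktuple; set k := Num.truncn _.
have Hk : `|tnth y i| <= k.+1%:R.
  apply: (@le_trans _ _ (\sum_(i < n) `|tnth y i|)); last by rewrite ltW// truncnS_gt.
  by rewrite (bigD1 i)//= lerDl sumr_ge0.
have := ler_norm (tnth y i); have := ler_norm (- tnth y i); rewrite normrN => H1 H2.
by apply/andP; split; lra.
Qed.

Lemma dist_to_ge0 E x : 0 <= dist_to E x.
Proof.
have [->|/set0P[y Ey]] := eqVneq E set0; first by rewrite /dist_to image_set0 inf0.
apply: lb_le_inf; first by exists (eudist x y), y.
by move=> _ [z _ <-]; exact: sqrtr_ge0.
Qed.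

Lemma powRe_ge0 (a r : R) : (0 <= powRe a r)%E.
Proof. by rewrite /powRe; case: ifP => // _; rewrite lee_fin powR_ge0. Qed.

Lemma powReE (a r : R) : a != 0 -> powRe a r = (a `^ r)%:E.
Proof. by rewrite /powRe => /negbTE ->. Qed.

Section one_exponent.
Variables (E : set (euclid R n)) (beta : R).
Hypothesis b0 : 0 < beta.
Hypothesis Ib : I_infty E beta.

(** Local integrability of d^(-beta) includes its measurability on cubes, from
    which that of d follows since the power is monotone. *)
Lemma measurable_dist_to : measurable_fun setT (dist_to E).
Proof.
have [[_ iw] _] := Ib.
apply: (measurability (@RGenCInfty.G R)); first exact: RGenCInfty.measurableE.
move=> _ [_] [t] -> <-.
rewrite (_ : _ `&` _ = [set x | t <= dist_to E x]); last first.
  by apply/seteqP; split => y /=; rewrite in_itv/= andbT; [case|].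
have [t0|t0] := leP t 0.
  rewrite (_ : [set _ | _] = setT)//.
  by apply/seteqP; split => // y _ /=; rewrite (le_trans t0)// dist_to_ge0.
rewrite (_ : [set _ | _] = \bigcup_k (center_cube k `&`
    [set x | (powRe (dist_to E x) (- beta) <= (t `^ (- beta))%:E)%E])).
  apply: bigcupT_measurable => k; apply: emeasurable_fun_infty_c.
    exact: measurable_cube.
  by have /integrableP[] : vol.-integrable (center_cube k) (fun x => powRe (dist_to E x) (- beta)) by apply: iw.
have key x : (t <= dist_to E x) = (powRe (dist_to E x) (- beta) <= (t `^ (- beta))%:E)%E.
  have d0 := dist_to_ge0 E x; rewrite /powRe oppr_lt0 b0 andbT.
  have [->|dn] := eqVneq (dist_to E x) 0.
    by rewrite leNgt t0 leNgt ltry.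
  have dp : 0 < dist_to E x by rewrite lt_neqAle eq_sym dn.
  rewrite lee_fin !powRN lef_pV2 ?posrE ?powR_gt0//; apply/idP/idP => H.
    by rewrite ge0_ler_powR ?nnegrE// ltW.
  rewrite leNgt; apply/negP => H2; move: H; rewrite leNgt => /negP; apply.
  by rewrite gt0_ltr_powR// nnegrE ltW.
apply/seteqP; split => y /=; last by move=> [k _ [_ /=]]; rewrite key.
by rewrite key => H; have [k yk] := center_cube_cover y; exists k.
Qed.

(** The locally integrable weight d^(-beta) is infinite where d = 0. *)
Lemma vol_dist_to_eq0 : vol [set x | dist_to E x = 0] = 0%E.
Proof.
have [[_ iw] _] := Ib.
apply: measure_negligible; first exact: (measurable_dist_eq0 measurable_dist_to).
apply: (@negligibleS _ _ _ _ (\bigcup_k [set x | center_cube k x /\ dist_to E x = 0])).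
  by move=> x /= Hx; have [k xk] := center_cube_cover x; exists k.
apply: negligible_bigcup => k.
have ik : vol.-integrable (center_cube k) (fun x => powRe (dist_to E x) (- beta)).
  by apply: iw.
have := integrable_ae (measurable_cube _ _) ik.
apply: negligibleS => x /= [xk dx] /(_ xk).
by rewrite /powRe dx eqxx oppr_lt0 b0.
Qed.

(** The two conventions for negative powers of 0 differ only on the null set d
    = 0. *)
Lemma admissible_I_infty s : I_infty E (- s) -> admissible (dist_to E) s.
Proof.
move=> Is; have [[_ iw] _] := Is.
have dbl := A_infty_dense_part (fun x => powRe_ge0 _ _) Is.
rewrite opprK in iw dbl.
have aeq A : measurable A ->
    ae_eq vol A (fun y => powRe (dist_to E y) s) (fun y => (dist_to E y `^ s)%:E).
  move=> mA; exists [set x | dist_to E x = 0]; split.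
  - exact: (measurable_dist_eq0 measurable_dist_to).
  - exact: vol_dist_to_eq0.
  - by move=> y /=; apply: contra_notP => /eqP dy _; rewrite powReE.
have mp A : measurable_fun A (fun y => (dist_to E y `^ s)%:E).
  by apply: measurable_funTS; exact: measurable_dist_pow measurable_dist_to _.
have mpe A : measurable A -> measurable_fun A (fun y => powRe (dist_to E y) s).
  move=> mA; apply: measurable_funTS; apply: measurable_fun_ifT.
  - apply: measurable_and; last exact: measurable_cst.
    apply: measurable_fun_eqr; [exact: measurable_dist_to|exact: measurable_cst].
  - exact: measurable_cst.
  - exact: (measurable_dist_pow measurable_dist_to).
have eqint A : measurable A ->
    (\int[vol]_(y in A) powRe (dist_to E y) s = \int[vol]_(y in A) (dist_to E y `^ s)%:E)%E.
  move=> mA; by apply: ae_eq_integral; [exact: mA|exact: mpe|exact: mp|exact: aeq].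
split.
  move=> x l l0; have mQ := measurable_cube x l.
  apply/integrableP; split => //.
  have /integrableP[_] := iw x l l0.
  apply: le_lt_trans.
  rewrite (eq_integral (fun y => (dist_to E y `^ s)%:E)); last first.
    by move=> y _; rewrite gee0_abs// lee_fin powR_ge0.
  rewrite -eqint// le_eqVlt; apply/orP; left; apply/eqP; apply: eq_integral => y _.
  by rewrite gee0_abs// powRe_ge0.
move=> theta t0; have [C [C0 HC]] := dbl theta t0; exists C; split => // x l A l0 mA AQ HA.
by rewrite -!eqint ?HC//; exact: measurable_cube.
Qed.

End one_exponent.
End admissible.

(** * Minkowski dimension and the size of a cube *)

Section geometry_of_E.
Context {R : realType} {n : nat}.
Implicit Types (E : set (euclid R n)) (x y : euclid R n).

Lemma coord_le_eudist x y i : `|tnth x i - tnth y i| <= eudist x y.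
Proof.
rewrite -sqrtr_sqr /eudist ler_wsqrtr// (bigD1 i)//= lerDl.
by rewrite sumr_ge0// => j _; exact: sqr_ge0.
Qed.

(** If E is covered by k balls of radius m, then the set where d <= 2 m is
    covered by the k concentric cubes of side 8 m. *)
Lemma vol_near_cover E k (c : 'I_k -> euclid R n) m : 0 < m -> E !=set0 ->
  measurable [set y | dist_to E y <= 2 * m] ->
  E `<=` \bigcup_i cball (c i) m ->
  (vol [set y | (dist_to E y <= 2 * m)%R] <= (k%:R * (8 * m) ^+ n)%:E)%E.
Proof.
move=> m0 E0 mS Ec.
(* Points of the set are at distance less than 3 m from E, hence less than 4 m
   from a centre. *)
pose B (i : 'I_k) := cube [tuple (tnth (c i) j - 4 * m) | j < n] (8 * m).
have sub : [set y | dist_to E y <= 2 * m] `<=` \bigcup_(i in [set: 'I_k]) B i.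
  move=> y /= dy; have : inf [set eudist y z | z in E] < 3 * m.
    by apply: (le_lt_trans dy); lra.
  have [e0 Ee0] := E0.
  case/inf_lt; first by exists (eudist y e0), e0.
  move=> _ [e Ee <-] He; have [i _ ci] := Ec e Ee; exists i => // j.
  rewrite tnth_mktuple; move: ci; rewrite /cball/= => ci.
  have := le_lt_trans (coord_le_eudist y e j) He.
  have := le_trans (coord_le_eudist (c i) e j) ci.
  rewrite ler_norml ltr_norml => /andP[a1 a2] /andP[a3 a4]; apply/andP; split; lra.
have mB i : measurable (B i) by exact: measurable_cube.
have vB i : vol (B i) = ((8 * m) ^+ n)%:E by rewrite vol_cube//; lra.
pose F j := oapp B set0 (insub j : option 'I_k).
have FB (i : 'I_k) : F i = B i by rewrite /F valK.
apply: (@le_trans _ _ (\sum_(i < k) vol (F i))%E).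
  apply: (@content_subadditive _ _ _ vol _ F k) => //.
    by move=> j jk; rewrite (FB (Ordinal jk)).
  by rewrite -bigcup_mkord => y /sub[i _ yB]; exists i => //=; rewrite FB.
rewrite (eq_bigr (fun=> ((8 * m) ^+ n)%:E)); last by move=> i _; rewrite FB vB.
by rewrite sumEFin lee_fin sumr_const card_ord [leRHS]mulr_natl.
Qed.

(** Exponentiating the limit superior that defines the Minkowski dimension. *)
Lemma covering_bound E (lam : R) : (upper_minkowski_dim E < lam%:E)%E ->
  exists eps : R, 0 < eps /\ forall delta, 0 < delta -> delta < eps ->
    exists k (c : 'I_k -> euclid R n),
      E `<=` \bigcup_i cball (c i) delta /\ k%:R < delta `^ (- lam).
Proof.
case/ereal_inf_lt => _ [V [e /= e0 HV] <-] supV.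
exists (Num.min e 1); split; first by rewrite lt_min e0 ltr01.
move=> delta d0; rewrite lt_min => /andP[de d1].
have Vd : V delta.
  by apply: HV => //=; rewrite sub0r normrN gtr0_norm.
have L0 : 0 < ln delta^-1 by rewrite ln_gt0// invf_gt1.
have : (lne (covering_number E delta) * ((ln delta^-1)^-1)%:E < lam%:E)%E.
  by apply: le_lt_trans supV; apply: ereal_sup_ubound; exists delta.
rewrite lte_pdivrMr// => H.
have : (covering_number E delta < (delta `^ (- lam))%:E)%E.
  move: H; case: (covering_number E delta) => [r||] //=; last by move=> _; exact: ltNyr.
  case: ifPn => [r0 _|]; first by rewrite lte_fin (le_lt_trans r0)// powR_gt0.
  rewrite -ltNge => r0; rewrite -EFinM !lte_fin => H.
  rewrite -[r]lnK ?posrE// /powR gt_eqF// ltr_expR.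
  by move: H; rewrite lnV ?posrE// mulrN mulNr.
case/ereal_inf_lt => _ [k [c Ec] <-]; rewrite lte_fin => kd.
by exists k, c.
Qed.

Variables (E : set (euclid R n)) (D kappa : R).
Hypothesis n0 : (0 < n)%N.
Hypothesis D0 : 0 < D.
Hypothesis diamE : diam E = D%:E.
Hypothesis md : measurable_fun setT (dist_to E).
Hypothesis kappa0 : 0 < kappa.
Hypothesis dimE : (upper_minkowski_dim E < (n%:R - kappa)%:E)%E.

Let E0 : E !=set0.
Proof.
apply/set0P/eqP => E0; move: diamE; rewrite /diam E0 setX0 image_set0.
by rewrite ereal_sup0.
Qed.

Let vol_near_big m : D <= m ->
  (vol [set y | (dist_to E y <= 2 * m)%R] <= ((8 * m) ^+ n)%:E)%E.
Proof.
move=> Dm; have m0 : 0 < m by exact: lt_le_trans Dm.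
have [e Ee] := E0.
have := @vol_near_cover E 1 (fun=> e) m m0 E0 (measurable_dist_le md _).
rewrite mul1r; apply => z Ez; exists ord0 => //=; rewrite /cball/=.
apply: le_trans Dm; rewrite -lee_fin -diamE.
by apply: ereal_sup_ubound; exists (e, z).
Qed.

(** Half of the cube lies in the set where d <= 2 m, whose volume is bounded
    by a covering: by one ball if m >= D, and by less than m^(kappa - n) balls
    if m is small. The values of m between the threshold of smallness and D
    only affect the constant. *)
Lemma median_cube_bound : exists C : R, 0 < C /\
  forall x l m, 0 < l -> is_median (dist_to E) x l m ->
  (m < D -> l ^+ n <= C * m `^ kappa) /\ (D <= m -> l <= C * m).
Proof.
have [eps [eps0 Heps]] := covering_bound dimE.
pose C1 : R := 2 * 8 ^+ n.
pose C2 : R := 2 * (8 * D) ^+ n / eps `^ kappa.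
have C10 : 0 < C1 by rewrite mulr_gt0// exprn_gt0.
have D0' := D0.
have C20 : 0 < C2.
  by rewrite divr_gt0 ?powR_gt0// mulr_gt0// exprn_gt0// mulr_gt0.
(* C1 serves for m below eps, C2 for m between eps and D, and 16 for m above
   D. *)
exists (C1 + C2 + 16); split; first by rewrite !addr_gt0.
move=> x l m l0 [m0 _ H].
have mS := measurable_dist_le md (2 * m).
have mQ := measurable_cube x l.
have {}H : ((2^-1 * l ^+ n)%:E <= vol [set y | (dist_to E y <= 2 * m)%R])%E.
  apply: (le_trans H); apply: le_measure; rewrite ?inE//; first exact: measurableI.
split=> [mD|Dm]; last first.
  have := le_trans H (vol_near_big Dm); rewrite lee_fin => H1.
  have H2 : l ^+ n <= (16 * m) ^+ n.
    apply: (@le_trans _ _ (2 * (8 * m) ^+ n)); first by move: H1; move: (l ^+ n) (_ ^+ n) => u v; lra.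
    rewrite (_ : 16 * m = 2 * (8 * m)); last by ring.
    rewrite [leRHS]exprMn ler_wpM2r ?exprn_ge0//; first by rewrite mulr_ge0// ltW.
    by rewrite -[leLHS]expr1 ler_eXn2l// ltr1n.
  apply: (@le_trans _ _ (16 * m)).
    by rewrite -(ler_pXn2r n0) ?nnegrE ?mulr_ge0 ?(ltW m0) ?(ltW l0).
  by rewrite ler_pM2r// lerDr addr_ge0 ?(ltW C10) ?(ltW C20).
have [me|em] := ltP m eps.
  have [k [c [Ec kc]]] := Heps m m0 me.
  have := le_trans H (vol_near_cover m0 E0 mS Ec); rewrite lee_fin => H1.
  apply: (@le_trans _ _ (C1 * m `^ kappa)); last first.
    by rewrite ler_wpM2r ?powR_ge0// -addrA lerDl addr_ge0 ?(ltW C10) ?(ltW C20).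
  have H2 : k%:R * (8 * m) ^+ n <= 8 ^+ n * m `^ kappa.
    apply: (@le_trans _ _ (m `^ (- (n%:R - kappa)) * (8 * m) ^+ n)).
      by rewrite ler_wpM2r ?exprn_ge0 ?mulr_ge0 ?(ltW m0) ?(ltW kc).
    rewrite exprMn mulrCA ler_wpM2l ?exprn_ge0// -powR_mulrn ?(ltW m0)//.
    rewrite -powRD; last by rewrite (gt_eqF m0) implybT.
    by rewrite (_ : _ + _ = kappa)//; ring.
  rewrite /C1; move: H1 H2; move: (l ^+ n) (_ * _ ^+ n) (m `^ kappa) => u v w.
  by move: (8 ^+ n) => z; lra.
have := vol_near_big (lexx D) => H2.
have H3 : ((2^-1 * l ^+ n)%:E <= ((8 * D) ^+ n)%:E)%E.
  apply: (le_trans H); apply: le_trans H2; apply: le_measure; rewrite ?inE//.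
    exact: measurable_dist_le.
  by move=> y /= /le_trans; apply; rewrite ler_pM2l// ltW.
move: H3; rewrite lee_fin => H3.
apply: (@le_trans _ _ (C2 * m `^ kappa)); last first.
  by rewrite ler_wpM2r ?powR_ge0// [C1 + _]addrC -addrA lerDl addr_ge0 ?(ltW C10) ?(ltW C20).
have H4 : 1 <= m `^ kappa / eps `^ kappa.
  rewrite ler_pdivlMr ?powR_gt0// mul1r ge0_ler_powR ?nnegrE ?(ltW m0) ?(ltW eps0)//.
  exact: ltW.
apply: (@le_trans _ _ (2 * (8 * D) ^+ n * (m `^ kappa / eps `^ kappa))); last first.
  by rewrite /C2; move: (_ ^+ n) => z; rewrite mulrA mulrAC.
rewrite -[leLHS]mulr1 ler_pM ?exprn_ge0 ?(ltW l0)//.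
by move: H3; move: (l ^+ n) (_ ^+ n) => u v; lra.
Qed.

End geometry_of_E.

(** * The cube condition for the two weights *)

Section half_part_weights.
Context {R : realType} {n : nat}.

(** The continuous counterpart of half_part_property, with positivity and
    finiteness. *)
Definition half_part_weight (c : R) (u : euclid R n -> R) := forall x l, 0 < l ->
  (\int[vol]_(y in cube x l) (u y)%:E < +oo)%E /\
  forall A, measurable A -> A `<=` cube x l ->
    ((2^-1 * l ^+ n)%:E <= vol A)%E ->
    (0 < \int[vol]_(y in A) (u y)%:E)%E /\
    (\int[vol]_(y in cube x l) (u y)%:E <= c%:E * \int[vol]_(y in A) (u y)%:E)%E.

Lemma two_powM (a b a' b' t : R) : 0 < t ->
  two_pow a b t * two_pow a' b' t = two_pow (a + a') (b + b') t.
Proof.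
by move=> t0; rewrite /two_pow; case: ifP => _; rewrite powRD// (gt_eqF t0) implybT.
Qed.

Lemma two_powX (a b r t : R) : two_pow a b t `^ r = two_pow (a * r) (b * r) t.
Proof. by rewrite /two_pow; case: ifP => _; rewrite powRrM. Qed.

Variable E : set (euclid R n).
Variables (D beta : R).
Hypothesis D0 : 0 < D.
Hypothesis beta0 : 0 < beta.
Hypothesis Ib : I_infty E beta.
Local Notation d := (dist_to E).

Let md : measurable_fun setT d := measurable_dist_to beta0 Ib.
Let dnull := vol_dist_to_eq0 beta0 Ib.
Let d0 x : 0 <= d x := dist_to_ge0 E x.
Let adm_beta : admissible d (- beta).
Proof. by apply: (admissible_I_infty beta0 Ib); rewrite opprK. Qed.

Lemma half_part_two_pow a b : admissible d a -> admissible d b ->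
  exists c, 0 < c /\ half_part_weight c (fun x => two_pow a b (d x / D)).
Proof.
move=> aa ab.
have [C [C0 HC]] := integral_two_pow_le d0 md dnull D0 aa ab.
have [c [c0 Hc]] := integral_two_pow_ge d0 md dnull a b D0 beta0 adm_beta.
exists (C / c); split; first by rewrite divr_gt0.
move=> x l l0; have [m med] := exists_median d0 md dnull x l0.
have [m0 _ _] := med.
have P0 : 0 < two_pow a b (m / D) * l ^+ n.
  by rewrite mulr_gt0 ?exprn_gt0// two_pow_gt0// divr_gt0.
split; first by apply: (le_lt_trans (HC x l m l0 med)); exact: ltry.
move=> A mA AQ HA; have H := Hc x l m A l0 med mA AQ HA.
split; first by apply: lt_le_trans H; rewrite lte_fin mulr_gt0.
apply: (le_trans (HC x l m l0 med)).
have Cc : (0 <= (C / c)%:E)%E by rewrite lee_fin divr_ge0 ?(ltW C0) ?(ltW c0).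
apply: le_trans (lee_wpmul2l Cc H).
rewrite -EFinM lee_fin le_eqVlt; apply/orP; left; apply/eqP.
by field; rewrite gt_eqF.
Qed.

Variables (p q alpha kappa g1 g2 s1 s2 : R).
Hypothesis n0 : (0 < n)%N.
Hypothesis p1 : 1 < p.
Hypothesis q0 : 0 < q.
Hypothesis Th0 : 0 < Theta n p q alpha.
Hypothesis diamE : diam E = D%:E.
Hypothesis kappa0 : 0 < kappa.
Hypothesis dimE : (upper_minkowski_dim E < (n%:R - kappa)%:E)%E.
Hypothesis ag1 : admissible d g1.
Hypothesis ag2 : admissible d g2.
Hypothesis as1 : admissible d s1.
Hypothesis as2 : admissible d s2.
Hypothesis loc : g1 * q^-1 + s1 * (1 - p^-1) = - (kappa / n%:R * Theta n p q alpha).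
Hypothesis glob : g2 * q^-1 + s2 * (1 - p^-1) = - Theta n p q alpha.

Local Notation w := (fun x => two_pow g1 g2 (d x / D)).
Local Notation sigma := (fun x => two_pow s1 s2 (d x / D)).

(** The cube condition expressed by the side l and the median m; the exponents
    -kappa * Theta / n and -Theta make it a restatement of median_cube_bound. *)
Let median_apq : exists K, 0 < K /\ forall x l m, 0 < l -> is_median d x l m ->
  l `^ Theta n p q alpha *
  two_pow (- (kappa / n%:R * Theta n p q alpha)) (- Theta n p q alpha) (m / D) <= K.
Proof.
have [C [C0 HC]] := median_cube_bound n0 D0 diamE md kappa0 dimE.
move: Th0; set th := Theta _ _ _ _ => Th.
have nR : 0 < n%:R :> R by rewrite ltr0n.
pose K1 := (C * D `^ kappa) `^ (th / n%:R).
pose K2 := (C * D) `^ th.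
have K10 : 0 < K1 by rewrite powR_gt0// mulr_gt0// powR_gt0.
have K20 : 0 < K2 by rewrite powR_gt0// mulr_gt0.
exists (K1 + K2); split; first exact: addr_gt0.
move=> x l m l0 med; have [m0 _ _] := med.
have [H1 H2] := HC x l m l0 med.
have lp := ltW l0; have mp := ltW m0; have Cp := ltW C0; have Dp := ltW D0.
rewrite /two_pow ltr_pdivrMr// mul1r; case: ltP => mD.
  apply: (@le_trans _ _ K1); last by rewrite lerDl ltW.
  rewrite powRN ler_pdivrMr ?powR_gt0 ?divr_gt0//.
  rewrite (_ : kappa / n%:R * th = kappa * (th / n%:R)); last by ring.
  have tp : 0 <= m / D by exact: divr_ge0.
  have tk : 0 <= (m / D) `^ kappa := powR_ge0 _ _.
  have CD : 0 <= C * D `^ kappa by rewrite mulr_ge0 ?powR_ge0.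
  have Em : D * (m / D) = m by rewrite mulrC divfK ?gt_eqF.
  rewrite (powRrM _ kappa) /K1 -(powRM _ CD tk) -mulrA -(powRM _ Dp tp) Em.
  have -> : l `^ th = (l ^+ n) `^ (th / n%:R).
    rewrite -powR_mulrn// -powRrM; congr (_ `^ _); field; by rewrite gt_eqF.
  apply: ler_powR_base; rewrite ?exprn_ge0//; last exact: H1.
  by rewrite divr_ge0 ?(ltW Th) ?(ltW nR).
apply: (@le_trans _ _ K2); last by rewrite lerDr ltW.
rewrite powRN ler_pdivrMr ?powR_gt0 ?divr_gt0//.
have tp : 0 <= m / D by exact: divr_ge0.
have CD : 0 <= C * D by exact: mulr_ge0.
rewrite /K2 -(powRM _ CD tp) -mulrA [D * _]mulrC divfK ?gt_eqF//.
apply: ler_powR_base => //; [exact: ltW|exact: H2].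
Qed.

(** Replacing the means of w and sigma by the values of the profiles at m
    turns the product into that of median_apq, since n / q + n (1 - 1 / p) +
    alpha - n = Theta. *)
Lemma cube_Apq : exists K, 0 < K /\ forall x l, 0 < l ->
  l `^ (alpha - n%:R) * fine (\int[vol]_(y in cube x l) (w y)%:E) `^ q^-1 *
  fine (\int[vol]_(y in cube x l) (sigma y)%:E) `^ (1 - p^-1) <= K.
Proof.
have [K [K0 HK]] := median_apq.
have [Cw [Cw0 Hw]] := integral_two_pow_le d0 md dnull D0 ag1 ag2.
have [Cs [Cs0 Hs]] := integral_two_pow_le d0 md dnull D0 as1 as2.
exists (Cw `^ q^-1 * Cs `^ (1 - p^-1) * K); split.
  by rewrite !mulr_gt0// powR_gt0.
move=> x l l0; have [m med] := exists_median d0 md dnull x l0.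
have [m0 _ _] := med; have t0 : 0 < m / D by rewrite divr_gt0.
have lp := ltW l0.
have qV0 : 0 <= q^-1 by rewrite invr_ge0 ltW.
have pV0 : 0 <= 1 - p^-1.
  by rewrite subr_ge0 invf_le1 ?(ltW p1)//; exact: lt_trans ltr01 p1.
have fb (u : euclid R n -> R) B : (forall y, 0 <= u y) ->
    (\int[vol]_(y in cube x l) (u y)%:E <= B%:E)%E ->
    0 <= fine (\int[vol]_(y in cube x l) (u y)%:E) <= B.
  move=> u0 HB; have I0 : (0 <= \int[vol]_(y in cube x l) (u y)%:E)%E.
    by apply: integral_ge0 => y _; rewrite lee_fin.
  rewrite fine_ge0//= -lee_fin fineK// ge0_fin_numE//.
  by apply: le_lt_trans HB _; exact: ltry.
have /andP[w0 wB] := fb _ _ (fun y => two_pow_ge0 g1 g2 (d y / D)) (Hw x l m l0 med).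
have /andP[z0 zB] := fb _ _ (fun y => two_pow_ge0 s1 s2 (d y / D)) (Hs x l m l0 med).
set W := fine _ in w0 wB *; set Z := fine _ in z0 zB *.
have V0 : 0 <= l ^+ n by rewrite exprn_ge0.
have B1 : W `^ q^-1 <= Cw `^ q^-1 * two_pow (g1 * q^-1) (g2 * q^-1) (m / D) * l `^ (n%:R * q^-1).
  rewrite -two_powX powRrM powR_mulrn// -powRM ?two_pow_ge0 ?(ltW Cw0)//.
  rewrite -powRM ?mulr_ge0 ?two_pow_ge0 ?(ltW Cw0)//.
  by apply: ler_powR_base => //; rewrite -mulrA.
have B2 : Z `^ (1 - p^-1) <= Cs `^ (1 - p^-1) * two_pow (s1 * (1 - p^-1)) (s2 * (1 - p^-1)) (m / D) * l `^ (n%:R * (1 - p^-1)).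
  rewrite -two_powX powRrM powR_mulrn// -powRM ?two_pow_ge0 ?(ltW Cs0)//.
  rewrite -powRM ?mulr_ge0 ?two_pow_ge0 ?(ltW Cs0)//.
  by apply: ler_powR_base => //; rewrite -mulrA.
rewrite -mulrA.
apply: (le_trans (ler_wpM2l (powR_ge0 _ _) (ler_pM (powR_ge0 _ _) (powR_ge0 _ _) B1 B2))).
have := HK x l m l0 med; rewrite -loc -glob -two_powM// => H.
have KC : 0 <= Cw `^ q^-1 * Cs `^ (1 - p^-1) by rewrite mulr_ge0 ?powR_ge0.
apply: le_trans (ler_wpM2l KC H).
have -> : l `^ Theta n p q alpha = l `^ (alpha - n%:R) * l `^ (n%:R * q^-1) * l `^ (n%:R * (1 - p^-1)).
  rewrite -!powRD ?(gt_eqF l0) ?implybT//; congr (_ `^ _).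
  by rewrite /Theta; ring.
by rewrite le_eqVlt; apply/orP; left; apply/eqP; ring.
Qed.

End half_part_weights.

(** * Dyadic grids *)

Section grid.
Context {R : realType} {n : nat}.
Variables (c : 'I_n -> R) (s : R) (J : nat).
Hypothesis s0 : 0 < s.

Local Notation T := {ffun 'I_n -> 'I_(2 ^ J)}.
Implicit Types (om : T) (P : pred T).

(** The atoms of the grid have side s; om indexes the atoms, and om %/ 2 ^ j
    is the position of its ancestor j generations up. *)
Definition side j : R := s * (2 ^ j)%:R.

Definition same_box j (om om' : T) : bool :=
  [forall i, (om i %/ 2 ^ j == om' i %/ 2 ^ j)%N].

Definition box j om : set (euclid R n) := [set x | forall i,
  c i + side j * (om i %/ 2 ^ j)%:R <= tnth x i
  < c i + side j * (om i %/ 2 ^ j).+1%:R].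

(** Boxes of all generations and their half parts are of this form, which
    reduces integrals over them to finite sums over the atoms. *)
Definition atoms_union P : set (euclid R n) := [set x | exists om, P om /\ box 0 om x].

(** The closed cube with the same corner and side as a box: the hypotheses on
    weights concern closed cubes. *)
Definition box_cube j om : set (euclid R n) :=
  cube [tuple c i + side j * (om i %/ 2 ^ j)%:R | i < n] (side j).

Lemma side_gt0 j : 0 < side j.
Proof. by rewrite mulr_gt0// ltr0n expn_gt0. Qed.

Lemma side0 : side 0 = s.
Proof. by rewrite /side expn0 mulr1. Qed.

Lemma same_box_refl j : reflexive (same_box j).
Proof. by move=> om; apply/forallP => i. Qed.

Lemma same_box_sym j : symmetric (same_box j).
Proof. by move=> om om'; apply: eq_forallb => i; rewrite eq_sym. Qed.

Lemma same_box_trans j : transitive (same_box j).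
Proof.
move=> b a e /forallP ab /forallP be; apply/forallP => i.
by rewrite (eqP (ab i)).
Qed.

Lemma same_box_nest j om om' : same_box j om om' -> same_box j.+1 om om'.
Proof.
move=> /forallP H; apply/forallP => i.
by rewrite expnSr !divnMA (eqP (H i)).
Qed.

Lemma measurable_box j om : measurable (box j om).
Proof.
pose A i : set (measurableTypeR R) := `[c i + side j * (om i %/ 2 ^ j)%:R,
  c i + side j * (om i %/ 2 ^ j).+1%:R[%classic.
rewrite (_ : box j om = [set y | forall i, A i (tnth y i)]).
  by apply: measurable_rect => i; exact: measurable_itv.
by apply/seteqP; split => y /= H i; have := H i; rewrite /A/= in_itv.
Qed.

Lemma vol_box_atom j om : vol (box j om) = (side j ^+ n)%:E.
Proof.
pose A i : set (measurableTypeR R) := `[c i + side j * (om i %/ 2 ^ j)%:R,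
  c i + side j * (om i %/ 2 ^ j).+1%:R[%classic.
rewrite (_ : box j om = [set y | forall i, A i (tnth y i)]); last first.
  by apply/seteqP; split => y /= H i; have := H i; rewrite /A/= in_itv.
rewrite vol_rect; last by move=> i; exact: measurable_itv.
rewrite (eq_bigr (fun=> (side j)%:E)); last first.
  move=> i _; rewrite lebesgue_measure_itv/= lte_fin ltrD2l ltr_pM2l ?side_gt0//.
  rewrite ltr_nat ltnSn -EFinD; congr (_%:E); rewrite -[(_ %/ _).+1]addn1 natrD; ring.
by rewrite prodEFin prodr_const card_ord.
Qed.

Lemma box_sub_cube j om : box j om `<=` box_cube j om.
Proof.
move=> x bx i; have /andP[h1 h2] := bx i; rewrite tnth_mktuple h1/= ltW//.
apply: lt_le_trans h2 _.
by rewrite -addrA lerD2l -[(_ %/ _).+1]addn1 natrD mulrDr mulr1.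
Qed.

Lemma box_index j om om' x : box j om x -> box j om' x -> same_box j om om'.
Proof.
move=> b b'; apply/forallP => i; have /andP[h1 h2] := b i; have /andP[h3 h4] := b' i.
have l0 := side_gt0 j.
have := le_lt_trans h1 h4; have := le_lt_trans h3 h2.
by rewrite !ltrD2l !ltr_pM2l// !ltr_nat !ltnS => H1 H2; rewrite eqn_leq H1 H2.
Qed.

Lemma box_eq j om om' : same_box j om om' -> box j om = box j om'.
Proof.
move=> /forallP H; rewrite /box; apply/seteqP; split => x /= h i;
  by have := h i; rewrite (eqP (H i)).
Qed.

Lemma same_box0 om om' : same_box 0 om om' -> om = om'.
Proof.
move=> /forallP H; apply/ffunP => i; apply/val_inj => /=.
by have := H i; rewrite expn0 !divn1 => /eqP.
Qed.

Lemma box0_sub j om : box 0 om `<=` box j om.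
Proof.
move=> x h i; have /andP[h1 h2] := h i.
move: h1 h2; rewrite expn0 divn1 side0 => h1 h2; apply/andP; split.
  apply: le_trans h1; rewrite lerD2l /side -mulrA ler_pM2l// -natrM ler_nat.
  by rewrite mulnC leq_trunc_div.
apply: (lt_le_trans h2); rewrite lerD2l /side -mulrA ler_pM2l// -natrM ler_nat.
by rewrite mulnC; apply: ltn_ceil; rewrite expn_gt0.
Qed.

(** The 2^J atoms in each direction fill up the boxes of generation at most J. *)
Lemma box_atom j om x : (j <= J)%N -> box j om x ->
  exists2 om', same_box j om om' & box 0 om' x.
Proof.
move=> jJ bx.
have idx i : exists k : 'I_(2 ^ J), (k %/ 2 ^ j = om i %/ 2 ^ j)%N /\
    c i + s * k%:R <= tnth x i < c i + s * k.+1%:R.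
  have /andP[h1 h2] := bx i.
  set Q := (om i %/ 2 ^ j)%N in h1 h2 *.
  pose u := (tnth x i - c i) / s.
  have u1 : (Q * 2 ^ j)%:R <= u.
    rewrite ler_pdivlMr// natrM -mulrA [_ * s]mulrC mulrC; move: h1; rewrite /side; lra.
  have u2 : u < (Q.+1 * 2 ^ j)%:R.
    rewrite ltr_pdivrMr// natrM -mulrA [_ * s]mulrC mulrC; move: h2; rewrite /side; lra.
  have u0 : 0 <= u by apply: le_trans u1.
  have /andP[t1 t2] := truncn_itv u0.
  set k := Num.truncn u in t1 t2.
  have k1 : (Q * 2 ^ j <= k)%N by rewrite truncn_ge_nat.
  have k2 : (k < Q.+1 * 2 ^ j)%N by rewrite truncn_lt_nat.
  have kQ : (k %/ 2 ^ j = Q)%N.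
    have P0 : (0 < 2 ^ j)%N by rewrite expn_gt0.
    by apply/eqP; rewrite eqn_leq leq_divRL// k1 andbT -ltnS ltn_divLR.
  have kJ : (k < 2 ^ J)%N.
    apply: (leq_trans k2).
    rewrite -(subnK jJ) expnD leq_mul2r; apply/orP; right.
    by rewrite /Q ltn_divLR ?expn_gt0// -expnD subnK.
  exists (Ordinal kJ); split => //=.
  move: t1 t2; rewrite /u ler_pdivlMr// ltr_pdivrMr// => t1 t2.
  by apply/andP; split; rewrite mulrC; lra.
pose om' : T := [ffun i => sval (cid (idx i))].
exists om'.
  by apply/forallP => i; rewrite ffunE; case: cid => k /= [-> _].
move=> i; rewrite ffunE expn0 divn1 side0; by case: cid => k /= [_ ->].
Qed.

Lemma box_atoms_union j om : (j <= J)%N -> box j om = atoms_union (same_box j om).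
Proof.
move=> jJ; apply/seteqP; split => x.
  by move=> /(box_atom jJ)[om' h1 h2]; exists om'.
by case=> om' [/box_eq -> /box0_sub].
Qed.

Lemma indic_atoms_union P x :
  (\1_(atoms_union P) x : R) = \sum_(om | P om) \1_(box 0 om) x.
Proof.
rewrite indicE; have [/set_mem[om [Pom bx]]|xP] := boolP (x \in atoms_union P).
  rewrite (bigD1 om)//= indicE mem_set// big1 ?addr0// => om' /andP[_ ne].
  rewrite indicE memNset// => bx'; move: ne; rewrite -(same_box0 (box_index bx' bx)).
  by rewrite eqxx.
rewrite big1// => om Pom; rewrite indicE memNset// => bx.
by move: xP; rewrite notin_setE; apply; exists om.
Qed.

Lemma atoms_unionE P : atoms_union P = \bigcup_(om in [set om | P om]) box 0 om.
Proof. by apply/seteqP; split => x; [case=> om [? ?]; exists om|case=> om ? ?; exists om]. Qed.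

Lemma measurable_atoms_union P : measurable (atoms_union P).
Proof.
by rewrite atoms_unionE; apply: fin_bigcup_measurable => // om _; exact: measurable_box.
Qed.

Lemma integral_atoms_union (g : euclid R n -> R) P : measurable_fun setT g ->
  (forall x, 0 <= g x) ->
  (\int[vol]_(x in atoms_union P) (g x)%:E =
   \sum_(om | P om) \int[vol]_(x in box 0 om) (g x)%:E)%E.
Proof.
move=> mg g0.
have H A : measurable A -> (\int[vol]_(x in A) (g x)%:E =
    \int[vol]_x ((g x)%:E * (\1_A x)%:E))%E.
  by move=> mA; rewrite integral_mul_indic.
rewrite H; last exact: measurable_atoms_union.
rewrite (eq_integral (fun x => (\sum_(om <- enum P) ((g x)%:E * (\1_(box 0 om) x)%:E))%E)); last first.
  move=> x _; rewrite indic_atoms_union -sumEFin ge0_sume_distrr; last first.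
    by move=> om _; rewrite lee_fin.
  by rewrite big_enum.
rewrite ge0_integral_sum; last 3 first.
- exact: measurableT.
- move=> om; apply: emeasurable_funM; first exact/measurable_EFinP.
  by apply/measurable_EFinP; apply: measurable_indic; exact: measurable_box.
- by move=> om x _; rewrite -EFinM lee_fin mulr_ge0.
by rewrite big_enum/=; apply: eq_bigr => om _; rewrite H//; exact: measurable_box.
Qed.

Lemma vol_atoms_union P : vol (atoms_union P) = (\sum_(om | P om) s ^+ n)%:E.
Proof.
have E (A : set (euclid R n)) : measurable A -> (\int[vol]_(x in A) (cst (1 : R) x)%:E = vol A)%E.
  by move=> mA; rewrite -[RHS]mul1e -(integral_cst vol mA).
have := @integral_atoms_union (cst 1) P (measurable_cst _) (fun=> ler01).
rewrite (E _ (measurable_atoms_union P)) => ->; rewrite -sumEFin; apply: eq_bigr => om _.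
by rewrite (E _ (measurable_box 0 om)) vol_box_atom side0.
Qed.

Lemma card_class j om : (j <= J)%N ->
  class_sum same_box (fun=> 1 : R) j om * s ^+ n = side j ^+ n.
Proof.
move=> jJ; apply: EFin_inj; rewrite -(vol_box_atom j om) (box_atoms_union om jJ) vol_atoms_union.
by rewrite mulr_suml; under eq_bigr do rewrite mul1r.
Qed.

End grid.

(** * The two-weight inequality for one grid *)

Section grid_bound.
Context {R : realType} {n : nat}.
Variables (c : 'I_n -> R) (s : R) (J : nat).
Hypothesis s0 : 0 < s.

Local Notation T := {ffun 'I_n -> 'I_(2 ^ J)}.
Local Notation box := (box c s).
Local Notation same_box := (@same_box n J).
Local Notation sd := (side s).
Local Notation atoms_union := (@atoms_union R n c s J).
Implicit Types (om : T) (P : pred T) (u : euclid R n -> R).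

Definition step_function (a : T -> R) (x : euclid R n) : R :=
  \sum_om a om * \1_(box 0 om) x.

Lemma step_functionE a om x : box 0 om x -> step_function a x = a om.
Proof.
move=> bx; rewrite /step_function (bigD1 om)//= indicE mem_set// mulr1 big1 ?addr0// => om' ne.
rewrite indicE memNset ?mulr0// => bx'; move: ne.
by rewrite -(same_box0 (box_index s0 bx' bx)) eqxx.
Qed.

Lemma step_function_out a x : (forall om, ~ box 0 om x) -> step_function a x = 0.
Proof. by move=> bx; rewrite /step_function big1// => om _; rewrite indicE memNset ?mulr0. Qed.

Lemma measurable_step_function a : measurable_fun setT (step_function a).
Proof.
apply: measurable_sum => om; apply: measurable_funM; first exact: measurable_cst.
by apply: measurable_indic; exact: measurable_box.
Qed.

Lemma step_function_ge0 a x : (forall om, 0 <= a om) -> 0 <= step_function a x.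
Proof. by move=> a0; apply: sumr_ge0 => om _; rewrite mulr_ge0. Qed.

Lemma integral_step_function a u q : (forall om, 0 <= a om) -> 0 < q ->
  measurable_fun setT u -> (forall x, 0 <= u x) ->
  (\int[vol]_x (step_function a x `^ q * u x)%:E =
   \sum_om (a om `^ q)%:E * \int[vol]_(x in box 0 om) (u x)%:E)%E.
Proof.
move=> a0 q0 mu u0.
have mi om : measurable_fun setT (fun x => ((u x)%:E * (\1_(box 0 om) x)%:E)%E).
  apply: emeasurable_funM; first exact/measurable_EFinP.
  by apply/measurable_EFinP; apply: measurable_indic; exact: measurable_box.
rewrite (eq_integral (fun x => (\sum_(om <- enum T) ((a om `^ q)%:E * ((u x)%:E * (\1_(box 0 om) x)%:E))%E)%E)); last first.
  move=> x _; rewrite big_enum/=.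
  have [[om bx]|/forallNP nx] := pselect (exists om, box 0 om x).
    rewrite (step_functionE _ bx) (bigD1 om)//= indicE mem_set// mule1 big1 ?adde0// => om' ne.
    rewrite indicE memNset ?mule0// => bx'; move: ne.
    by rewrite -(same_box0 (box_index s0 bx' bx)) eqxx.
  rewrite step_function_out// powR0 ?gt_eqF// mul0r big1// => om _.
  by rewrite indicE memNset// !mule0.
rewrite ge0_integral_sum; last 3 first.
- exact: measurableT.
- by move=> om; apply: emeasurable_funM; [exact: measurable_cst|exact: mi].
- by move=> om x _; rewrite -!EFinM lee_fin !mulr_ge0 ?powR_ge0.
rewrite big_enum/=; apply: eq_bigr => om _; rewrite ge0_integralZl_EFin.
- by rewrite integral_mul_indic.
- exact: measurableT.
- by move=> x _; rewrite -EFinM lee_fin mulr_ge0.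
- exact: mi.
- exact: powR_ge0.
Qed.

Definition mass u om : R := fine (\int[vol]_(x in box 0 om) (u x)%:E).

Section one_weight.
Variables (u : euclid R n -> R).
Hypothesis mu : measurable_fun setT u.
Hypothesis u0 : forall x, 0 <= u x.
Hypothesis finu : forall om, (\int[vol]_(x in box 0 om) (u x)%:E < +oo)%E.

Lemma integral_ge0E A : (0 <= \int[vol]_(x in A) (u x)%:E)%E.
Proof. by apply: integral_ge0 => x _; rewrite lee_fin. Qed.

Lemma massE om : (\int[vol]_(x in box 0 om) (u x)%:E = (mass u om)%:E)%E.
Proof. by rewrite fineK// ge0_fin_numE// integral_ge0E. Qed.

Lemma mass_ge0 om : 0 <= mass u om.
Proof. by rewrite fine_ge0// integral_ge0E. Qed.

Lemma integral_atoms_union_mass P :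
  (\int[vol]_(x in atoms_union P) (u x)%:E = (\sum_(om | P om) mass u om)%:E)%E.
Proof.
rewrite integral_atoms_union// -sumEFin; apply: eq_bigr => om _; exact: massE.
Qed.

Lemma integral_box_mass j om : (j <= J)%N ->
  (\int[vol]_(x in box j om) (u x)%:E = (class_sum same_box (mass u) j om)%:E)%E.
Proof. by move=> jJ; rewrite box_atoms_union// integral_atoms_union_mass. Qed.

End one_weight.

Section good.
Variables (cw : R) (u : euclid R n -> R).
Hypothesis mu : measurable_fun setT u.
Hypothesis u0 : forall x, 0 <= u x.
Hypothesis gu : half_part_weight cw u.

Lemma le_integral_cube j om :
  (\int[vol]_(x in box j om) (u x)%:E <=
   \int[vol]_(x in box_cube c s j om) (u x)%:E)%E.
Proof.
by apply: le_integral_subset; [move=> x; rewrite lee_fin|exact: box_sub_cube].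
Qed.

Lemma half_part_weight_fin om : (\int[vol]_(x in box 0 om) (u x)%:E < +oo)%E.
Proof.
apply: le_lt_trans (le_integral_cube 0 om) _.
by have [] := gu [tuple c i + sd 0 * (om i %/ 2 ^ 0)%:R | i < n] (side_gt0 s0 0).
Qed.

Lemma half_part_mass_gt0 om : 0 < mass u om.
Proof.
rewrite -lte_fin -massE//; last exact: half_part_weight_fin.
have [_ H] := gu [tuple c i + sd 0 * (om i %/ 2 ^ 0)%:R | i < n] (side_gt0 s0 0).
have [] // := H (box 0 om) (measurable_box c s 0 om) (@box_sub_cube R n c s J _ om).
rewrite vol_box_atom// lee_fin; have := exprn_ge0 n (ltW (side_gt0 s0 0)).
by move: (_ ^+ n) => z; lra.
Qed.

(** A set of atoms that makes up half of a box, by number, is a subset of the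
    surrounding cube of at least half its volume. *)
Lemma half_part_mass : half_part_property J.+1 same_box cw (mass u).
Proof.
move=> j om B; rewrite ltnS => jJ HB.
have finu := half_part_weight_fin.
have bE : class_sum same_box (fun om' => mass u om' * (B om')%:R) j om =
    \sum_(om' | same_box j om om' && B om') mass u om'.
  rewrite /class_sum big_mkcondr; apply: eq_bigr => om' _.
  by case: (B om'); rewrite ?mulr1 ?mulr0.
have [_ H] := gu [tuple c i + sd j * (om i %/ 2 ^ j)%:R | i < n] (side_gt0 s0 j).
pose A := atoms_union (fun om' => same_box j om om' && B om').
have mA : measurable A by exact: measurable_atoms_union.
have AQ : A `<=` box_cube c s j om.
  apply: subset_trans (@box_sub_cube R n c s J _ om).
  rewrite box_atoms_union//; by move=> x [om' [/andP[h1 _] h2]]; exists om'.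
have vA : ((2^-1 * sd j ^+ n)%:E <= vol A)%E.
  rewrite vol_atoms_union// lee_fin -(card_class c s0 om jJ).
  have -> : \sum_(om' | same_box j om om' && B om') s ^+ n =
      class_sum same_box (fun y => (B y)%:R) j om * s ^+ n.
    rewrite /class_sum mulr_suml big_mkcondr; apply: eq_bigr => om' _.
    by case: (B om'); rewrite ?mul1r ?mul0r.
  rewrite mulrA ler_wpM2r ?exprn_ge0 ?(ltW s0)//.
  by move: HB; move: (class_sum _ _ _ _) (class_sum _ _ _ _) => a b; lra.
have [_ H2] := H A mA AQ vA.
move: (le_trans (le_integral_cube j om) H2).
by rewrite integral_box_mass// integral_atoms_union_mass// -EFinM lee_fin bE.
Qed.

End good.

End grid_bound.

Section grid_two_weight.
Context {R : realType} {n : nat}.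
Variables (c : 'I_n -> R) (s : R) (J : nat).
Variables (p q alpha cw K : R) (w sigma f : euclid R n -> R) (N : set (euclid R n)).
Hypothesis s0 : 0 < s.
Hypothesis p1 : 1 < p.
Hypothesis pq : p <= q.
Hypothesis alpha0 : 0 < alpha.
Hypothesis cw0 : 0 < cw.
Hypothesis K0 : 0 < K.
Hypothesis mw : measurable_fun setT w.
Hypothesis w0 : forall x, 0 <= w x.
Hypothesis gw : half_part_weight cw w.
Hypothesis msigma : measurable_fun setT sigma.
Hypothesis sigma0 : forall x, 0 <= sigma x.
Hypothesis gsigma : half_part_weight cw sigma.
Hypothesis mN : measurable N.
Hypothesis N0 : vol N = 0%E.
Hypothesis sigmaN : forall x, ~ N x -> 0 < sigma x.
Hypothesis Apq : forall x l, 0 < l ->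
  l `^ (alpha - n%:R) * fine (\int[vol]_(y in cube x l) (w y)%:E) `^ q^-1 *
  fine (\int[vol]_(y in cube x l) (sigma y)%:E) `^ (1 - p^-1) <= K.
Hypothesis mf : measurable_fun setT f.
Hypothesis f0 : forall x, 0 <= f x.
Hypothesis fB : (\int[vol]_x (f x `^ p * sigma x `^ (1 - p))%:E < +oo)%E.

Local Notation T := {ffun 'I_n -> 'I_(2 ^ J)}.
Local Notation box := (box c s).
Local Notation same_box := (@same_box n J).
Local Notation sd := (side s).
Implicit Types (om : T).

(** A dyadic fractional integral, cut off at the scale of the atoms and at
    that of the top boxes; the coefficient is |Q|^(alpha/n - 1) for a box Q. *)
Definition grid_operator : euclid R n -> R :=
  step_function c s (fun om : T => \sum_(j < J.+1)
    sd j `^ (alpha - n%:R) * fine (\int[vol]_(y in box j om) (f y)%:E)).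

Let p_gt0 : 0 < p. Proof. exact: lt_trans ltr01 p1. Qed.

Let g x := f x `^ p * sigma x `^ (1 - p).

Let mg : measurable_fun setT g.
Proof.
apply: measurable_funM.
  exact: (measurableT_comp (measurable_powR p) mf).
exact: (measurableT_comp (measurable_powR (1 - p)) msigma).
Qed.

Let g0 x : 0 <= g x. Proof. by rewrite mulr_ge0 ?powR_ge0. Qed.

(** young_tangent multiplied by sigma, for the function f / sigma. *)
Let tangent x m : 0 <= m -> 0 < sigma x ->
  p * m `^ (p - 1) * f x <= g x + (p - 1) * m `^ p * sigma x.
Proof.
move=> m0 sx.
have Y := young_tangent (divr_ge0 (f0 x) (ltW sx)) m0 p1.
have := ler_wpM2l (ltW sx) Y.
rewrite mulrDr (_ : sigma x * (p * _) = p * m `^ (p - 1) * (sigma x * (f x / sigma x))); last by ring.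
rewrite [sigma x * (f x / _)]mulrC divfK ?gt_eqF// => /le_trans; apply.
rewrite [X in _ <= _ + X]mulrC lerD2r.
rewrite powRM ?invr_ge0 ?(ltW sx)// mulrCA /g ler_wpM2l ?powR_ge0//.
rewrite -powR_inv1 ?(ltW sx)// -powRrM mulN1r powRD ?(gt_eqF sx) ?implybT//.
by rewrite powRr1 ?(ltW sx).
Qed.

Let tangent_int om m : 0 <= m ->
  ((p * m `^ (p - 1))%:E * \int[vol]_(x in box 0 om) (f x)%:E <=
  \int[vol]_(x in box 0 om) (g x)%:E + ((p - 1) * m `^ p * mass c s sigma om)%:E)%E.
Proof.
move=> m0; have mB := measurable_box c s 0 om.
have k0 : 0 <= p * m `^ (p - 1) by rewrite mulr_ge0 ?powR_ge0// ltW.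
have k1 : 0 <= (p - 1) * m `^ p by rewrite mulr_ge0 ?powR_ge0// subr_ge0 ltW.
have meas (u : euclid R n -> R) : measurable_fun setT u -> measurable_fun (box 0 om) (fun x => (u x)%:E).
  by move=> mu; apply/measurable_EFinP; exact: measurable_funTS.
have measZ (k : R) (u : euclid R n -> R) : measurable_fun setT u ->
    measurable_fun (box 0 om) (fun x => k%:E * (u x)%:E)%E.
  by move=> mu; apply: emeasurable_funM; [exact: measurable_cst|exact: meas].
have ge0 (u : euclid R n -> R) : (forall x, 0 <= u x) -> forall x, box 0 om x -> (0 <= (u x)%:E)%E.
  by move=> u0 x _; rewrite lee_fin.
have ge0Z (k : R) (u : euclid R n -> R) : 0 <= k -> (forall x, 0 <= u x) ->
    forall x, box 0 om x -> (0 <= k%:E * (u x)%:E)%E.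
  by move=> k_ge0 u0 x _; rewrite -EFinM lee_fin mulr_ge0.
rewrite [X in (_ <= _ + X)%E]EFinM -(massE sigma0 (half_part_weight_fin c s0 sigma0 gsigma) om).
rewrite -(ge0_integralZl_EFin vol mB (ge0 _ f0) (meas _ mf) k0).
rewrite -(ge0_integralZl_EFin vol mB (ge0 _ sigma0) (meas _ msigma) k1).
rewrite -(ge0_integralD vol mB (ge0 _ g0) (meas _ mg) (ge0Z _ _ k1 sigma0) (measZ _ _ msigma)).
apply: ae_ge0_le_integral.
- exact: mB.
- exact: ge0Z.
- exact: measZ.
- by move=> x Bx; rewrite adde_ge0 ?ge0 ?ge0Z.
- by apply: emeasurable_funD; [exact: meas|exact: measZ].
exists N; split => // x /=; apply: contra_notP => Nx _.
by rewrite -!EFinM -EFinD lee_fin tangent// sigmaN.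
Qed.

Let g_fin om : (\int[vol]_(x in box 0 om) (g x)%:E < +oo)%E.
Proof.
by apply: le_lt_trans fB; apply: le_integral_subset => // x; rewrite lee_fin.
Qed.

(** Local integrability of f follows from finiteness of its weighted norm,
    since sigma is locally integrable: this is tangent with m = 1. *)
Lemma atom_integral_fin om : (\int[vol]_(x in box 0 om) (f x)%:E < +oo)%E.
Proof.
have := tangent_int om (m := 1) ler01; rewrite !powR1 !mulr1 => H.
have : (p%:E * \int[vol]_(x in box 0 om) (f x)%:E < +oo)%E.
  apply: (le_lt_trans H); rewrite lte_add_pinfty ?ltry//; exact: g_fin.
have : (0 <= \int[vol]_(x in box 0 om) (f x)%:E)%E.
  by apply: integral_ge0 => x _; rewrite lee_fin.
by case: integral => [r _ _|_|//]; [exact: ltry|rewrite gt0_muley ?lte_fin].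
Qed.

Let fm := mass c s f (J := J).
Let wm := mass c s w (J := J).
Let sm := mass c s sigma (J := J).

Let sm_gt0 om : 0 < sm om. Proof. exact: (half_part_mass_gt0 c s0 sigma0 gsigma). Qed.
Let wm_gt0 om : 0 < wm om. Proof. exact: (half_part_mass_gt0 c s0 w0 gw). Qed.
Let fm_ge0 om : 0 <= fm om. Proof. exact: mass_ge0. Qed.

(** Replacing f and sigma by their masses on the atoms does not increase the
    weighted norm: this is tangent with m the mean of f with respect to sigma. *)
Lemma mass_jensen om : fm om `^ p * sm om `^ (1 - p) <= mass c s g om.
Proof.
have sp := sm_gt0 om; have s_0 := ltW sp.
pose m := fm om / sm om; have m0 : 0 <= m by rewrite divr_ge0.
have := tangent_int om m0.
rewrite (massE f0 atom_integral_fin) (massE g0 g_fin) -EFinM -EFinD lee_fin -/(fm om) -/(sm om).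
have fE : fm om = m * sm om by rewrite divfK ?gt_eqF.
have -> : fm om `^ p * sm om `^ (1 - p) = m `^ p * sm om.
  rewrite fE powRM// -mulrA -powRD ?(gt_eqF sp) ?implybT// addrC subrK.
  by rewrite powRr1.
rewrite {1}fE (_ : p * m `^ (p - 1) * _ = p * (m * m `^ (p - 1)) * sm om); last by ring.
rewrite mulr_powRB1//.
by rewrite (_ : p * _ * _ = m `^ p * sm om + (p - 1) * m `^ p * sm om) ?lerD2r//; ring.
Qed.

(** The coefficient in front of the mean of the masses of f over the atoms of
    a box: the number of these atoms times side^(alpha - n). *)
Let lam j : R := sd j `^ (alpha - n%:R) * (sd j ^+ n / s ^+ n).
Let L : R := 2 `^ alpha / (2 `^ alpha - 1).

Let r1 : 1 < 2 `^ alpha :> R.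
Proof. by rewrite /powR gt_eqF// expR_gt1 mulr_gt0// ln_gt0// ltr1n. Qed.

Let L0 : 0 < L.
Proof. by rewrite divr_gt0 ?powR_gt0// subr_gt0. Qed.

Let sn0 : 0 < s ^+ n. Proof. exact: exprn_gt0. Qed.

Let side_ge0 j : 0 <= sd j. Proof. exact/ltW/side_gt0. Qed.

Let lamE j : lam j = sd j `^ alpha / s ^+ n.
Proof.
rewrite /lam mulrA -powR_mulrn// -powRD ?subrK//.
by rewrite (gt_eqF (side_gt0 s0 j)) implybT.
Qed.

Let lamS j : lam j.+1 = 2 `^ alpha * lam j.
Proof.
rewrite !lamE mulrA -powRM//; congr (_ `^ _ / _).
by rewrite /side expnS natrM mulrCA.
Qed.

Let lam0 j : 0 <= lam j.
Proof. by rewrite lamE divr_ge0 ?powR_ge0// ltW. Qed.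

(** The coefficients grow geometrically with ratio 2^alpha > 1. *)
Let lamL j : (j < J.+1)%N -> \sum_(i < j.+1) lam i <= L * lam j.
Proof.
move=> _; elim: j => [|j IH].
  rewrite big_ord1 ler_peMl// /L ler_pdivlMr ?subr_gt0// mul1r.
  by rewrite lerBlDr lerDl.
rewrite big_ord_recr/=; apply: (@le_trans _ _ (L * lam j + lam j.+1)).
  by rewrite lerD2r.
rewrite lamS /L; move: r1 (lam j); move: (2 `^ alpha) => r r1' z.
rewrite le_eqVlt; apply/orP; left; apply/eqP; field.
by rewrite subr_eq0 gt_eqF.
Qed.

(** On a grid with finitely many atoms everything is a finite sum, and
    discrete_two_weight applies to the masses of w, sigma and f. *)
Lemma grid_two_weight :
  (\int[vol]_x (grid_operator x `^ q * w x)%:E <=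
   (discrete_const cw p q K L *
    fine (\int[vol]_x (f x `^ p * sigma x `^ (1 - p))%:E) `^ (q / p))%:E)%E.
Proof.
have q0 : 0 < q by exact: lt_le_trans pq.
have fwb := half_part_weight_fin c (J := J) s0 w0 gw.
have fsb := half_part_weight_fin c (J := J) s0 sigma0 gsigma.
have opE j om : (j <= J)%N -> sd j `^ (alpha - n%:R) * fine (\int[vol]_(y in box j om) (f y)%:E) =
    lam j * class_mean same_box (fun=> 1) j fm om.
  move=> jJ; rewrite (integral_box_mass s0 mf f0 atom_integral_fin)//= /class_mean /lam.
  have c1 := card_class c s0 om jJ.
  have c10 : 0 < class_sum same_box (fun=> 1 : R) j om.
    by apply: class_sum_gt0 => //; exact: same_box_refl.
  have -> : class_sum same_box (fun y => 1 * fm y) j om = class_sum same_box fm j om.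
    by apply: eq_bigr => y _; rewrite mul1r.
  by rewrite -c1; field; rewrite !gt_eqF.
have a0 om : 0 <= \sum_(j < J.+1) sd j `^ (alpha - n%:R) *
    fine (\int[vol]_(y in box j om) (f y)%:E).
  apply: sumr_ge0 => j _; rewrite mulr_ge0 ?powR_ge0// fine_ge0//.
  by apply: integral_ge0 => y _; rewrite lee_fin.
rewrite integral_step_function//.
rewrite (eq_bigr (fun om => (wm om * (\sum_(j < J.+1) lam j * class_mean same_box (fun=> 1) j fm om) `^ q)%:E)); last first.
  move=> om _; rewrite massE// -EFinM mulrC; congr (_ * _ `^ _)%:E.
  by apply: eq_bigr => j _; rewrite opE// -ltnS.
rewrite sumEFin lee_fin.
have ApqD j om : (j < J.+1)%N -> lam j / class_sum same_box (fun=> 1) j om *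
    class_sum same_box wm j om `^ q^-1 * class_sum same_box sm j om `^ (1 - p^-1) <= K.
  rewrite ltnS => jJ; have c1 := card_class c s0 om jJ.
  have c10 : 0 < class_sum same_box (fun=> 1 : R) j om.
    by apply: class_sum_gt0 => //; exact: same_box_refl.
  have -> : lam j / class_sum same_box (fun=> 1) j om = sd j `^ (alpha - n%:R).
    by rewrite /lam -c1; field; rewrite !gt_eqF.
  have bnd (u : euclid R n -> R) : measurable_fun setT u -> (forall x, 0 <= u x) ->
      half_part_weight cw u -> 0 <= class_sum same_box (mass c s u (J := J)) j om <=
      fine (\int[vol]_(y in box_cube c s j om) (u y)%:E).
    move=> mu u0 gu; have fu := half_part_weight_fin c (J := J) s0 u0 gu.
    rewrite sumr_ge0; last by move=> om' _; exact: mass_ge0.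
    have [fc _] := gu [tuple c i + sd j * (om i %/ 2 ^ j)%:R | i < n] _ (side_gt0 s0 j).
    rewrite -lee_fin fineK; last by rewrite ge0_fin_numE// integral_ge0E.
    by rewrite -(integral_box_mass s0 mu u0 fu)// le_integral_cube.
  have /andP[b1 b2] := bnd w mw w0 gw; have /andP[b3 b4] := bnd sigma msigma sigma0 gsigma.
  apply: le_trans (Apq [tuple c i + sd j * (om i %/ 2 ^ j)%:R | i < n] (side_gt0 s0 j)).
  rewrite -!mulrA ler_wpM2l ?powR_ge0//; apply: ler_pM; rewrite ?powR_ge0//.
    by apply: ler_powR_base => //; rewrite invr_ge0 ltW.
  apply: ler_powR_base => //; rewrite subr_ge0 invf_le1//; exact: ltW.
apply: (le_trans (discrete_two_weight (@same_box_refl n J) (@same_box_sym n J)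
  (@same_box_trans n J) (@same_box_nest n J) p1 pq cw0 K0 L0 lam0 wm_gt0 sm_gt0 fm_ge0
  lamL (half_part_mass c s0 mw w0 gw) (half_part_mass c s0 msigma sigma0 gsigma) ApqD)).
rewrite ler_wpM2l//; first exact/ltW/discrete_const_gt0.
apply: ler_powR_base; first by rewrite divr_ge0// ltW.
  by apply: sumr_ge0 => om _; rewrite mulr_ge0 ?powR_ge0.
apply: (@le_trans _ _ (\sum_om mass c s g om)).
  by apply: ler_sum => om _; exact: mass_jensen.
rewrite -lee_fin -(integral_atoms_union_mass s0 mg g0 g_fin xpredT) fineK; last first.
  rewrite ge0_fin_numE//; exact: (integral_ge0E g0).
by apply: le_integral_subset => // x; rewrite lee_fin.
Qed.

End grid_two_weight.

(** * Lower limits *)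

Section liminf.
Context {R : realType}.
Implicit Types (u v : (\bar R)^nat).
Local Open Scope ereal_scope.

(** The lower limit as a supremum of infima, from which one-sided bounds are
    immediate. *)
Lemma limn_einfE u : limn_einf u = ereal_sup (range (einfs u)).
Proof. by rewrite limn_einf_lim; apply/cvg_lim => //; exact: cvg_einfs_sup. Qed.

Lemma limn_einf_ge u c K0 : (forall K, (K0 <= K)%N -> c <= u K) -> c <= limn_einf u.
Proof.
move=> H; rewrite limn_einfE; apply: (@le_trans _ _ (einfs u K0)).
  by apply/ereal_infP => _ [K /= K0K <-]; exact: H.
by apply: ereal_sup_ubound; exists K0.
Qed.

Lemma lt_limn_einf u c : c < limn_einf u ->
  exists K0, forall K, (K0 <= K)%N -> c < u K.
Proof.
rewrite limn_einfE => /ereal_sup_gt[_ [K0 _ <-] H]; exists K0 => K K0K.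
apply: (lt_le_trans H); apply: ereal_inf_lbound; exists K => //=.
Qed.

Lemma limn_einf_le u c :
  (forall K, u K <= c) -> limn_einf u <= c.
Proof.
move=> H; rewrite limn_einfE; apply/ereal_supP => _ [K _ <-].
by apply: le_trans (H K); apply: ereal_inf_lbound; exists K => /=.
Qed.

Lemma measurable_limn_einf d (T : measurableType d) 
    (f : (T -> \bar R)^nat) : (forall K, measurable_fun setT (f K)) ->
  measurable_fun setT (fun x => limn_einf (f^~ x)).
Proof.
move=> mf; rewrite /limn_einf; apply: measurableT_comp => //.
apply: measurable_fun_limn_esup => K.
by apply: measurableT_comp => //; exact: mf.
Qed.

End liminf.

(** * Shifted grids and the kernel *)

Section third_trick.
Context {R : realType}.

(** The left ends, L / 3 apart, of two intervals of length L that both contain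
    ]-L/3, L/3[. *)
Definition corner (L : R) (t : bool) : R := - (L / 3) * (1 + t%:R).

(** The two grids of step l are shifted against each other by L / 3, which is
    one or two thirds of l modulo l, because L / l is a power of 2. So their
    end points are at distance at least l / 3, and two points closer than l /
    3 are separated by at most one of the grids. *)
Lemma third_trick (L l a b : R) (k : nat) : 0 < l -> L = l * (2 ^ k)%:R ->
  - (L / 3) < a -> a < L / 3 -> - (L / 3) < b -> b < L / 3 ->
  `|a - b| < l / 3 ->
  exists t m, corner L t + l * m%:R <= a < corner L t + l * m.+1%:R /\
    corner L t + l * m%:R <= b < corner L t + l * m.+1%:R.
Proof.
move=> l0 LE.
wlog ab : a b / a <= b.
  move=> W aL1 aL2 bL1 bL2 H; have [ab|/ltW ba] := leP a b; first exact: W.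
  by have [|t [m [h1 h2]]] := W b a ba bL1 bL2 aL1 aL2; [rewrite distrC|exists t, m].
move=> aL1 aL2 bL1 bL2; rewrite distrC ger0_norm ?subr_ge0// => ab3.
have pos t : 0 <= a - corner L t.
  by rewrite /corner; case: t; rewrite ?mulr1n ?mulr0n; lra.
pose m t := Num.truncn ((a - corner L t) / l).
have Hm t : corner L t + l * (m t)%:R <= a < corner L t + l * (m t).+1%:R.
  have /truncn_itv/andP[h1 h2] : 0 <= (a - corner L t) / l by rewrite divr_ge0// ltW.
  move: h1 h2; rewrite -/(m t) ler_pdivlMr// ltr_pdivrMr// => h1 h2.
  by apply/andP; split; rewrite mulrC; lra.
have [bF|bF] := ltP b (corner L false + l * (m false).+1%:R).
  exists false, (m false); split => //; rewrite bF andbT.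
  by have /andP[h _] := Hm false; exact: le_trans ab.
have [bT|bT] := ltP b (corner L true + l * (m true).+1%:R).
  exists true, (m true); split => //; rewrite bT andbT.
  by have /andP[h _] := Hm true; exact: le_trans ab.
exfalso.
have /andP[_ aF] := Hm false; have /andP[_ aT] := Hm true.
move: (m false).+1 (m true).+1 bF bT aF aT => u v.
rewrite /corner mulr0n mulr1n addr0 mulr1 => bF bT aF aT.
have H1 : l * (3 * u + 2 ^ k)%:R < l * (3 * v + 1)%:R.
  rewrite (natrD _ (3 * u) (2 ^ k)) (natrD _ (3 * v) 1) (natrM _ 3 u) (natrM _ 3 v).
  rewrite !mulrDr -LE mulr1 [l * (_ * u%:R)]mulrCA [l * (_ * v%:R)]mulrCA.
  lra.
have H2 : l * (3 * v)%:R < l * (3 * u + 2 ^ k + 1)%:R.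
  rewrite (natrD _ (3 * u + 2 ^ k) 1) (natrD _ (3 * u) (2 ^ k)).
  rewrite (natrM _ 3 u) (natrM _ 3 v).
  rewrite !mulrDr -LE mulr1 [l * (_ * u%:R)]mulrCA [l * (_ * v%:R)]mulrCA.
  lra.
move: H1 H2; rewrite !ltr_pM2l// !ltr_nat => H1 H2.
have E : (3 * u + 2 ^ k = 3 * v)%N.
  by rewrite !addn1 !ltnS in H1 H2; apply/eqP; rewrite eqn_leq H1.
have : (3 %| 2 ^ k)%N.
  by rewrite -(dvdn_addr (m := 3 * u)) ?dvdn_mulr// E dvdn_mulr.
by rewrite Euclid_dvdX.
Qed.

End third_trick.

Section kernel.
Context {R : realType} {n : nat}.
Variables (s : R) (J : nat).
Hypothesis s0 : 0 < s.
Local Notation T := {ffun 'I_n -> 'I_(2 ^ J)}.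
Local Notation sd := (side s).
Let L := sd J.
Implicit Types (t : {ffun 'I_n -> bool}) (x y : euclid R n) (om : T).

(** A choice of one of the two grids in every coordinate. *)
Definition grid_corner t : 'I_n -> R := fun i => corner L (t i).

Definition central x := forall i, `|tnth x i| < L / 3.

Let L0 : 0 < L. Proof. exact: side_gt0. Qed.

Let sideS j : sd j.+1 = 2 * sd j.
Proof. by rewrite /side expnS natrM mulrCA. Qed.

Let top_itv (a : R) (b : bool) : `|a| < L / 3 ->
  corner L b + L * 0%:R <= a < corner L b + L * 1%:R.
Proof.
rewrite ltr_norml => /andP[h1 h2]; move: L0 => Lp; rewrite mulr0 addr0 mulr1 /corner.
by apply/andP; case: b; rewrite ?mulr1n ?mulr0n; split; lra.
Qed.

Lemma central_atom t x : central x ->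
  exists om, box (grid_corner t) s 0 om x.
Proof.
move=> cx; have P0 : (0 < 2 ^ J)%N by rewrite expn_gt0.
pose om0 : T := [ffun=> Ordinal P0].
have bx : box (grid_corner t) s J om0 x.
  by move=> i; rewrite ffunE /= div0n; exact: top_itv.
by have [om _ ?] := box_atom s0 (leqnn J) bx; exists om.
Qed.

(** Smallest generation with r < side / 3; it is the finest one at which
    third_trick applies. *)
Lemma find_level (r : R) : s / 6 <= r ->
  exists j, [/\ (j <= J)%N, sd j / 6 <= r & r < sd j / 3 \/ j = J].
Proof.
move=> sr; have ex : exists j, (r < sd j / 3) || (j == J) by exists J; rewrite eqxx orbT.
case: (ex_minnP ex) => j Pj minj; exists j; split.
- by apply: minj; rewrite eqxx orbT.
- case: j Pj minj => [|j] Pj minj; first by rewrite side0.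
  have [H|H] := leP (sd j / 3) r; first by rewrite sideS; lra.
  by have := minj j; rewrite H ltnn => /(_ isT).
- by case/orP: Pj => [?|/eqP ?]; [left|right].
Qed.

(** third_trick in every coordinate, at the generation given by find_level. At
    the top generation the grids have a single box, which contains all central
    points. *)
Lemma kernel_cover x y : central x -> central y -> s / 6 <= eudist x y ->
  exists t om j, [/\ (j <= J)%N, box (grid_corner t) s 0 om x,
    box (grid_corner t) s j om y & sd j / 6 <= eudist x y].
Proof.
move=> cx cy sr; have [j [jJ jr H]] := find_level sr.
have idx i : exists bm : bool * nat,
    corner L bm.1 + sd j * bm.2%:R <= tnth x i < corner L bm.1 + sd j * bm.2.+1%:R /\
    corner L bm.1 + sd j * bm.2%:R <= tnth y i < corner L bm.1 + sd j * bm.2.+1%:R.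
  case: H => [Hj|->]; last by exists (false, 0%N); split; exact: top_itv.
  have LE : L = sd j * (2 ^ (J - j))%:R.
    by rewrite /L /side -mulrA -natrM -expnD subnKC.
  have := cx i; have := cy i; rewrite !ltr_norml => /andP[h1 h2] /andP[h3 h4].
  have [//|b [m [e1 e2]]] := third_trick (side_gt0 s0 j) LE h3 h4 h1 h2.
    exact: le_lt_trans (coord_le_eudist x y i) Hj.
  by exists (b, m).
pose t : {ffun 'I_n -> bool} := [ffun i => (sval (cid (idx i))).1].
have [om bx] := central_atom t cx.
exists t, om, j; split => // i.
have := box0_sub s0 j bx i.
rewrite /grid_corner ffunE; case: cid => -[b m] /= [/andP[x1 x2] /andP[y1 y2]].
move=> /andP[z1 z2]; have l0 := side_gt0 s0 j.
have -> : (om i %/ 2 ^ j)%N = m; last by rewrite y1 y2.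
have := le_lt_trans z1 x2; have := le_lt_trans x1 z2.
by rewrite !ltrD2l !ltr_pM2l// !ltr_nat !ltnS => A B; apply/eqP; rewrite eqn_leq A B.
Qed.

Variables (alpha : R) (f : euclid R n -> R).
Hypothesis alphan : alpha < n%:R.
Hypothesis mf : measurable_fun setT f.
Hypothesis f0 : forall x, 0 <= f x.
Hypothesis finf : forall t om, (\int[vol]_(x in box (grid_corner t) s 0 om) (f x)%:E < +oo)%E.

(** The constant accounts for the ratio of the distance of two points to the
    side of their common box. *)
Definition grids_operator x : R :=
  6 `^ (n%:R - alpha) * \sum_t grid_operator (grid_corner t) s J alpha f x.

Lemma kernel_le_cover x y : central x -> central y -> s / 6 <= eudist x y ->
  exists t om j, [/\ (j <= J)%N, box (grid_corner t) s 0 om x,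
    box (grid_corner t) s j om y &
    (eudist x y `^ (n%:R - alpha))^-1 <= 6 `^ (n%:R - alpha) * sd j `^ (alpha - n%:R)].
Proof.
move=> cx cy sr; have [t [om [j [jJ bx by_ jr]]]] := kernel_cover cx cy sr.
exists t, om, j; split => //.
have na : 0 < n%:R - alpha by rewrite subr_gt0.
have l0 := side_gt0 s0 j.
have l60 : 0 < sd j / 6 by rewrite divr_gt0.
rewrite -(opprB n%:R alpha) powRN -lef_pV2 ?posrE; last 2 first.
- by rewrite mulr_gt0 ?invr_gt0 ?powR_gt0.
- by rewrite invr_gt0 powR_gt0//; exact: lt_le_trans jr.
rewrite invrK invfM invrK mulrC -powRN.
have -> : 6 `^ (- (n%:R - alpha)) = (6^-1 : R) `^ (n%:R - alpha).
  by rewrite -powR_inv1// -powRrM mulN1r.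
rewrite -powRM ?invr_ge0 ?(ltW l0)//.
by apply: ler_powR_base; [exact: ltW|exact: ltW|exact: jr].
Qed.

(** At each y the kernel is one of the terms of a finite sum of multiples of
    indicators of boxes that contain x; the integral of f against this sum is
    the operator on the grids. *)
Lemma truncated_riesz_le x : central x ->
  (\int[vol]_(y in [set y | central y /\ (s / 6 <= eudist x y)%R])
     (f y / eudist x y `^ (n%:R - alpha))%:E <= (grids_operator x)%:E)%E.
Proof.
move=> cx.
pose om t := sval (cid (central_atom t cx)).
have bom t : box (grid_corner t) s 0 (om t) x by exact: (svalP (cid (central_atom t cx))).
pose k t (j : 'I_J.+1) : R := 6 `^ (n%:R - alpha) * sd j `^ (alpha - n%:R).
have k0 t j : 0 <= k t j by rewrite mulr_ge0 ?powR_ge0.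
pose g t (j : 'I_J.+1) y : \bar R :=
  ((k t j)%:E * ((f y)%:E * (\1_(box (grid_corner t) s j (om t)) y)%:E))%E.
have g0 t j y : (0 <= g t j y)%E.
  by rewrite /g -!EFinM lee_fin mulr_ge0// mulr_ge0.
have mfi t (j : 'I_J.+1) : measurable_fun setT
    (fun y => ((f y)%:E * (\1_(box (grid_corner t) s j (om t)) y)%:E)%E).
  apply: emeasurable_funM; first exact/measurable_EFinP.
  by apply/measurable_EFinP; apply: measurable_indic; exact: measurable_box.
have mg t j : measurable_fun setT (g t j).
  by apply: emeasurable_funM; [exact: measurable_cst|exact: mfi].
apply: (@le_trans _ _ (\int[vol]_y (\sum_(t <- enum {ffun 'I_n -> bool})
    \sum_(j <- enum 'I_J.+1) g t j y))%E).
  rewrite integral_mkcond; apply: le_integral_pointwise => y _.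
  rewrite patchE; case: ifPn => [|_]; last first.
    by apply: sume_ge0 => t _; apply: sume_ge0.
  rewrite inE /= => -[cy sr].
  have [t [om' [j [jJ bx bxy ker]]]] := kernel_le_cover cx cy sr.
  have omE : om' = om t by apply: same_box0; exact: (box_index s0 bx (bom t)).
  rewrite big_enum/= (bigD1 t)//= big_enum/=.
  rewrite (bigD1 (Ordinal (jJ : (j < J.+1)%N)))//= /g -addeA.
  rewrite indicE mem_set /=; last by rewrite -omE.
  rewrite mule1; apply: (@le_trans _ _ ((k t (Ordinal (jJ : (j < J.+1)%N)))%:E * (f y)%:E)%E).
    by rewrite -EFinM lee_fin [leLHS]mulrC; apply: ler_wpM2r => //; exact: ker.
  rewrite leeDl// adde_ge0//; apply: sume_ge0 => i _; first exact: g0.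
  by apply: sume_ge0 => j' _; exact: g0.
rewrite ge0_integral_sum; last 3 first.
- exact: measurableT.
- by move=> t; apply: emeasurable_sum => j; exact: mg.
- by move=> t y _; apply: sume_ge0.
rewrite big_enum/= /grids_operator mulr_sumr -sumEFin; apply: lee_sum => t _.
rewrite ge0_integral_sum; last 3 first.
- exact: measurableT.
- by move=> j; exact: mg.
- by move=> j y _.
rewrite big_enum/= /grid_operator (step_functionE s0 _ (bom t)) mulr_sumr -sumEFin.
apply: lee_sum => j _.
rewrite /g ge0_integralZl_EFin; last 4 first.
- exact: measurableT.
- by move=> y _; rewrite -EFinM lee_fin mulr_ge0.
- exact: mfi.
- exact: k0.
rewrite integral_mul_indic//.
have jJ : (j <= J)%N by rewrite -ltnS.
by rewrite (integral_box_mass s0 mf f0 (finf t) _ jJ)/= -EFinM mulrA.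
Qed.

End kernel.

(** * Letting the mesh tend to zero *)

Section riesz_limit.
Context {R : realType} {n : nat}.
Implicit Types (x y : euclid R n) (K : nat).

(** Atoms of side 2^-K with 2 K generations make boxes of side 2^K, so
    refining the grid also exhausts the space. *)
Definition mesh K : R := (2 ^ K)%:R^-1.

Lemma mesh_gt0 K : 0 < mesh K.
Proof. by rewrite invr_gt0 ltr0n expn_gt0. Qed.

Lemma side_mesh K : side (mesh K) K.*2 = (2 ^ K)%:R.
Proof.
by rewrite /side /mesh -addnn expnD natrM mulKf// pnatr_eq0 -lt0n expn_gt0.
Qed.

Lemma measurable_eudist x : measurable_fun setT (eudist x).
Proof.
rewrite (_ : eudist x = (fun y => (\sum_(i < n) (tnth x i - tnth y i) ^+ 2) `^ 2^-1)).
  apply: (measurableT_comp (measurable_powR _)).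
  apply: measurable_sum => i; apply: measurable_funX.
  by apply: measurable_funB; [exact: measurable_cst|exact: measurable_coord].
apply/funext => y; rewrite powR12_sqrt// sumr_ge0// => i _; exact: sqr_ge0.
Qed.

Lemma measurable_central s J : measurable (central s J : set (euclid R n)).
Proof.
pose A (i : 'I_n) : set (measurableTypeR R) := `]- (side s J / 3), (side s J / 3)[%classic.
rewrite (_ : central s J = [set y : euclid R n | forall i, A i (tnth y i)]).
  by apply: measurable_rect => i; exact: measurable_itv.
by apply/seteqP; split => y /= H i; have := H i; rewrite /A/= in_itv/= ltr_norml.
Qed.

Definition truncation K x : set (euclid R n) :=
  [set y | central (mesh K) K.*2 y /\ mesh K / 6 <= eudist x y].

Lemma measurable_truncation K x : measurable (truncation K x).
Proof.
apply: measurableI; first exact: measurable_central.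
rewrite [X in measurable X](_ : _ = eudist x @^-1` `[mesh K / 6, +oo[%classic); last first.
  by apply/seteqP; split => y /=; rewrite in_itv/= andbT.
by rewrite -[X in measurable X]setTI; apply: measurable_eudist => //; exact: measurable_itv.
Qed.

(** The region covered by the grids exhausts the space. *)
Lemma near_central x : exists K0, forall K, (K0 <= K)%N -> central (mesh K) K.*2 x.
Proof.
pose S := 3 * \sum_(i < n) `|tnth x i|.
exists (Num.truncn S).+1 => K HK i.
rewrite side_mesh ltr_pdivlMr// mulrC.
apply: (@le_lt_trans _ _ S).
  by rewrite /S ler_pM2l// (bigD1 i)//= lerDl sumr_ge0.
apply: (lt_le_trans (truncnS_gt S)); rewrite ler_nat.
apply: (leq_trans HK); exact/ltnW/ltn_expl.
Qed.

Lemma near_truncation x y : 0 < eudist x y ->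
  exists K0, forall K, (K0 <= K)%N -> truncation K x y.
Proof.
move=> r0; have [K0 HK0] := near_central y.
exists (maxn K0 (Num.truncn (eudist x y)^-1).+1) => K; rewrite geq_max => /andP[k0 k1].
split; first exact: HK0.
have H : (eudist x y)^-1 <= (2 ^ K)%:R.
  apply: (le_trans (ltW (truncnS_gt _))); rewrite ler_nat.
  by apply: (leq_trans k1); exact/ltnW/ltn_expl.
have P0 : 0 < (2 ^ K)%:R :> R by rewrite ltr0n expn_gt0.
apply: (@le_trans _ _ (mesh K)).
  by rewrite ler_pdivrMr// ler_peMr ?ler1n// ltW// mesh_gt0.
by rewrite /mesh -[leRHS]invrK lef_pV2 ?posrE ?invr_gt0.
Qed.

Variables (alpha : R) (f : euclid R n -> R).
Hypothesis alphan : alpha < n%:R.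
Hypothesis mf : measurable_fun setT f.
Hypothesis f0 : forall x, 0 <= f x.
Hypothesis finf : forall K t (om : {ffun 'I_n -> 'I_(2 ^ K.*2)}),
  (\int[vol]_(x in box (grid_corner (mesh K) K.*2 t) (mesh K) 0 om) (f x)%:E < +oo)%E.

Let h x y : R := f y / eudist x y `^ (n%:R - alpha).

Lemma measurable_riesz_kernel x : measurable_fun setT (h x).
Proof.
apply: measurable_funM; first exact: mf.
rewrite (_ : (fun y => _) = (fun y => eudist x y `^ (- (n%:R - alpha)))).
  exact: measurableT_comp (measurable_powR _) (measurable_eudist x).
by apply/funext => y; rewrite powRN.
Qed.

Let h0 x y : 0 <= h x y. Proof. by rewrite divr_ge0 ?powR_ge0. Qed.

(** Fatou's lemma in y. The statement with a number rho below the integral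
    avoids upper limits of the operator values. *)
Lemma riesz_lt_grids x rho : (rho%:E < \int[vol]_y (h x y)%:E)%E ->
  exists K0, forall K, (K0 <= K)%N ->
    rho < grids_operator (mesh K) K.*2 alpha f x.
Proof.
move=> Hrho.
pose k K y := (((fun y => (h x y)%:E) \_ (truncation K x)) y : \bar R).
have k0 K y : (0 <= k K y)%E.
  by rewrite /k patchE; case: ifP => // _; rewrite lee_fin.
have mk K : measurable_fun setT (k K).
  apply/(measurable_restrictT _ (measurable_truncation K x)).
  by apply: measurable_funTS; apply/measurable_EFinP; exact: measurable_riesz_kernel.
have pt y : ((h x y)%:E <= limn_einf (k^~ y))%E.
  have r0 : 0 <= eudist x y := sqrtr_ge0 _.
  move: r0; rewrite le_eqVlt => /orP[/eqP r0|r0].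
    rewrite /h -r0 powR0; last by rewrite subr_eq0 gt_eqF.
    by rewrite invr0 mulr0; apply: (@limn_einf_ge _ _ _ 0%N) => K _; exact: k0.
  have [K0 HK0] := near_truncation r0.
  apply: (@limn_einf_ge _ _ _ K0) => K /HK0 HK.
  by rewrite /k patchE mem_set.
have H1 := le_trans (le_integral_pointwise vol (fun y (_ : setT y) => pt y))
  (fatou vol measurableT mk (fun K y _ => k0 K y)).
have [K1 HK1] := lt_limn_einf (lt_le_trans Hrho H1).
have [K2 HK2] := near_central x.
exists (maxn K1 K2) => K; rewrite geq_max => /andP[k1 k2].
rewrite -lte_fin; apply: (lt_le_trans (HK1 K k1)).
rewrite /k -integral_mkcond.
exact: (truncated_riesz_le (mesh_gt0 K) alphan mf f0 (finf (K := K)) (HK2 K k2)).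
Qed.

End riesz_limit.

(** * The two-weight inequality for the fractional integral *)

Section riesz_two_weight.
Context {R : realType} {n : nat}.
Variables (p q alpha cw K : R) (w sigma : euclid R n -> R) (N : set (euclid R n)).
Hypothesis p1 : 1 < p.
Hypothesis pq : p <= q.
Hypothesis alpha0 : 0 < alpha.
Hypothesis alphan : alpha < n%:R.
Hypothesis cw0 : 0 < cw.
Hypothesis K0 : 0 < K.
Hypothesis mw : measurable_fun setT w.
Hypothesis w0 : forall x, 0 <= w x.
Hypothesis gw : half_part_weight cw w.
Hypothesis msigma : measurable_fun setT sigma.
Hypothesis sigma0 : forall x, 0 <= sigma x.
Hypothesis gsigma : half_part_weight cw sigma.
Hypothesis mN : measurable N.
Hypothesis N0 : vol N = 0%E.
Hypothesis wN : forall x, ~ N x -> 0 < w x.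
Hypothesis sigmaN : forall x, ~ N x -> 0 < sigma x.
Hypothesis Apq : forall x l, 0 < l ->
  l `^ (alpha - n%:R) * fine (\int[vol]_(y in cube x l) (w y)%:E) `^ q^-1 *
  fine (\int[vol]_(y in cube x l) (sigma y)%:E) `^ (1 - p^-1) <= K.

(** The factors are, in order, the constant in kernel_le_cover, that in
    sum_powR_le, the number of grids and the constant for one grid. *)
Definition riesz_const : R :=
  (6 `^ (n%:R - alpha)) `^ q * #|{ffun 'I_n -> bool}|%:R `^ q *
  (#|{ffun 'I_n -> bool}|%:R *
   discrete_const cw p q K (2 `^ alpha / (2 `^ alpha - 1))).

Variable f : euclid R n -> R.
Hypothesis mf : measurable_fun setT f.
Hypothesis fB : (\int[vol]_x (`|f x| `^ p * sigma x `^ (1 - p))%:E < +oo)%E.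

Let q0 : 0 < q. Proof. exact: lt_le_trans (lt_trans ltr01 p1) pq. Qed.
Let F x := `|f x|.
Let mF : measurable_fun setT F.
Proof. exact: measurableT_comp mf. Qed.
Let F0 x : 0 <= F x. Proof. exact: normr_ge0. Qed.

Let H k x := grids_operator (mesh k) k.*2 alpha F x.
Let b := fine (\int[vol]_x (F x `^ p * sigma x `^ (1 - p))%:E).

Let gop_ge0 k t x :
  0 <= grid_operator (grid_corner (mesh k) k.*2 t) (mesh k) k.*2 alpha F x.
Proof.
apply: step_function_ge0 => om; apply: sumr_ge0 => j _; rewrite mulr_ge0 ?powR_ge0//.
by rewrite fine_ge0// integral_ge0E.
Qed.

Let mgop k t : measurable_fun setT
  (grid_operator (grid_corner (mesh k) k.*2 t) (mesh k) k.*2 alpha F).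
Proof. exact: measurable_step_function. Qed.

Let mH k : measurable_fun setT (H k).
Proof.
apply: measurable_funM; first exact: measurable_cst.
by apply: measurable_sum => t; exact: mgop.
Qed.

Let mHw k : measurable_fun setT (fun x => (H k x `^ q * w x)%:E).
Proof.
apply/measurable_EFinP; apply: measurable_funM; last exact: mw.
exact: (measurableT_comp (measurable_powR q) (mH k)).
Qed.

Let integral_H_le k : (\int[vol]_x (H k x `^ q * w x)%:E <=
  (riesz_const * b `^ (q / p))%:E)%E.
Proof.
pose op t := grid_operator (grid_corner (mesh k) k.*2 t) (mesh k) k.*2 alpha F.
pose c1 : R := (6 `^ (n%:R - alpha)) `^ q * #|{ffun 'I_n -> bool}|%:R `^ q.
have c10 : 0 <= c1 by rewrite mulr_ge0 ?powR_ge0.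
have mt t : measurable_fun setT (fun x => (op t x `^ q * w x)%:E).
  apply/measurable_EFinP; apply: measurable_funM; last exact: mw.
  exact: (measurableT_comp (measurable_powR q) (mgop k t)).
have t0 t x : (0 <= (op t x `^ q * w x)%:E)%E.
  by rewrite lee_fin mulr_ge0 ?powR_ge0.
apply: (@le_trans _ _ (\int[vol]_x (c1%:E * \sum_(t <- enum {ffun 'I_n -> bool})
    (op t x `^ q * w x)%:E))%E).
  apply: le_integral_pointwise => x _; rewrite big_enum/= sumEFin -EFinM lee_fin.
  rewrite -mulr_suml mulrA ler_wpM2r// /H /grids_operator powRM ?powR_ge0//; last first.
    by rewrite sumr_ge0.
  by rewrite /c1 -mulrA ler_wpM2l ?powR_ge0// sum_powR_le.
rewrite ge0_integralZl_EFin; last 4 first.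
- exact: measurableT.
- by move=> x _; apply: sume_ge0 => t _; exact: t0.
- by apply: emeasurable_sum => t; exact: mt.
- exact: c10.
rewrite /riesz_const -/c1 -[X in (_ <= X%:E)%E]mulrA [X in (_ <= X)%E]EFinM lee_wpmul2l ?lee_fin//.
rewrite ge0_integral_sum; last 3 first.
- exact: measurableT.
- exact: mt.
- by move=> t x _; exact: t0.
rewrite big_enum/= -mulrA mulr_natl -sumr_const -sumEFin.
apply: lee_sum => t _.
exact: (grid_two_weight _ k.*2 (mesh_gt0 k) p1 pq alpha0 cw0 K0 mw w0 gw msigma
  sigma0 gsigma mN N0 sigmaN Apq mF F0 fB).
Qed.

Let riesz_abs_le x : (`|riesz alpha f x| <=
  \int[vol]_y (F y / eudist x y `^ (n%:R - alpha))%:E)%E.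
Proof.
apply: (le_trans (le_abse_integral vol measurableT _)).
  by apply/measurable_EFinP; exact: measurable_riesz_kernel.
apply: le_integral_pointwise => y _.
by rewrite lee_fin normrM [`|_^-1|]ger0_norm// invr_ge0 powR_ge0.
Qed.

(** Any number below the value of the operator at x is eventually exceeded by
    the operators on the grids; the positive factor w x transfers this to the
    weighted powers, including infinite values. *)
Lemma riesz_pointwise x : ~ N x ->
  (`|riesz alpha f x| `^ q * (w x)%:E <=
   limn_einf (fun k => (H k x `^ q * w x)%:E))%E.
Proof.
move=> /wN wx; have finf k t (om : {ffun 'I_n -> 'I_(2 ^ k.*2)}) :
    (\int[vol]_(x in box (grid_corner (mesh k) k.*2 t) (mesh k) 0 om) (F x)%:E < +oo)%E.
  exact: (atom_integral_fin _ (mesh_gt0 k) p1 msigma sigma0 gsigma mN N0 sigmaN mF F0 fB).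
have ge rho : 0 <= rho -> (rho%:E < `|riesz alpha f x|)%E ->
    ((rho `^ q * w x)%:E <= limn_einf (fun k => (H k x `^ q * w x)%:E))%E.
  move=> rho0 Hrho.
  have [k0 Hk0] := riesz_lt_grids alphan mF F0 finf (lt_le_trans Hrho (riesz_abs_le x)).
  apply: (@limn_einf_ge _ _ _ k0) => k /Hk0 Hk.
  rewrite lee_fin ler_wpM2r ?(ltW wx)//.
  by apply: ler_powR_base; [exact: ltW|exact: rho0|exact: ltW].
have L0 : (0 <= limn_einf (fun k => (H k x `^ q * w x)%:E))%E.
  by apply: (@limn_einf_ge _ _ _ 0%N) => k _; rewrite lee_fin mulr_ge0 ?powR_ge0.
rewrite leNgt; apply/negP; move: ge L0.
set l := limn_einf _; have := abse_ge0 (riesz alpha f x).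
case: (`|riesz alpha f x|)%E => [r||]//; case: l => [v||]//=.
- rewrite !lee_fin => r0 ge v0; rewrite ?poweR_EFin -?EFinM lte_fin => Hv.
  (* A value strictly between the lower limit v and the weighted power,
     written as rho^q w x with rho below the operator. *)
  pose v' := (v + r `^ q * w x) / 2.
  have v'v : v < v' by rewrite /v'; lra.
  have v'r : v' < r `^ q * w x by rewrite /v'; lra.
  have v'0 : 0 <= v' by lra.
  pose rho := (v' / w x) `^ q^-1.
  have rhoq : rho `^ q * w x = v'.
    rewrite /rho -powRrM mulVf ?gt_eqF// powRr1; last exact: divr_ge0 v'0 (ltW wx).
    by rewrite divfK ?gt_eqF.
  have := ge rho (powR_ge0 _ _); rewrite rhoq => H1.
  have : (rho%:E < r%:E)%E.
    rewrite lte_fin ltNge; apply/negP => rr.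
    have : r `^ q * w x <= v'.
      by rewrite -rhoq ler_wpM2r ?(ltW wx)// ler_powR_base// ltW.
    lra.
  by move=> /H1; rewrite lee_fin; lra.
- move=> _ ge v0 _; move: v0; rewrite lee_fin => v0.
  pose rho := ((v + 1) / w x) `^ q^-1.
  have rhoq : rho `^ q * w x = v + 1.
    rewrite /rho -powRrM mulVf ?gt_eqF// powRr1 ?divr_ge0 ?(ltW wx)//; last by lra.
    by rewrite divfK ?gt_eqF.
  have := ge rho (powR_ge0 _ _) (ltry _); rewrite rhoq lee_fin; lra.
- by move=> _ _ _; rewrite ltNge leey.
Qed.

(** Fatou's lemma in x. It is stated for any Phi below the weighted power off
    N, because there the weights of the theorem may be infinite while w is
    not. *)
Lemma riesz_two_weight (Phi : euclid R n -> \bar R) :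
  (forall x, ~ N x -> (Phi x <= `|riesz alpha f x| `^ q * (w x)%:E)%E) ->
  (\int[vol]_x Phi x <= (riesz_const * b `^ (q / p))%:E)%E.
Proof.
move=> HPhi.
pose Linf x := limn_einf (fun k => (H k x `^ q * w x)%:E).
have mL : measurable_fun setT Linf.
  by apply: measurable_limn_einf => k; exact: mHw.
pose Psi x := if x \in N then +oo%E else Linf x.
have mPsi : measurable_fun setT Psi.
  apply: measurable_fun_ifT; [|exact: measurable_cst|exact: mL].
  apply: (measurable_fun_bool true).
  rewrite setTI (_ : _ @^-1` _ = N)//; apply/seteqP; split => y /=.
    by move=> /set_mem.
  by move=> Ny; rewrite mem_set.
apply: (@le_trans _ _ (\int[vol]_x Psi x)%E).
  apply: le_integral_pointwise => x _; rewrite /Psi; case: ifPn => [_|xN]; first exact: leey.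
  have nx : ~ N x by move=> Nx; move: xN; rewrite mem_set.
  by apply: (le_trans (HPhi x nx)); exact: riesz_pointwise.
have -> : (\int[vol]_x Psi x = \int[vol]_x Linf x)%E.
  apply: ae_eq_integral => //; exists N; split => // x /=.
  apply: contra_notP => nx _; rewrite /Psi; case: ifPn => // /set_mem //.
apply: le_trans (_ : (limn_einf (fun k => \int[vol]_x (H k x `^ q * w x)%:E) <= _)%E).
  by apply: fatou => // k x _; rewrite lee_fin mulr_ge0 ?powR_ge0.
by apply: limn_einf_le => k; exact: integral_H_le.
Qed.

End riesz_two_weight.

(** * The theorem *)

Lemma half_part_weightW {R : realType} {n : nat} (c c' : R) (u : euclid R n -> R) :
  c <= c' -> half_part_weight c u -> half_part_weight c' u.
Proof.
move=> cc gu x l l0; have [fu H] := gu x l l0; split => // A mA AQ HA.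
have [Ap HA'] := H A mA AQ HA; split => //.
by apply: (le_trans HA'); rewrite lee_wpmul2r ?lee_fin// ltW.
Qed.

Lemma uweight_two_pow {R : realType} {n : nat} (E : set (euclid R n)) (g1 g2 : R) x :
  0 < fine (diam E) -> dist_to E x != 0 ->
  uweight E g1 g2 x = (two_pow g1 g2 (dist_to E x / fine (diam E)))%:E.
Proof.
move=> D0 dx; have dD : dist_to E x / fine (diam E) != 0.
  by rewrite mulf_neq0// invr_neq0// gt_eqF.
by rewrite /uweight /two_pow ltr_pdivrMr// mul1r; case: ifP => _; rewrite powReE.
Qed.

Lemma powR_le_powRe {R : realType} (a r : R) : ((a `^ r)%:E <= powRe a r)%E.
Proof. by rewrite /powRe; case: ifP => // _; exact: leey. Qed.

Lemma uweight_ge0 {R : realType} {n : nat} (E : set (euclid R n)) (g1 g2 : R) x :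
  (0 <= uweight E g1 g2 x)%E.
Proof. by rewrite /uweight; case: ifP => _; exact: powRe_ge0. Qed.

(** On the closure of E the weight of the theorem may be infinite, so only an
    inequality holds; it is in the direction needed on the right-hand side. *)
Lemma two_pow_le_uweight {R : realType} {n : nat} (E : set (euclid R n)) (g1 g2 : R) x :
  0 < fine (diam E) ->
  ((two_pow g1 g2 (dist_to E x / fine (diam E)))%:E <= uweight E g1 g2 x)%E.
Proof.
move=> D0; rewrite /uweight /two_pow ltr_pdivrMr// mul1r.
by case: ifP => _; exact: powR_le_powRe.
Qed.

Theorem theorem1p1 (R : realType) (n : nat) (p q alpha : R)
    (E : set (euclid R n)) :
  (0 < n)%N ->
  1 < p -> p <= q ->
  0 < alpha -> alpha < n%:R ->
  0 < Theta n p q alpha ->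
  (0 < diam E)%E -> (diam E < +oo)%E ->
  median_porous E ->
  forall gamma1 gamma2 delta1 delta2 : R,
  I_infty E (- gamma1) -> I_infty E (- gamma2) ->
  I_infty E (delta1 * conj_exp p / p) -> I_infty E (delta2 * conj_exp p / p) ->
  (upper_minkowski_dim E - n%:R%:E <
    (n%:R / Theta n p q alpha * (gamma1 / q - delta1 / p))%:E)%E ->
  n%:R / Theta n p q alpha * (gamma1 / q - delta1 / p) < 0 ->
  delta2 / p - gamma2 / q = Theta n p q alpha ->
  exists C : R, 0 < C /\
    forall f : euclid R n -> R,
      measurable_fun [set: euclid R n] f ->
      ((\int[vol]_x (`|riesz alpha f x| `^ q * uweight E gamma1 gamma2 x))
          `^ q^-1 <=
       C%:E * (\int[vol]_x ((`|f x| `^ p)%:E * uweight E delta1 delta2 x))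
          `^ p^-1)%E.
Proof.
move=> n0 p1 pq alpha0 alphan Th0 diam0 diamy [beta [beta0 Ib]] g1 g2 d1 d2.
move=> Ig1 Ig2 Id1 Id2 dimE kneg glob.
set th := Theta n p q alpha in Th0 dimE kneg glob *.
pose D := fine (diam E).
have diamE : diam E = D%:E by rewrite /D fineK// gt0_fin_numE.
have D0 : 0 < D by rewrite -lte_fin -diamE.
have nR : 0 < n%:R :> R by rewrite ltr0n.
have p0 : 0 < p by lra.
have q0 : 0 < q by lra.
have p10 : 0 < p - 1 by lra.
pose kappa := - (n%:R / th * (g1 / q - d1 / p)).
have kappa0 : 0 < kappa by rewrite oppr_gt0.
have dimE' : (upper_minkowski_dim E < (n%:R - kappa)%:E)%E.
  by move: dimE; rewrite lteBlDr// -EFinD /kappa opprK addrC.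
have md := measurable_dist_to beta0 Ib.
have dnull := vol_dist_to_eq0 beta0 Ib.
have d0 := dist_to_ge0 E.
pose s1 := - (d1 * conj_exp p / p); pose s2 := - (d2 * conj_exp p / p).
have ag1 := admissible_I_infty beta0 Ib Ig1.
have ag2 := admissible_I_infty beta0 Ib Ig2.
have as1 : admissible (dist_to E) s1 by apply: (admissible_I_infty beta0 Ib); rewrite opprK.
have as2 : admissible (dist_to E) s2 by apply: (admissible_I_infty beta0 Ib); rewrite opprK.
have sE d : - (d * conj_exp p / p) * (1 - p^-1) = - (d / p).
  by rewrite /conj_exp; field; rewrite !gt_eqF.
(* sigma^(1 - p) is the weight on the right-hand side because (1 - p')(1 - p)
   = 1. *)
have sE' d : - (d * conj_exp p / p) * (1 - p) = d.
  by rewrite /conj_exp; field; rewrite !gt_eqF.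
have loc1 : g1 * q^-1 + s1 * (1 - p^-1) = - (kappa / n%:R * th).
  by rewrite /s1 sE /kappa; field; rewrite !gt_eqF.
have loc2 : g2 * q^-1 + s2 * (1 - p^-1) = - th.
  by rewrite /s2 sE -glob; ring.
have [K [K0 Apq]] := cube_Apq D0 beta0 Ib n0 p1 q0 Th0 diamE kappa0 dimE' ag1 ag2 as1 as2 loc1 loc2.
pose w x := two_pow g1 g2 (dist_to E x / D).
pose sigma x := two_pow s1 s2 (dist_to E x / D).
have [c1 [c10 gw1]] := half_part_two_pow D0 beta0 Ib ag1 ag2.
have [c2 [c20 gs1]] := half_part_two_pow D0 beta0 Ib as1 as2.
pose cw := c1 + c2; have cw0 : 0 < cw by exact: addr_gt0.
have gw : half_part_weight cw w by apply: half_part_weightW gw1; rewrite lerDl ltW.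
have gs : half_part_weight cw sigma by apply: half_part_weightW gs1; rewrite lerDr ltW.
have mw : measurable_fun setT w by exact/measurable_EFinP/measurable_two_pow.
have ms : measurable_fun setT sigma by exact/measurable_EFinP/measurable_two_pow.
pose N := [set x | dist_to E x = 0].
have mN : measurable N by exact: measurable_dist_eq0.
have dN x : ~ N x -> dist_to E x != 0 by move=> /eqP.
have dpos x : ~ N x -> 0 < dist_to E x / D.
  by move=> /dN nx; rewrite divr_gt0// lt_neqAle eq_sym nx d0.
pose C0 := riesz_const (n := n) p q alpha cw K.
have C00 : 0 < C0.
  have M0 : 0 < #|{ffun 'I_n -> bool}|%:R :> R.
    by rewrite ltr0n; apply/card_gt0P; exists [ffun=> true].
  have r1 : 1 < 2 `^ alpha :> R.
    by rewrite /powR gt_eqF// expR_gt1 mulr_gt0// ln_gt0// ltr1n.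
  rewrite /C0 /riesz_const; apply: mulr_gt0.
    by rewrite mulr_gt0// powR_gt0// powR_gt0.
  apply: mulr_gt0 => //; apply: (discrete_const_gt0 p1 pq cw0 K0).
  by rewrite divr_gt0 ?powR_gt0// subr_gt0.
exists (C0 `^ q^-1); split; first exact: powR_gt0.
move=> f mf.
set B := (\int[vol]_x ((`|f x| `^ p)%:E * uweight E d1 d2 x))%E.
pose g x := `|f x| `^ p * sigma x `^ (1 - p).
have gB : (\int[vol]_x (g x)%:E <= B)%E.
  apply: le_integral_pointwise => x _; rewrite /g EFinM lee_wpmul2l ?lee_fin ?powR_ge0//.
  rewrite /sigma two_powX /s1 /s2 !sE'; exact: two_pow_le_uweight.
have g0 : (0 <= \int[vol]_x (g x)%:E)%E.
  by apply: integral_ge0 => x _; rewrite lee_fin mulr_ge0 ?powR_ge0.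
(* An infinite right-hand side leaves nothing to prove; otherwise f is locally
   integrable and the estimate for finite norms applies. *)
have [By|Bfin] := eqVneq B +oo%E.
  rewrite By poweRyr ?invr_neq0 ?gt_eqF// gt0_muley ?leey// lte_fin.
  exact: powR_gt0.
have gfin : (\int[vol]_x (g x)%:E < +oo)%E by rewrite (le_lt_trans gB)// ltey.
pose b := fine (\int[vol]_x (g x)%:E).
have bE : (\int[vol]_x (g x)%:E = b%:E)%E by rewrite /b fineK// ge0_fin_numE.
have b0 : 0 <= b by rewrite fine_ge0.
have main : (\int[vol]_x (`|riesz alpha f x| `^ q * uweight E g1 g2 x) <=
    (C0 * b `^ (q / p))%:E)%E.
  apply: (riesz_two_weight p1 pq alpha0 alphan cw0 K0 mw _ gw ms _ gs mN dnull _ _ Apq mf gfin).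
  - by move=> x; exact: two_pow_ge0.
  - by move=> x; exact: two_pow_ge0.
  - by move=> x nx; apply: two_pow_gt0; exact: dpos.
  - by move=> x nx; apply: two_pow_gt0; exact: dpos.
  - by move=> x nx; rewrite uweight_two_pow//; exact: dN.
have LHS0 : (0 <= \int[vol]_x (`|riesz alpha f x| `^ q * uweight E g1 g2 x))%E.
  by apply: integral_ge0 => x _; rewrite mule_ge0 ?poweR_ge0 ?uweight_ge0.
have pV0 : 0 <= p^-1 by rewrite invr_ge0 ltW.
have qV0 : 0 <= q^-1 by rewrite invr_ge0 ltW.
apply: (@le_trans _ _ ((C0 * b `^ (q / p))%:E `^ q^-1)%E).
  apply: gt0_ler_poweR; [exact: qV0| | |exact: main].
    by rewrite in_itv/= leey andbT.
  by rewrite in_itv/= leey andbT (le_trans LHS0).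
rewrite poweR_EFin powRM ?powR_ge0 ?(ltW C00)// -powRrM.
rewrite (_ : q / p * q^-1 = p^-1); last by field; rewrite !gt_eqF.
rewrite EFinM lee_wpmul2l ?lee_fin ?powR_ge0// -poweR_EFin.
apply: gt0_ler_poweR; first exact: pV0.
- by rewrite in_itv/= leey andbT lee_fin.
- by rewrite in_itv/= leey andbT; exact: le_trans gB.
- by rewrite -bE.
Qed.
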